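(* There is an absolute constant $c$ such that for every integer $r\ge 3$, if $H$ is the disjoint union of $r$ cycles, then $$f(H)\le \frac{3|V(H)|}{2}+c\,r^2\log r.$$ Moreover, if $H$ is the disjoint union of two cycles, then $$f(H)<|V(H)|+\frac{9}{2}\left\lceil\sqrt{4+|V(H)|}\,\right\rceil+2.$$
   Context: Graphs are finite and simple. For a planar graph $H$, $f(H)$ denotes the minimum integer such that every graph with no minor isomorphic to $H$ has treewidth at most $f(H)$ (it exists by a theorem of Robertson and Seymour). The cycles in the disjoint union may have different lengths. $\log$ is the natural logarithm. *)

(* Defs.v *)
From HB Require Import structures.
From mathcomp Require Import all_boot all_order all_algebra.
From mathcomp Require Import boolp reals exp.
Set Implicit Arguments.
Unset Strict Implicit.
Unset Printing Implicit Defensive.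

Record sgraph := SGraph {
  vertex :> finType;
  adj : rel vertex;
  adj_sym : symmetric adj;
  adj_irr : irreflexive adj }.

Definition iso (G H : sgraph) : Prop :=
  exists2 phi : G -> H, bijective phi
    & forall x y, adj (phi x) (phi y) = adj x y.

(* The empty set is not connected. *)
Definition connected_set (G : sgraph) (A : {set G}) : Prop :=
  A != set0 /\
  {in A &, forall x y,
     connect [rel u v | [&& u \in A, v \in A & adj u v]] x y}.

(* The condition on sizes excludes the closed walks [:: x; y] along one edge. *)
Definition acyclic (G : sgraph) : Prop :=
  forall p : seq G, 2 < size p -> ~ ucycle (@adj G) p.

Definition is_tree (T : sgraph) : Prop :=
  connected_set [set: T] /\ acyclic T.

(* [minor H G]: G has a minor isomorphic to H.  [B x] is the branch set of x,
   that is, the set of vertices of G contracted to x. *)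
Definition minor (H G : sgraph) : Prop :=
  exists B : H -> {set G},
    [/\ forall x, connected_set (B x),
        forall x y, x != y -> [disjoint B x & B y]
      & forall x y, adj x y ->
          exists u v, [/\ u \in B x, v \in B y & adj u v]].

(* Vertices are covered by the third condition, as [connected_set] includes
   nonemptiness. *)
Definition tree_decomposition (G T : sgraph) (B : T -> {set G}) : Prop :=
  [/\ is_tree T,
      forall x y : G, adj x y -> exists t, (x \in B t) && (y \in B t)
    & forall x : G, connected_set [set t | x \in B t]].

(* The graph with no vertices gets width 0 rather than -1. *)
Definition width (G T : sgraph) (B : T -> {set G}) : nat :=
  (\max_(t : T) #|B t|).-1.

Definition has_width (G : sgraph) (n : nat) : Prop :=
  exists (T : sgraph) (B : T -> {set G}),
    tree_decomposition B /\ width B = n.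

Lemma unit_adj_sym : symmetric (fun _ _ : unit => false).
Proof. by []. Qed.

Lemma unit_adj_irr : irreflexive (fun _ : unit => fun _ : unit => false).
Proof. by []. Qed.

Definition one_vertex : sgraph := SGraph unit_adj_sym unit_adj_irr.

Lemma has_width_ex (G : sgraph) : exists n, `[< has_width G n >].
Proof.
pose B (t : one_vertex) := [set: G].
have conn (A : {set one_vertex}) : tt \in A -> connected_set A.
  move=> ttA; split; first by apply/set0Pn; exists tt.
  by move=> [] [] _ _; exact: connect0.
exists (width B); apply/asboolP; exists one_vertex, B; split=> //; split.
- split; first by apply: conn; rewrite inE.
  by move=> [|x [|y p]] //= _ /andP[].
- by move=> x y _; exists tt; rewrite !inE.
- by move=> x; apply: conn; rewrite !inE.
Qed.

Definition treewidth (G : sgraph) : nat := ex_minn (has_width_ex G).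

(* [is_f H k]: k is the minimum integer such that every graph with no minor
   isomorphic to H has treewidth at most k.  This is a relation because such a
   k exists only for planar H.  Natural numbers suffice: treewidths are
   nonnegative except for the graph with no vertices. *)
Definition minor_free_treewidth_le (H : sgraph) (k : nat) : Prop :=
  forall G : sgraph, ~ minor H G -> treewidth G <= k.

Definition is_f (H : sgraph) (k : nat) : Prop :=
  minor_free_treewidth_le H k /\
  forall k', minor_free_treewidth_le H k' -> k <= k'.

(* [ordS i] is i + 1 modulo n; [cycle_graph n] is a cycle only for n >= 3. *)
Definition cycle_adj (n : nat) : rel 'I_n :=
  fun i j => (i != j) && ((j == ordS i) || (i == ordS j)).

Lemma cycle_adj_sym n : symmetric (@cycle_adj n).
Proof. by move=> i j; rewrite /cycle_adj eq_sym orbC. Qed.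

Lemma cycle_adj_irr n : irreflexive (@cycle_adj n).
Proof. by move=> i; rewrite /cycle_adj eqxx. Qed.

Definition cycle_graph (n : nat) : sgraph :=
  SGraph (@cycle_adj_sym n) (@cycle_adj_irr n).

Definition union_adj (I : finType) (G : I -> sgraph) : rel {i : I & G i} :=
  fun u v => (tag u == tag v) && adj (tagged u) (tagged_as u v).

Lemma union_adj_sym (I : finType) (G : I -> sgraph) :
  symmetric (@union_adj I G).
Proof.
move=> [i x] [j y]; rewrite /union_adj /=; case: (eqVneq i j) => // eqij.
by case: j / eqij y => y; rewrite !tagged_asE adj_sym.
Qed.

Lemma union_adj_irr (I : finType) (G : I -> sgraph) :
  irreflexive (@union_adj I G).
Proof. by move=> [i x]; rewrite /union_adj /= tagged_asE adj_irr andbF. Qed.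

Definition disjoint_union (I : finType) (G : I -> sgraph) : sgraph :=
  SGraph (@union_adj_sym I G) (@union_adj_irr I G).

Definition disjoint_union_of_cycles (r : nat) (H : sgraph) : Prop :=
  exists l : 'I_r -> nat,
    (forall i, 3 <= l i) /\
    iso H (disjoint_union (fun i => cycle_graph (l i))).

(* Main.v *)
Require Import Defs.
From HB Require Import structures.
From mathcomp Require Import all_boot all_order all_algebra.
From mathcomp Require Import boolp reals exp.
From mathcomp Require Import zify lra.
Set Implicit Arguments.
Unset Strict Implicit.
Unset Printing Implicit Defensive.

(**
Treewidth is dual to brambles: if every bramble of G is covered by at most
k + 1 vertices, then the treewidth of G is at most k ([treewidth_le_bramble]).
Hence it suffices to find the disjoint cycles, as minors, in a graph with a
bramble all of whose covers are large; the least size of a cover is called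
the order of the bramble.

The hub.  Some path P meets all members of the bramble ([covering_path]).
Along P, the order of the family of the members that avoid an initial segment
drops by at most one at each vertex, so P can be cut where this order is
exactly u.  The members avoiding P then lie in one component U of G - P, the
hub.  A part X of P has rank at least m if fewer than m vertices never cut X
off from these members; two disjoint parts of rank at least m are joined by m
disjoint paths through U ([linked], by Menger's theorem).  If all vertices of
P with neighbours in U lie in a set S0 or in parts cut off by sets S1, S2, S3
with fewer than u vertices together, then these sets and a cover of size u of
the members avoiding P cover the whole bramble ([cover_blocked]).  So, if the
order is large, whatever remains of P after removing a few vertices and parts
that are only just cut off has large rank.  In particular P can be divided
into consecutive segments A, I, Z, J such that A and Z are minimal of rank at
least q and I has l - 2 vertices.  Every path from A to Z through U then
closes a cycle of length at least l with P.

Many cycles ([many_cycles]).  The cycles are found one by one, the longest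
first.  Take q of order r log r, with J empty, and consider q disjoint paths
from A to Z through U.  If one of them has at most l / 2 inner vertices,
rounded up, then P and this path contain a cycle of length l; deleting both
reduces the order by 3 l / 2 + O(q), and the induction continues.  Otherwise
all are long.  Cutting A and Z into blocks of eight ends and contracting the
blocks gives a multigraph with four times as many edges as vertices and with
bounded degrees.  Growing balls, one finds in it a subgraph with O(log r)
vertices and at least as many edges as vertices ([short_dense]); this can be
repeated to get r disjoint ones ([many_short]).  Each contains a cycle, which
uses two of the long paths, and so has length at least l in G
([span_cycle]).

Two cycles ([two_cycles]).  Now l1 >= l2 and I has l1 - 2 vertices.  The
paths from A to Z through U are called columns: each closes a cycle of length
at least l1.  Among the vertices of J with neighbours in U, let t be the
first, b the last, and let JL and JR be all but the last, respectively all
but the first, l2 - 2 of them.  Both have rank at least p, so that p disjoint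
paths in U, the rows, join their neighbourhoods.  A connected part of U
between t and JR, or between JL and b, closes a cycle of length at least l2
with J; so, unless two disjoint cycles exist, it meets every column.  This
replaces planarity: the columns are linearly ordered as separators of t from
b, and beyond the first column the rows are linearly ordered as separators of
A from Z ([chain]).  A path can then snake through all the other columns,
leaving them alternately along the last and along the first row ([snake]).
It meets all rows in each column, so it has at least l2 - 1 vertices if there
are 2 j of them with l2 <= 2 j p + 1.  The column that leaves A last may be
assumed to be the first one; then the rest of A closes the path to a cycle
that is disjoint from the cycle of the first column.  With n = l1 + l2 and s
the square root of 4 + n rounded up, p = s and j = s / 4 rounded up suffice,
and the treewidth is at most n + 8 j + 2 p - 4.
*)

(** * Sets that meet *)

Section Meets.
Variable T : finType.
Implicit Types A B C : {set T}.

Definition meets A B := A :&: B != set0.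

Lemma meetsP A B : reflect (exists2 x, x \in A & x \in B) (meets A B).
Proof.
apply: (iffP (set0Pn _)) => [[x /setIP[? ?]]|[x ? ?]]; exists x => //.
exact/setIP.
Qed.

Lemma meetsI x A B : x \in A -> x \in B -> meets A B.
Proof. by move=> ? ?; apply/meetsP; exists x. Qed.

Lemma meetsC A B : meets A B = meets B A.
Proof. by rewrite /meets setIC. Qed.

Lemma meetsS A B C (D : {set T}) : meets A B -> A \subset C -> B \subset D -> meets C D.
Proof.
by case/meetsP=> x xA xB /subsetP s /subsetP s'; apply: (@meetsI x); auto.
Qed.

Lemma meetsUl A B C : meets (A :|: B) C = meets A C || meets B C.
Proof. by rewrite /meets setIUl setU_eq0 negb_and. Qed.

Lemma meets1l x A : meets [set x] A = (x \in A).
Proof.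
apply/meetsP/idP => [[y /set1P ->]|xA] //.
by exists x; rewrite ?set11.
Qed.

Lemma nmeetsP A B x : ~~ meets A B -> x \in A -> x \notin B.
Proof. by move=> h xA; apply: contra h => /(meetsI xA). Qed.

Lemma nmeets_sub A B : ~~ meets A (~: B) -> A \subset B.
Proof.
by move=> h; apply/subsetP => x xA; have := nmeetsP h xA; rewrite inE negbK.
Qed.

Lemma nmeets_disj A B : ~~ meets A B = [disjoint A & B].
Proof. by rewrite /meets negbK setI_eq0. Qed.
End Meets.

(** * Connected sets *)

Section Conn.
Variable T : finType.
Implicit Types (A B C D S X Y : {set T}) (e : rel T).

Definition restr e A u v := [&& u \in A, v \in A & e u v].
Arguments restr e A u v /.

(** For the adjacency of a graph this is [connected_set]; the relation is a
    parameter because vertices and edges get deleted. *)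
Definition conn e A : Prop :=
  A != set0 /\ {in A &, forall x y, connect (restr e A) x y}.

Lemma restrS e A B : A \subset B -> subrel (restr e A) (restr e B).
Proof.
move=> /subsetP sAB x y /= /and3P[xA yA exy].
by rewrite (sAB x) ?(sAB y).
Qed.

Lemma restr_connectS e A B :
  A \subset B -> subrel (connect (restr e A)) (connect (restr e B)).
Proof.
move=> sAB; apply: connect_sub => x y h.
exact/connect1/(restrS sAB).
Qed.

Lemma restr_path e A x p : x \in A ->
  path (restr e A) x p = path e x p && all (mem A) p.
Proof.
elim: p x => //= y p IH x xA; rewrite xA /=.
case yA: (y \in A); last by rewrite ?andbF.
by rewrite IH //= andbA.
Qed.

Lemma conn_ex e A : conn e A -> exists x, x \in A.
Proof. by case=> /set0Pn. Qed.

Lemma conn1 e x : conn e [set x].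
Proof.
split; first by apply/set0Pn; exists x; rewrite set11.
by move=> y z /set1P -> /set1P ->.
Qed.

Section Sym.
Variable e : rel T.
Hypothesis e_sym : symmetric e.

Lemma restr_sym A : symmetric (restr e A).
Proof. by move=> x y /=; rewrite e_sym; case: (x \in A); case: (y \in A). Qed.

Lemma restr_csym A : connect_sym (restr e A).
Proof. exact/sym_connect_sym/restr_sym. Qed.

Lemma conn_from A x : x \in A ->
  (forall y, y \in A -> connect (restr e A) x y) -> conn e A.
Proof.
move=> xA h; split; first by apply/set0Pn; exists x.
move=> y z yA zA; apply: (connect_trans (y := x)); last exact: h.
by rewrite restr_csym h.
Qed.

Lemma connU A B : conn e A -> conn e B -> meets A B -> conn e (A :|: B).
Proof.
move=> [_ cA] [_ cB] /meetsP[x xA xB].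
apply: (@conn_from _ x); first by rewrite inE xA.
move=> y /setUP[yA|yB].
- by apply: (restr_connectS (subsetUl A B)); apply: cA.
- by apply: (restr_connectS (subsetUr A B)); apply: cB.
Qed.

Lemma connE A B x y : conn e A -> conn e B -> x \in A -> y \in B -> e x y ->
  conn e (A :|: B).
Proof.
move=> cA cB xA yB exy.
have c2 : conn e [set x; y].
  apply: (@conn_from _ x); first by rewrite !inE eqxx.
  move=> z; rewrite !inE => /orP[] /eqP -> //.
  by apply/connect1 => /=; rewrite !inE !eqxx orbT.
have c3 : conn e (A :|: [set x; y]).
  by apply: connU => //; apply: (@meetsI _ x) => //; rewrite !inE eqxx.
have -> : A :|: B = (A :|: [set x; y]) :|: B.
  apply/setP => z; rewrite !inE; case zA: (z \in A) => //=.
  case: (z =P x) => [zx|_]; first by rewrite zx xA in zA.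
  by case: (z =P y) => [->|_].
apply: connU => //; apply: (@meetsI _ y) => //.
by rewrite !inE eqxx !orbT.
Qed.

Lemma conn_path x p : path e x p -> conn e [set z in x :: p].
Proof.
elim/last_ind: p => [|p y IH].
  move=> _; have -> : [set z in [:: x]] = [set x] by apply/setP=> z; rewrite !inE.
  exact: conn1.
rewrite rcons_path => /andP[/IH c exy].
have -> : [set z in x :: rcons p y] = [set z in x :: p] :|: [set y].
  by apply/setP => z; rewrite !inE mem_rcons inE; case: eqP; rewrite ?orbT //= orbC.
apply: connE (conn1 e y) _ _ exy => //; last exact: set11.
by rewrite inE mem_last.
Qed.

Lemma conn_cross A X : conn e A -> meets A X -> ~~ (A \subset X) ->
  exists x y, [/\ x \in A, y \in A, x \in X, y \notin X & e x y].
Proof.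
move=> [_ cA] /meetsP[x xA xX] /subsetPn[y yA yX].
have /connectP[p] := cA _ _ xA yA; rewrite restr_path // => /andP[].
elim: p x xA xX => [|z p IH] x xA xX /=; first by move=> _ _ ?; subst; rewrite xX in yX.
move=> /andP[exz pz] /andP[zA pA] yE.
case zX: (z \in X); first exact: (IH z).
by exists x, z; rewrite zX.
Qed.

Lemma conn_subX A X : conn e A -> meets A X ->
  (forall x y, x \in A -> y \in A -> x \in X -> e x y -> y \in X) -> A \subset X.
Proof.
move=> cA mX h; apply/negPn/negP => /(conn_cross cA mX)[x [y [xA yA xX yX exy]]].
by move: yX; rewrite (h x y).
Qed.

Lemma conn_upath A x y : conn e A -> x \in A -> y \in A ->
  exists p, [/\ path e x p, last x p = y, uniq (x :: p) & {subset x :: p <= A}].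
Proof.
move=> [_ cA] xA yA; have /connectP[p pp ->] := cA _ _ xA yA.
case/shortenP: pp => p' pp' u _; exists p'; split=> //.
- by move: pp'; rewrite restr_path // => /andP[].
- move: pp'; rewrite restr_path // => /andP[_ /allP h] z.
  by rewrite inE => /predU1P[->|/h].
Qed.

Definition component D x := [set y in D | connect (restr e D) x y].

Lemma component_sub D x : component D x \subset D.
Proof. by apply/subsetP => y; rewrite inE => /andP[]. Qed.

Lemma component_refl D x : x \in D -> x \in component D x.
Proof. by move=> xD; rewrite inE xD connect0. Qed.

Lemma component_max D x A : conn e A -> A \subset D -> x \in A -> A \subset component D x.
Proof.
move=> cA sAD xA; apply/subsetP => y yA; rewrite inE (subsetP sAD) //=.
by apply: (restr_connectS sAD); apply: cA.2.
Qed.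

Lemma component_conn D x : x \in D -> conn e (component D x).
Proof.
move=> xD; apply: (@conn_from _ x); first exact: component_refl.
move=> y; rewrite inE => /andP[_ /connectP[p + ->]].
rewrite restr_path // => /andP[pp /allP pD].
apply/connectP; exists p => //; rewrite restr_path ?component_refl // pp /=.
apply/allP => z zp /=; rewrite inE (pD z zp : z \in D) /=.
case/splitPr: zp pp pD => p1 p2 pp pD.
apply/connectP; exists (rcons p1 z); last by rewrite last_rcons.
rewrite restr_path // -cats1 all_cat cat_path /=.
move: pp; rewrite cat_path /= => /andP[-> /andP[-> _]] /=.
rewrite andbT; apply/andP; split; last by apply: pD; rewrite mem_cat !inE eqxx orbT.
by apply/allP => w w1; apply: pD; rewrite mem_cat w1.
Qed.

Lemma component_closed D x y z : y \in component D x -> z \in D -> e y z -> z \in component D x.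
Proof.
rewrite !inE => /andP[yD cy] zD eyz; rewrite zD /=.
by apply: (connect_trans cy); apply: connect1 => /=; rewrite yD zD.
Qed.

Lemma conn_component D x A : x \in D -> conn e A -> A \subset D ->
  meets A (component D x) -> A \subset component D x.
Proof.
move=> xD cA sAD m; apply: conn_subX => // y z yA zA yC eyz.
by apply: component_closed eyz => //; apply: (subsetP sAD).
Qed.

Definition reach D S := [set y in D | [exists x in S :&: D, connect (restr e D) x y]].

Lemma reachP D S y :
  reflect (exists A, [/\ conn e A, A \subset D, meets A S & y \in A]) (y \in reach D S).
Proof.
rewrite inE; apply: (iffP andP) => [[yD /existsP[x /andP[/setIP[xS xD] c]]]|].
  exists (component D x); split; first exact: component_conn.
  - exact: component_sub.
  - by apply: (@meetsI _ x); rewrite ?component_refl.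
  - by rewrite inE yD.
move=> [A [cA sA /meetsP[x xA xS] yA]]; split; first exact: (subsetP sA).
apply/existsP; exists x; rewrite inE xS (subsetP sA) //=.
by apply: (restr_connectS sA); apply: cA.2.
Qed.

Lemma reach_sub D S : reach D S \subset D.
Proof. by apply/subsetP => y; rewrite inE => /andP[]. Qed.

Lemma reach_conn D S A : conn e A -> A \subset D -> meets A (reach D S) ->
  A \subset reach D S.
Proof.
move=> cA sA /meetsP[x xA /reachP[B [cB sB mB xB]]].
apply/subsetP => y yA; apply/reachP; exists (A :|: B); split.
- by apply: connU => //; apply: (@meetsI _ x).
- by rewrite subUset sA.
- by rewrite meetsUl mB orbT.
- by rewrite inE yA.
Qed.

Lemma reach_conn0 D S A : conn e A -> A \subset D -> meets A S -> A \subset reach D S.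
Proof. by move=> cA sA m; apply/subsetP => y yA; apply/reachP; exists A. Qed.

End Sym.

Lemma conn_rel e e' A : {in A &, subrel e e'} -> conn e A -> conn e' A.
Proof.
move=> s [n c]; split=> // x y xA yA; move: (c x y xA yA).
apply: connect_sub => u v /= /and3P[uA vA euv]; apply/connect1 => /=.
by rewrite uA vA s.
Qed.
End Conn.

(** * Menger's theorem *)

Section Menger.
Variable T : finType.
Implicit Types (A B S X : {set T}) (e : rel T) (p q : seq T).

(** Menger's theorem is stated with all walks from A to B in [separates], and
    with paths that meet A and B only at their ends, the [lpath]s, in the
    linkage; a common vertex of A and B is such a path. *)
Definition abpath e A B p :=
  if p is x :: q then [&& x \in A, path e x q & last x q \in B] else false.

Definition lpath e A B p : Prop :=
  exists x q, [/\ p = x :: q, abpath e A B p, uniq p,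
    forall v, v \in p -> v \in A -> v = x
  & forall v, v \in p -> v \in B -> v = last x q].

(** A walk from A to B that cannot be shortened has distinct vertices and
    meets A and B only at its ends. *)
Lemma abpath_lpath e A B p : abpath e A B p ->
  exists2 q, lpath e A B q & {subset q <= p}.
Proof.
have [n] := ubnP (size p); elim: n p => // n IH p.
case: p => [|x p] // np /and3P[xA pp lB].
have [up|] := boolP (uniq (x :: p)); last first.
  move=> nu; case: (shortenP pp) lB np nu => q pq uq sq lB np nu.
  have qlt : size q < size p.
    rewrite ltn_neqAle; apply/andP; split; last first.
      by apply: uniq_leq_size => //; case/andP: uq.
    apply/eqP => se; move/negP: nu; apply.
    have /= /andP[nq uq'] := uq.
    have [_ eqi] := uniq_min_size uq' sq (eq_leq (esym se)).
    by rewrite /= -eqi nq /= -(eq_uniq se eqi).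
  have [||r lr sr] := IH (x :: q) => //=.
  - by move: np; rewrite /= ltnS; apply: leq_ltn_trans.
  - by rewrite xA pq lB.
  exists r => // v /sr; rewrite !inE => /predU1P[->|/sq ->]; rewrite ?eqxx ?orbT //.
have [/allP hA|/allPn[v vp]] := boolP (all (fun v => (v \in A) ==> (v == x)) (x :: p)); last first.
  rewrite negb_imply => /andP[vA nvx].
  move: vp; rewrite inE (negPf nvx) /= => vp.
  case/splitPr: vp pp lB np {up} => p1 p2; rewrite cat_path last_cat /= => /and3P[_ _ pv] lB np.
  have [||r lr sr] := IH (v :: p2).
  - by move: np; rewrite /= size_cat /=; lia.
  - by rewrite /= vA pv.
  by exists r => // w /sr; rewrite [w \in x :: _]inE mem_cat => ->; rewrite ?orbT.
have [/allP hB|/allPn[v vp]] := boolP (all (fun v => (v \in B) ==> (v == last x p)) (x :: p)); last first.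
  rewrite negb_imply => /andP[vB nvx].
  case: (splitPl vp) pp nvx up lB np hA => p1 p2 lv; rewrite cat_path last_cat lv => /andP[pp1 pp2] nvx up lB np hA.
  have [||r lr sr] := IH (x :: p1).
  - case: p2 nvx np {pp2 up lB hA} => [|w p2]; first by rewrite eqxx.
    by move=> _; rewrite /= size_cat /=; lia.
  - by rewrite /= xA pp1 lv.
  by exists r => // w /sr; rewrite !inE mem_cat => /orP[->//|->]; rewrite ?orbT.
exists (x :: p) => //; exists x, p; split=> //; first by rewrite /= xA pp.
- by move=> v /hA /implyP h /h /eqP.
- by move=> v /hB /implyP h /h /eqP.
Qed.

Definition separates e A B S := forall p, abpath e A B p -> has (mem S) p.

(** Goering's proof, by induction on the number of edges.  If deleting an edge
    (x, y) leaves a separator S with fewer than k vertices, then x |: S and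
    y |: S are separators of the whole graph with exactly k vertices.  By
    induction A is linked to the first and the second to B without using the
    edge.  The two linkages meet only in S, so they can be spliced there, and
    the edge joins the path that ends in x to the path that starts in y. *)
Lemma menger_aux n e A B k :
  #|[set z : T * T | e z.1 z.2]| <= n ->
  (forall S, separates e A B S -> k <= #|S|) ->
  exists f : 'I_k -> seq T,
    (forall i, lpath e A B (f i)) /\
    (forall i j v, v \in f i -> v \in f j -> i = j).
Proof.
elim: n e A B => [|n IH] e A B.
  rewrite leqn0 cards_eq0 => /eqP e0 hS.
  have ef x y : e x y = false.
    by apply/negbTE/negP => h; have /setP/(_ (x, y)) := e0; rewrite !inE h.
  have /hS kle : separates e A B (A :&: B).
    move=> [|x [|y p]] //=; last by rewrite ef andbF.
    by rewrite orbF inE => /andP[-> ->].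
  exists (fun i => [:: enum_val (widen_ord kle i)]); split=> [i|i j v].
    have := enum_valP (widen_ord kle i); rewrite inE => /andP[iA iB].
    exists (enum_val (widen_ord kle i)), [::]; split=> //=; rewrite ?iA ?iB //.
    - by move=> v; rewrite inE => /eqP.
    - by move=> v; rewrite inE => /eqP.
  rewrite !inE => /eqP -> /eqP /enum_val_inj /(congr1 val) /= ij; exact: val_inj.
move=> en hS.
have [e0|] := posnP #|[set z : T * T | e z.1 z.2]|; first by apply: IH => //; rewrite e0.
rewrite card_gt0 => /set0Pn[[x y]]; rewrite inE /= => exy.
pose e' := [rel u v | e u v && ((u, v) != (x, y))].
have e'n : #|[set z : T * T | e' z.1 z.2]| <= n.
  rewrite -ltnS; apply: leq_trans en; apply: proper_card; apply/properP; split.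
    by apply/subsetP => z; rewrite !inE /= => /andP[].
  by exists (x, y); rewrite !inE /= ?exy ?eqxx.
have e'e : subrel e' e by move=> u v /= /andP[].
have [all_k|/existsNP[S /not_implyP[sepS /negP]]] :=
  pselect (forall S, separates e' A B S -> k <= #|S|).
  have [f [f1 f2]] := IH e' A B e'n all_k.
  exists f; split=> // i; have [u [q [E ab U h1 h2]]] := f1 i.
  exists u, q; split=> //; move: ab; rewrite E /= => /and3P[-> pp ->].
  by rewrite (sub_path e'e pp).
rewrite -ltnNge => Sk.
have e'_pathx u p : path e u p -> x \notin belast u p -> path e' u p.
  elim: p u => //= v p IHp u /andP[euv pp]; rewrite inE negb_or => /andP[nu np].
  by rewrite euv xpair_eqE eq_sym (negPf nu) IHp.
have e'_pathy u p : path e u p -> y \notin p -> path e' u p.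
  elim: p u => //= v p IHp u /andP[euv pp]; rewrite inE negb_or => /andP[nu np].
  by rewrite euv xpair_eqE (eq_sym v) (negPf nu) andbF IHp.
have sepx : separates e A B (x |: S).
  move=> [|u p] // /and3P[uA pp lB].
  have [|nx] := boolP (x \in u :: p).
    by move=> h; apply/hasP; exists x => //=; rewrite setU11.
  have : has (mem S) (u :: p).
    apply: sepS; rewrite /= uA lB andbT /=; apply: e'_pathx => //.
    by apply: contra nx => /mem_belast.
  by apply: sub_has => v /=; rewrite inE => ->; rewrite orbT.
have sepy : separates e A B (y |: S).
  move=> [|u p] // /and3P[uA pp lB].
  have [|ny] := boolP (y \in u :: p).
    by move=> h; apply/hasP; exists y => //=; rewrite setU11.
  have : has (mem S) (u :: p).
    apply: sepS; rewrite /= uA lB andbT /=; apply: e'_pathy => //.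
    by apply: contra ny; rewrite inE => ->; rewrite orbT.
  by apply: sub_has => v /=; rewrite inE => ->; rewrite orbT.
have := hS _ sepx; rewrite cardsU1 => kx.
have := hS _ sepy; rewrite cardsU1 => ky.
have nxS : x \notin S by move: kx Sk; case: (x \in S) => //=; lia.
have nyS : y \notin S by move: ky Sk; case: (y \in S) => //=; lia.
have k1 : #|x |: S| = k by rewrite cardsU1 nxS; move: kx Sk; rewrite nxS /=; lia.
have k2 : #|y |: S| = k by rewrite cardsU1 nyS; move: kx Sk; rewrite nxS /=; lia.
have sep1 X : separates e' A (x |: S) X -> k <= #|X|.
  move=> sX; apply: hS => -[|u p] // ab.
  have hx := sepx _ ab; case/and3P: ab => uA pp lB.
  have [v vp [vS vmin]] : exists2 v, v \in u :: p & v \in x |: S /\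
      exists p1 p2, [/\ p = p1 ++ p2, last u p1 = v & ~~ has (mem (x |: S)) (belast u p1)].
    elim: p u hx {uA lB} pp => [|w p IHp] u /=.
      by rewrite orbF => uS _; exists u; [rewrite inE eqxx|split=> //; exists [::], [::]].
    have [uS _ _|nuS /= h /andP[_ pp]] := boolP (u \in x |: S).
      by exists u; [rewrite inE eqxx|split=> //; exists [::], (w :: p)].
    have [v vp [vS [p1 [p2 [E L H]]]]] := IHp w h pp.
    exists v; first by rewrite inE vp orbT.
    by split=> //; exists (w :: p1), p2; rewrite E /= negb_or nuS.
  case: vmin => p1 [p2 [E L H]].
  have : has (mem X) (u :: p1).
    apply: sX; rewrite /= uA L vS andbT /=; apply: e'_pathx.
      by move: pp; rewrite E cat_path => /andP[].
    by apply: contra H => xb; apply/hasP; exists x => //=; rewrite setU11.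
  by rewrite E -cat_cons has_cat => ->.
have sep2 X : separates e' (y |: S) B X -> k <= #|X|.
  move=> sX; apply: hS => -[|u p] // ab.
  have hx := sepy _ ab; case/and3P: ab => uA pp lB.
  suff [v [p1 [p2 [vS [E H]]]]] : exists v p1 p2, v \in y |: S /\
      u :: p = p1 ++ v :: p2 /\ ~~ has (mem (y |: S)) p2.
    have pv : path e v p2 /\ last v p2 \in B.
      case: p1 E => [|w p1] [E1 E2]; first by subst.
      by move: pp lB; rewrite E2 cat_path last_cat /= => /and3P[_ _ ->].
    have : has (mem X) (v :: p2).
      apply: sX; rewrite /= vS pv.2 andbT /=; apply: e'_pathy; first exact: pv.1.
      by apply: contra H => xb; apply/hasP; exists y => //=; rewrite setU11.
    by rewrite E has_cat => ->; rewrite orbT.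
  elim: p u hx {uA lB pp} => [|w p IHp] u /=.
    by rewrite orbF => uS; exists u, [::], [::].
  have [h _|h] := boolP (has (mem (y |: S)) (w :: p)).
    have [v [p1 [p2 [vS [E H]]]]] := IHp w h.
    by exists v, (u :: p1), p2; rewrite E.
  rewrite /= in h; rewrite (negPf h) orbF => uS; exists u, [::], (w :: p).
  by rewrite uS.
have [f [f1 f2]] := IH e' A _ e'n sep1.
have [g [g1 g2]] := IH e' _ B e'n sep2.
pose lst i := last x (f i); pose hd j := head y (g j).
have fE i : exists2 p, f i = rcons p (lst i) & uniq (rcons p (lst i)).
  rewrite /lst; have [u [p [E _ U _ _]]] := f1 i; rewrite E /=.
  by exists (belast u p); rewrite -lastI // -E.
have gE j : exists p, g j = hd j :: p.
  by rewrite /hd; have [u [p [E _ _ _ _]]] := g1 j; rewrite E; exists p.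
have lstS i : lst i \in x |: S.
  by rewrite /lst; have [u [p [E + _ _ _]]] := f1 i; rewrite E => /and3P[_ _].
have hdS i : hd i \in y |: S.
  by rewrite /hd; have [u [p [E + _ _ _]]] := g1 i; rewrite E => /and3P[].
have hd_in j : hd j \in g j by have [p ->] := gE j; rewrite inE eqxx.
have lst_in j : lst j \in f j by have [p -> _] := fE j; rewrite mem_rcons inE eqxx.
have lst_only i v : v \in f i -> v \in x |: S -> v = lst i.
  by move=> vi vS; rewrite /lst; have [u [p [E _ _ _ h]]] := f1 i; rewrite E /=; apply: h.
have hd_only i v : v \in g i -> v \in y |: S -> v = hd i.
  by move=> vi vS; rewrite /hd; have [u [p [E _ _ h _]]] := g1 i; rewrite E /=; apply: h.
have hd_inj : injective hd by move=> i j h; apply: (g2 i j (hd i)); rewrite // h.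
have lst_inj : injective lst by move=> i j h; apply: (f2 i j (lst i)); rewrite // h.
have hd_sur v : v \in y |: S -> exists j, hd j = v.
  move=> vS; have : v \in [set hd j | j in 'I_k].
    suff -> : [set hd j | j in 'I_k] = y |: S by [].
    apply/eqP; rewrite eqEcard k2 card_imset // card_ord leqnn andbT.
    by apply/subsetP => _ /imsetP[j _ ->].
  by case/imsetP => j _ ->; exists j.
pose sg v := if v == x then y else v.
have sgS v : v \in x |: S -> sg v \in y |: S.
  by rewrite /sg !inE; case: (v =P x) => //= _ h; rewrite ?eqxx ?h ?orbT.
have sg_inj : {in x |: S &, injective sg}.
  move=> u v; rewrite /sg !inE; case: (u =P x) => [->|_] /=; case: (v =P x) => [->|_] //=.
    by move=> _ vS E; rewrite E vS in nyS.
  by move=> uS _ E; rewrite -E uS in nyS.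
have /choice[J hJ] : forall i, exists j, hd j = sg (lst i).
  by move=> i; apply: hd_sur; apply: sgS.
have J_inj : injective J.
  move=> i i' E; apply: lst_inj; apply: sg_inj => //.
  by rewrite -!hJ E.
pose h i := f i ++ (if lst i == x then g (J i) else behead (g (J i))).
have cross i j v : v \in f i -> v \in g j -> v \in S /\ (v = lst i /\ v = hd j).
  move=> vf vg.
  suff vS : v \in S.
    by split=> //; split; [apply: lst_only|apply: hd_only]; rewrite // inE vS orbT.
  have [u [p [E ab U _ _]]] := f1 i.
  have [w [q [E' ab' U' _ _]]] := g1 j.
  have vp : v \in u :: p by rewrite -E.
  case: (splitPl vp) E ab => p1 p2 lv E ab.
  have [q1 [q2 E2]] : exists q1 q2, w :: q = q1 ++ v :: q2.
    by move: vg; rewrite E' => /splitPr[q1 q2]; exists q1, q2.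
  have pv : path e' v q2 /\ last v q2 \in B.
    move: ab'; rewrite E' => /and3P[_ pw lB].
    case: q1 E2 => [|w' q1] [E1 E2]; first by subst.
    by move: pw lB; rewrite E2 cat_path last_cat /= => /and3P[_ _ ->].
  have : has (mem S) (u :: p1 ++ q2).
    apply: sepS; rewrite /= cat_path last_cat lv pv.1 pv.2 !andbT.
    by move: ab; rewrite E /= cat_path => /andP[-> /andP[/andP[-> _] _]].
  rewrite -cat_cons has_cat => /orP[]/hasP[z zp zS] /=; rewrite /= in zS.
    have zl : z = lst i by apply: lst_only; rewrite ?inE ?zS ?orbT // E -cat_cons mem_cat zp.
    case: p2 E {ab} => [|t p2] E.
      by move: zl; rewrite /lst E cats0 /= lv => <-.
    have : lst i \in t :: p2 by rewrite /lst E /= last_cat /= mem_last.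
    rewrite -zl => zt; move: U; rewrite E -cat_cons cat_uniq => /and3P[_ /hasPn/(_ z zt)] /=.
    by rewrite zp.
  have zg : z \in g j by rewrite E' E2 mem_cat inE zp !orbT.
  have zl : z = hd j by apply: hd_only; rewrite ?inE ?zS ?orbT.
  case: q1 E2 => [|t q1] E2.
    by move: zl; rewrite /hd E' E2 /= => <-.
  have : z = t by move: zl; rewrite /hd E' E2 /=.
  move=> zt; move: U'; rewrite E' E2 -zt /= mem_cat inE zp !orbT //.
have hP i : abpath e A B (h i).
  rewrite /h; have [u [p [E ab _ _ _]]] := f1 i.
  have [w [q [E' ab' _ _ _]]] := g1 (J i).
  have hw : hd (J i) = w by rewrite /hd E'.
  have hu : lst i = last u p by rewrite /lst E.
  move: (hJ i); rewrite hw hu /sg E E' /=.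
  move: ab ab'; rewrite E E' /= => /and3P[-> pp _] /and3P[_ pq lB].
  case: eqP => [lx wy|_ lw].
    by rewrite cat_path last_cat (sub_path e'e pp) lx /= lB (sub_path e'e pq) wy exy.
  by rewrite cat_path last_cat (sub_path e'e pp) -lw lB (sub_path e'e pq).
have hsub i v : v \in h i -> v \in f i \/ v \in g (J i).
  rewrite /h mem_cat => /orP[->|]; first by left.
  by case: ifP => _ vi; right => //; apply: mem_behead.
have hdis i j v : v \in h i -> v \in h j -> i = j.
  move=> /hsub[vi|vi] /hsub[vj|vj]; first exact: (f2 _ _ v).
  - have [vS [v1 v2]] := cross _ _ _ vi vj; apply: J_inj; apply: hd_inj.
    by rewrite hJ -v1 -v2 /sg; case: eqP => // vx; rewrite -vx vS in nxS.
  - have [vS [v1 v2]] := cross _ _ _ vj vi; apply: J_inj; apply: hd_inj.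
    by rewrite (hJ j) -v1 -v2 /sg; case: eqP => // vx; rewrite -vx vS in nxS.
  - by apply: J_inj; apply: (g2 _ _ v).
have /choice[h' hh'] : forall i, exists q, lpath e A B q /\ {subset q <= h i}.
  by move=> i; have [q ? ?] := abpath_lpath (hP i); exists q.
exists h'; split=> [i|i j v vi vj]; first by case: (hh' i).
by apply: (hdis _ _ v); [apply: (hh' i).2|apply: (hh' j).2].
Qed.

Theorem menger e A B k :
  (forall S, separates e A B S -> k <= #|S|) ->
  exists f : 'I_k -> seq T,
    (forall i, lpath e A B (f i)) /\
    (forall i j v, v \in f i -> v \in f j -> i = j).
Proof. exact: menger_aux (leqnn _). Qed.
End Menger.

(** * Brambles *)

Section Brambles.
Variables (T : finType) (e : rel T).
Implicit Types (A B C X : {set T}) (BB : {set {set T}}).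

Definition touch A B := [exists x in A, exists y in B, (x == y) || e x y].

Lemma touchP A B :
  reflect (exists x y, [/\ x \in A, y \in B & (x == y) || e x y]) (touch A B).
Proof.
apply: (iffP existsP) => [[x /andP[xA /existsP[y /andP[yB h]]]]|[x [y [xA yB h]]]].
  by exists x, y.
by exists x; rewrite xA; apply/existsP; exists y; rewrite yB.
Qed.

Definition bramble BB : Prop :=
  (forall A, A \in BB -> conn e A) /\
  (forall A B, A \in BB -> B \in BB -> touch A B).

Lemma conn_touch A B : symmetric e -> conn e A -> conn e B -> touch A B ->
  conn e (A :|: B).
Proof.
move=> e_sym cA cB /touchP[x [y [xA yB /orP[/eqP xy|xy]]]].
  by apply: connU => //; apply: (@meetsI _ x); rewrite // xy.
exact: connE cA cB xA yB xy.
Qed.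

Definition covers X BB := [forall A in BB, meets X A].

Lemma coversP X BB : reflect (forall A, A \in BB -> meets X A) (covers X BB).
Proof. exact: forall_inP. Qed.
End Brambles.

(** * Rooted tree-decompositions *)

Section RootedDec.
Variable T : finType.
Implicit Types (A B C V X : {set T}).

Inductive bagtree := Leaf | Node of {set T} & bagtree & bagtree.

Fixpoint verts t := if t is Node V l r then V :|: verts l :|: verts r else set0.
Fixpoint bags t := if t is Node V l r then V :: bags l ++ bags r else [::].
Definition root_bag t := if t is Node V _ _ then V else set0.
(** A vertex that occurs on both sides of a tree edge lies in both ends of the
    edge: the local form of the condition that the bags containing a given
    vertex form a subtree. *)
Fixpoint valid t : Prop :=
  if t is Node V l r then
    [/\ valid l, valid r, verts l :&: V \subset root_bag l,
        verts r :&: V \subset root_bag r & verts l :&: verts r \subset V]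
  else True.

Definition inbag t x y := exists2 V, V \in bags t & (x \in V) && (y \in V).

Lemma vertsP t x : x \in verts t <-> exists2 V, V \in bags t & x \in V.
Proof.
elim: t => [|V l IHl r IHr] /=; first by split; [rewrite inE|case].
split.
- rewrite !inE => /orP[/orP[xV|/IHl[W Wl xW]]|/IHr[W Wr xW]].
  + by exists V; rewrite ?inE ?eqxx.
  + by exists W => //; rewrite inE mem_cat Wl orbT.
  + by exists W => //; rewrite inE mem_cat Wr !orbT.
- case=> W; rewrite inE mem_cat => /orP[/eqP ->|/orP[Wl|Wr]] xW; rewrite !inE.
  + by rewrite xW.
  + by rewrite (IHl.2 _) ?orbT //; exists W.
  + by rewrite (IHr.2 _) ?orbT //; exists W.
Qed.

Lemma inbag_verts t x y : inbag t x y -> x \in verts t /\ y \in verts t.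
Proof. by move=> [V Vt /andP[xV yV]]; split; apply/vertsP; exists V. Qed.

(** Moving the root down along an edge turns the old root into a third child
    of the new one.  Branching being binary, the bag of the new root is
    repeated to make room. *)
Lemma reroot_aux n s u V W : size (bags s) < n -> valid (Node V s u) ->
  W \in bags s -> exists t, [/\ valid t, root_bag t = W, verts t = verts (Node V s u)
     & bags t =i bags (Node V s u)].
Proof.
elim: n s u V => // n IH s u V; case: s => [|V' a b] //= sz.
move=> [[va vb aV' bV' ab] vu sV uV su].
have inter A B C x : A :&: B \subset C -> x \in A -> x \in B -> x \in C.
  by move=> /subsetP h xA xB; apply: h; rewrite inE xA.
have step a1 b1 : valid a1 -> valid b1 -> verts a1 :&: V' \subset root_bag a1 ->
    verts b1 :&: V' \subset root_bag b1 -> verts a1 :&: verts b1 \subset V' ->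
    V' :|: verts a1 :|: verts b1 = V' :|: verts a :|: verts b ->
    valid (Node V' a1 (Node V' b1 (Node V u Leaf))).
  move=> va1 vb1 a1V' b1V' ab1 E /=; rewrite -E in sV su.
  have h1 x : x \in V' :|: verts a1 :|: verts b1 -> x \in V -> x \in V' by exact: inter.
  have h2 x : x \in V' :|: verts a1 :|: verts b1 -> x \in verts u -> x \in V by exact: inter.
  split=> //.
  - split=> //.
    + by split=> //; rewrite ?set0I ?setI0 sub0set.
    + apply/subsetP => x; rewrite !inE orbF => /andP[/orP[//|xu] xV'].
      by apply: h2; rewrite // !inE xV'.
    + apply/subsetP => x; rewrite !inE orbF => /andP[xb] /orP[xV|xu].
        by apply: h1; rewrite // !inE xb !orbT.
      by apply: h1; first rewrite !inE xb !orbT; last (apply: h2; rewrite // !inE xb !orbT).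
  - by apply/subsetP => x; rewrite !inE => /andP[_ ->].
  - apply/subsetP => x; rewrite !inE orbF => /andP[xa] /orP[/orP[//|xb]|/orP[xV|xu]].
    + exact: (inter _ _ _ _ ab1).
    + by apply: h1; rewrite // !inE xa !orbT.
    + by apply: h1; first rewrite !inE xa !orbT; last (apply: h2; rewrite // !inE xa !orbT).
have vE a1 b1 : V' :|: verts a1 :|: verts b1 = V' :|: verts a :|: verts b ->
    verts (Node V' a1 (Node V' b1 (Node V u Leaf))) = V :|: (V' :|: verts a :|: verts b) :|: verts u.
  move=> <- /=; apply/setP => x; rewrite !inE.
  by case: (x \in V); case: (x \in V'); case: (x \in verts a1); case: (x \in verts b1); case: (x \in verts u).
have bE a1 b1 : bags a1 ++ bags b1 =i bags a ++ bags b ->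
    bags (Node V' a1 (Node V' b1 (Node V u Leaf))) =i V :: (V' :: bags a ++ bags b) ++ bags u.
  move=> h x; have := h x; rewrite !(inE, mem_cat) /= => <-.
  by case: (x == V); case: (x == V'); case: (x \in bags a1); case: (x \in bags b1); case: (x \in bags u).
have v1 := step a b va vb aV' bV' ab erefl.
have E2 : V' :|: verts b :|: verts a = V' :|: verts a :|: verts b by rewrite -!setUA (setUC (verts b)).
have v2 : valid (Node V' b (Node V' a (Node V u Leaf))).
  by apply: step => //; rewrite setIC.
have szab := sz; rewrite /= ltnS size_cat in szab.
rewrite inE mem_cat => /orP[/eqP -> | /orP[Wa|Wb]].
- exists (Node V' a (Node V' b (Node V u Leaf))); split=> //; [exact: vE|exact: bE].
- have [|t [t1 t2 t3 t4]] := IH a _ V' _ v1 Wa; first by move: szab; lia.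
  exists t; split=> //; first by rewrite t3 vE.
  by move=> x; rewrite t4 bE.
- have [|t [t1 t2 t3 t4]] := IH b _ V' _ v2 Wb; first by move: szab; lia.
  exists t; split=> //; first by rewrite t3 vE.
  by move=> x; rewrite t4 bE // => y; rewrite !mem_cat orbC.
Qed.

Lemma reroot s W : valid s -> W \in bags s ->
  exists t, [/\ valid t, root_bag t = W, verts t = verts s & bags t =i bags s].
Proof.
case: s => // V l r vs; rewrite inE mem_cat => /orP[/eqP ->|/orP[Wl|Wr]].
- by exists (Node V l r).
- exact: (@reroot_aux (size (bags l)).+1).
- have vs' : valid (Node V r l).
    by case: vs => *; split=> //; rewrite setIC.
  have [t [t1 t2 t3 t4]] := reroot_aux (ltnSn _) vs' Wr.
  exists t; split=> //.
    by rewrite t3 /= -!setUA (setUC (verts l)).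
  by move=> x; rewrite t4 /= !(inE, mem_cat) (orbC (x \in bags l)).
Qed.

Variable e : rel T.
Hypothesis e_sym : symmetric e.

(** Vertices of the root bag may have neighbours elsewhere, so that the property
    is inherited by subtrees. *)
Definition edges_covered t := forall x y, x \in verts t -> e x y -> inbag t x y \/ x \in root_bag t.

Lemma edges_covered_l V l r : valid (Node V l r) -> edges_covered (Node V l r) -> edges_covered l.
Proof.
move=> [_ _ /subsetP lV _ /subsetP lr] h x y xl exy.
have xV : x \in V -> x \in root_bag l by move=> xV; apply: lV; rewrite inE xl.
case: (h x y _ exy); rewrite /= ?inE ?xl ?orbT //; last by right; auto.
move=> [W]; rewrite inE mem_cat => /orP[/eqP -> /andP[? _]|/orP[Wl ?|Wr /andP[xW _]]].
- by right; auto.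
- by left; exists W.
- by right; apply: xV; apply: lr; rewrite inE xl; apply/vertsP; exists W.
Qed.

Lemma mirror V l r : valid (Node V l r) -> edges_covered (Node V l r) ->
  valid (Node V r l) /\ edges_covered (Node V r l).
Proof.
move=> vt h; split; first by case: vt => *; split=> //; rewrite setIC.
move=> x y /=; rewrite -setUA (setUC (verts r)) setUA => xv exy.
case: (h x y xv exy) => [[W Wt xyW]|]; [left|by right].
by exists W => //; move: Wt; rewrite /= !(inE, mem_cat) (orbC (W \in bags l)).
Qed.

(** If P missed the root bag of l, no edge of P would leave the vertices of l,
    so P would lie among them; but there V only has vertices of that bag. *)
Lemma meets_child V l r P : valid (Node V l r) -> edges_covered (Node V l r) -> conn e P ->
  meets P V -> meets P (verts l) -> meets P (root_bag l).
Proof.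
move=> vt ec cP PV Pl; apply: contraT => nr.
have el := edges_covered_l vt ec.
case: vt => _ _ /subsetP lV _ _.
have sP : P \subset verts l.
  apply: (conn_subX cP Pl) => x y xP yP xl exy.
  case: (el x y xl exy) => [/inbag_verts[]//|xr].
  by move/negP: nr; case; apply: (meetsI xP).
case/meetsP: PV => x xP xV; move/negP: nr; case; apply: (meetsI xP).
by apply: lV; rewrite inE (subsetP sP).
Qed.

Inductive subtree : bagtree -> bagtree -> Prop :=
| subtree0 t : subtree t t
| subtreel s V l r : subtree s l -> subtree s (Node V l r)
| subtreer s V l r : subtree s r -> subtree s (Node V l r).

Lemma subtree_verts s t : subtree s t -> verts s \subset verts t.
Proof.
elim=> [//|s' V l r _ IH|s' V l r _ IH] /=; apply: (subset_trans IH).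
  by rewrite (setUC V) -setUA subsetUl.
exact: subsetUr.
Qed.

Lemma meets_subtree s t P : subtree s t -> valid t -> edges_covered t -> conn e P ->
  meets P (root_bag t) -> meets P (verts s) -> meets P (root_bag s).
Proof.
move=> st vt et cP; elim: st vt et => [//|s' V l r sl IH|s' V l r sr IH] vt et Pr Ps.
- apply: IH => //; [by case: vt|exact: edges_covered_l vt et|].
  apply: meets_child (vt) et cP Pr _.
  exact: meetsS Ps _ (subtree_verts sl).
- have [vt' et'] := mirror vt et.
  apply: IH => //; [by case: vt|exact: edges_covered_l vt' et'|].
  apply: meets_child (vt') et' cP Pr _.
  exact: meetsS Ps _ (subtree_verts sr).
Qed.

(** A decomposition of C :|: X.  A vertex of X is added to all bags from the
    root down to where it occurs, so that the new root bag contains X; in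
    [dec_comp] a path from X to the root pays for this. *)
Fixpoint proj C X t :=
  if t is Node V l r then
    Node ((V :&: C) :|: (X :&: verts t)) (proj C X l) (proj C X r)
  else Leaf.

Lemma proj_verts C X t : verts (proj C X t) = verts t :&: (C :|: X).
Proof.
elim: t => [|V l IHl r IHr] /=; first by rewrite set0I.
rewrite IHl IHr; apply/setP => x; rewrite !inE.
by case: (x \in V); case: (x \in C); case: (x \in X); case: (x \in verts l); case: (x \in verts r).
Qed.

Lemma proj_root_bag C X t : root_bag (proj C X t) = (root_bag t :&: C) :|: (X :&: verts t).
Proof. by case: t => [|V l r] //=; rewrite set0I setI0 setU0. Qed.

Lemma proj_valid C X t : valid t -> valid (proj C X t).
Proof.
elim: t => //= V l IHl r IHr [/IHl vl /IHr vr /subsetP lV /subsetP rV /subsetP lr].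
split=> //.
- rewrite proj_verts proj_root_bag; apply/subsetP => x; rewrite !inE.
  move: (lV x); rewrite !inE; case: (x \in root_bag l); case: (x \in verts l);
    case: (x \in C); case: (x \in X); case: (x \in V) => //= h _; exact: h.
- rewrite proj_verts proj_root_bag; apply/subsetP => x; rewrite !inE.
  move: (rV x); rewrite !inE; case: (x \in root_bag r); case: (x \in verts r);
    case: (x \in C); case: (x \in X); case: (x \in V) => //= h _; exact: h.
- rewrite !proj_verts; apply/subsetP => x; rewrite !inE.
  move=> /andP[/andP[xl xCX] /andP[xr _]]; rewrite xl xr.
  have xV : x \in V by apply: lr; rewrite inE xl.
  by rewrite xV; case: (x \in C) xCX => //= ->.
Qed.

Lemma proj_bags C X t W : W \in bags (proj C X t) ->
  exists2 s, subtree s t & W = (root_bag s :&: C) :|: (X :&: verts s) /\ root_bag s \in bags t.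
Proof.
elim: t => //= V l IHl r IHr; rewrite inE mem_cat => /orP[/eqP ->|/orP[/IHl|/IHr]].
- by exists (Node V l r); [exact: subtree0|rewrite /= inE eqxx].
- by move=> [s ss [-> h]]; exists s; [exact: subtreel|rewrite inE mem_cat h orbT].
- by move=> [s ss [-> h]]; exists s; [exact: subtreer|rewrite inE mem_cat h !orbT].
Qed.

Lemma proj_inbag C X t x y : x \in C :|: X -> y \in C :|: X -> inbag t x y ->
  inbag (proj C X t) x y.
Proof.
move=> xc yc; elim: t => [|V l IHl r IHr] [W] //=.
rewrite inE mem_cat => /orP[/eqP -> /andP[xV yV]|/orP[Wl h|Wr h]].
- exists (V :&: C :|: X :&: verts (Node V l r)); first by rewrite inE eqxx.
  move: xc yc; rewrite !inE xV yV /=.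
  by do 4! case: (_ \in _).
- have [|W' W'l h'] := IHl; first by exists W.
  by exists W' => //=; rewrite inE mem_cat W'l orbT.
- have [|W' W'l h'] := IHr; first by exists W.
  by exists W' => //=; rewrite inE mem_cat W'l !orbT.
Qed.
End RootedDec.

(** * Small bags from small covers *)

Section Duality.
Variables (T : finType) (e : rel T).
Hypothesis e_sym : symmetric e.
Variable k : nat.
Hypothesis small_cover : forall BB, bramble e BB -> exists2 X, covers X BB & #|X| <= k.
Implicit Types (A B C V X : {set T}).

(** For the empty bramble the admissible sets are those with at most k elements.
    The larger the bramble, the more sets are admissible, which allows an
    induction from large brambles to the empty one. *)
Definition admissible (BB : {set {set T}}) (Y : {set T}) := (#|Y| <= k) || ~~ covers Y BB.

Definition adm_dec BB (W : {set T}) t :=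
  [/\ valid t, verts t = W, forall x y, x \in W -> y \in W -> e x y -> inbag t x y
    & forall V, V \in bags t -> admissible BB V].

(** The step of Bellenbaum and Diestel, for one component C of the complement
    of a minimum cover X.  If C cannot be added to the bramble, then C with its
    neighbours in X misses a member of BB and is an admissible bag.  If C can
    be added, induction provides a decomposition t0 for the larger bramble.
    If it is not good enough, some bag Vs is large and covers BB, hence misses
    C.  As X is a minimum cover, #|X| disjoint paths join X to Vs; none of them
    meets C.  Root the decomposition at Vs and project it to C :|: X.  A vertex
    x of X added to a bag is paid for by a vertex of the bag outside C, on the
    path through x; so bags do not grow, and the root bag becomes X. *)
Lemma dec_comp BB X C : bramble e BB -> covers X BB -> #|X| <= k ->
  (forall Y, covers Y BB -> #|X| <= #|Y|) ->
  conn e C -> ~~ meets C X ->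
  (forall x y, x \in C -> e x y -> y \notin X -> y \in C) ->
  (bramble e (C |: BB) -> exists t, adm_dec (C |: BB) setT t) ->
  (exists t, adm_dec BB setT t) \/ (exists2 t, adm_dec BB (C :|: X) t & root_bag t = X).
Proof.
move=> bB cX Xk Xmin cC CX Ccl IH.
have [cB tB] := bB; have admX : admissible BB X by rewrite /admissible Xk.
have [bBC|nb] := pselect (bramble e (C |: BB)); last first.
  right; have [B BB_B nt] : exists2 B, B \in BB & ~~ touch e C B.
    apply: contrapT => h; apply: nb; split=> [A|A B].
      by move=> /setU1P[->|/cB].
    have tC A' : A' \in BB -> touch e C A'.
      by move=> hA; apply: contrapT => h'; apply: h; exists A' => //; apply/negP.
    have tsym A1 A2 : touch e A1 A2 -> touch e A2 A1.
      move=> /touchP[x [y [? ? ?]]]; apply/touchP; exists y, x; split=> //.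
      by rewrite eq_sym e_sym.
    move=> /setU1P[->|hA] /setU1P[->|hB]; auto.
    have [x xC] := conn_ex cC; apply/touchP; exists x, x; split=> //; by rewrite eqxx.
  pose N := C :|: [set y in X | [exists x in C, e x y]].
  exists (Node X (Node N (Leaf T) (Leaf T)) (Leaf T)) => //; split.
  - rewrite /= !setU0 !set0I !setI0 !sub0set; split=> //.
    by apply/subsetP => x; rewrite inE => /andP[].
  - apply/setP => x; rewrite /= !inE; by case: (x \in X); case: (x \in C).
  - move=> x y xW yW exy; have [/andP[xX yX]|] := boolP ((x \in X) && (y \in X)).
      by exists X; rewrite /= ?inE ?eqxx // xX.
    rewrite negb_and => h; exists N; first by rewrite /= !inE eqxx orbT.
    move: xW yW; rewrite !inE.
    case xC: (x \in C); case yC: (y \in C) => //=.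
    + move=> _ yX; rewrite yX andTb; apply/existsP; exists x; by rewrite xC.
    + move=> xX _; rewrite xX andbT; apply/existsP; exists y; by rewrite yC e_sym.
    + by move=> xX yX; rewrite xX yX in h.
  - move=> V; rewrite /= !inE => /orP[/eqP ->//|/eqP ->].
    rewrite /admissible; apply/orP; right; apply/negP => /coversP/(_ B BB_B)/meetsP[x + xB].
    rewrite !inE => /orP[xC|/andP[xX /existsP[y /andP[yC eyx]]]]; move/negP: nt; apply; apply/touchP.
      by exists x, x; rewrite eqxx.
    by exists y, x; rewrite eyx orbT.
have [t0 [vt0 Vt0 et0 at0]] := IH bBC.
have [allB|/existsNP[Vs /not_implyP[Vs0 /negP]]] :=
  pselect (forall V, V \in bags t0 -> admissible BB V).
  by left; exists t0; split.
rewrite negb_or negbK -ltnNge => /andP[kV cV]; right.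
have VsC : ~~ meets Vs C.
  have := at0 _ Vs0; rewrite /admissible leqNgt kV /=; apply: contra => m.
  by apply/coversP => A /setU1P[->//|]; move/coversP: cV; apply.
have [t [vt rt Vt bt]] := reroot vt0 Vs0.
have et x y : e x y -> inbag t x y.
  move=> exy; have [|||W Wt h] := et0 x y => //; by exists W => //; rewrite bt.
have ec : edges_covered e t by move=> x y _ /et; left.
have [f [f1 f2]] : exists f : 'I_#|X| -> seq T,
    (forall i, lpath e X Vs (f i)) /\ (forall i j v, v \in f i -> v \in f j -> i = j).
  apply: menger => S sS; apply: Xmin; apply/coversP => B BB_B.
  have /meetsP[x xX xB] := coversP _ _ cX _ BB_B.
  have /meetsP[y yV yB] := coversP _ _ cV _ BB_B.
  have [p [pp lp _ sp]] := conn_upath (cB _ BB_B) xB yB.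
  have /hasP[z zp zS] : has (mem S) (x :: p) by apply: sS; rewrite /= xX pp lp.
  by apply: (meetsI zS); apply: sp.
have PX x : x \in X -> exists i, x \in f i.
  pose hd i := head x (f i).
  have hdX i : hd i \in X by rewrite /hd; have [u [p [-> /and3P[]]]] := f1 i.
  have hdf i : hd i \in f i.
    by rewrite /hd; have [u [p [-> ]]] := f1 i => *; rewrite inE eqxx.
  have hd_inj : injective hd by move=> i j h; apply: (f2 i j (hd i)); rewrite // h.
  have E : [set hd i | i in 'I_#|X|] = X.
    apply/eqP; rewrite eqEcard card_imset // card_ord leqnn andbT.
    by apply/subsetP => _ /imsetP[j _ ->].
  move=> xX; have : x \in [set hd i | i in 'I_#|X|] by rewrite E.
  by case/imsetP => i _ ->; exists i.
have PC i v : v \in f i -> v \notin C.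
  have [u [p [E ab U hX _]]] := f1 i; move: ab; rewrite E => /and3P[uX pp lV] vf.
  apply/negP => vC; suff lC : last u p \in C.
    by move/negP: VsC; apply; apply: meetsI lV lC.
  have nX w : w \in p -> w \notin X.
    move=> wp; apply/negP => wX; have wu : w = u by apply: hX => //; rewrite E inE wp orbT.
    by move: U; rewrite E /= -wu wp.
  have uC : u \notin C by rewrite meetsC in CX; exact: nmeetsP CX uX.
  have vu : v != u by apply: contraNneq uC => <-.
  move: vf; rewrite inE (negPf vu) => /= vp.
  case/splitPr: vp pp nX {U hX lV E} => p1 p2; rewrite cat_path last_cat /= => /and3P[_ _ pp] nX.
  have {}nX w : w \in p2 -> w \notin X by move=> wp; apply: nX; rewrite mem_cat inE wp !orbT.
  elim: p2 v vC pp nX {vu} => //= w p2 IHp v vC /andP[evw pw] nX.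
  apply: IHp pw _; first by apply: Ccl evw _ => //; apply: nX; rewrite mem_head.
  by move=> z zp; apply: nX; rewrite inE zp orbT.
have fconn i : conn e [set v in f i].
  have [u [p [E ab _ _ _]]] := f1 i; rewrite E; apply: conn_path => //.
  by move: ab; rewrite E => /and3P[].
have fVs i : meets [set v in f i] Vs.
  have [u [p [E ab _ _ _]]] := f1 i; move: ab; rewrite E => /and3P[_ _ lV].
  by apply: (meetsI _ lV); rewrite inE mem_last.
have fX i x y : x \in f i -> y \in f i -> x \in X -> y \in X -> x = y.
  have [u [p [_ _ _ hX _]]] := f1 i => xi yi xX yX.
  by rewrite (hX x) // (hX y).
exists (proj C X t); last first.
  rewrite proj_root_bag rt Vt Vt0 setIT; move: VsC; rewrite /meets negbK => /eqP ->.
  exact: set0U.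
split.
- exact: proj_valid.
- by rewrite proj_verts Vt Vt0 setTI.
- by move=> x y xW yW exy; apply: proj_inbag => //; exact: et.
move=> V /proj_bags[s ss [VE sbt]].
have sb0 : root_bag s \in bags t0 by rewrite -bt.
have cardV : #|V| <= #|root_bag s|.
  rewrite VE -[#|root_bag s|](cardsID C); apply: leq_trans (leq_card_setU _ _) _.
  rewrite leq_add2l.
  have /choice[g gP] : forall x, exists v, x \in X :&: verts s ->
      v \in root_bag s :\: C /\ exists i, x \in f i /\ v \in f i.
    move=> x; have [xX|_] := boolP (x \in X :&: verts s); last by exists x.
    move: xX; rewrite inE => /andP[xX xs]; have [i xi] := PX x xX.
    have /meetsP[v vi vs] : meets [set v in f i] (root_bag s).
      apply: (meets_subtree ss vt ec (fconn i)); first by rewrite rt.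
      by apply: (meetsI _ xs); rewrite inE.
    rewrite inE in vi; exists v => _; split; first by rewrite inE vs (PC i).
    by exists i.
  rewrite -(@card_in_imset _ _ g (mem (X :&: verts s))).
    by apply: subset_leq_card; apply/subsetP => _ /imsetP[x xs ->]; case: (gP x xs).
  move=> x y xs ys E; have [_ [i [xi gi]]] := gP x xs; have [_ [j [yj gj]]] := gP y ys.
  have ij : i = j by apply: f2 gi _; rewrite E.
  move: xs ys; rewrite -ij in yj; rewrite !inE => /andP[xX _] /andP[yX _].
  exact: fX xi yj xX yX.
rewrite /admissible; have := at0 _ sb0; rewrite /admissible => /orP[sk|]; first by rewrite (leq_trans cardV sk).
have [mC|nC] := boolP (meets (root_bag s) C); last first.
  move=> _; apply/orP; left; rewrite VE; move: nC; rewrite /meets negbK => /eqP ->.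
  by rewrite set0U (leq_trans _ Xk) // subset_leq_card // subsetIl.
move=> nc; apply/orP; right; apply: contra nc => /coversP cVB.
apply/coversP => A /setU1P[->//|BB_A].
have /meetsP[x + xA] := cVB A BB_A; rewrite VE inE => /orP[|].
  by rewrite inE => /andP[xs _]; apply: meetsI xs xA.
rewrite inE => /andP[_ xs]; rewrite meetsC; apply: (meets_subtree ss vt ec (cB _ BB_A)).
  by rewrite rt meetsC; move/coversP: cV; apply.
exact: meetsI xA xs.
Qed.

(** Induction on the number of sets outside BB.  The decompositions obtained for
    the components of the complement of X all have root bag X and are glued at
    their roots. *)
Lemma dec_exists n BB : #|~: BB| <= n -> bramble e BB -> exists t, adm_dec BB setT t.
Proof.
elim: n BB => [|n IH] BB nB bB.
  (* BB would contain the empty set, which is not connected *)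
  move: nB; rewrite leqn0 cards_eq0 => /eqP nB.
  have : set0 \in BB by rewrite -[BB]setCK nB inE in_set0.
  by case/(bB.1) => /eqP.
have [X0 cX0 X0k] := small_cover bB.
have exX : exists m, [exists X, covers X BB && (#|X| == m)].
  by exists #|X0|; apply/existsP; exists X0; rewrite cX0 eqxx.
have [m /existsP[X /andP[cX /eqP Xm]] mmin] := ex_minnP exX.
have Xmin Y : covers Y BB -> #|X| <= #|Y|.
  by move=> cY; rewrite Xm; apply: mmin; apply/existsP; exists Y; rewrite cY eqxx.
have Xk : #|X| <= k by apply: leq_trans X0k; apply: Xmin.
have comps x : x \notin X -> (exists t, adm_dec BB setT t) \/
    (exists2 t, adm_dec BB (component e (~: X) x :|: X) t & root_bag t = X).
  move=> xX; have xC : x \in ~: X by rewrite inE.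
  have CX : ~~ meets (component e (~: X) x) X.
    by apply/negP => /meetsP[y /(subsetP (component_sub _ _ _))]; rewrite inE => /negP.
  apply: dec_comp => //; first exact: component_conn.
  - move=> y z yC eyz zX; apply: component_closed yC _ eyz => //.
    by rewrite inE.
  - move=> bBC; apply: IH => //.
    have nC : component e (~: X) x \notin BB.
      by apply: contra CX => hC; rewrite meetsC; move/coversP: cX; apply.
    rewrite -ltnS; apply: leq_trans nB; apply: proper_card; apply/properP; split.
      by rewrite setCS subsetUr.
    by exists (component e (~: X) x); rewrite !inE // eqxx.
have [full|nfull] := pselect (exists t, adm_dec BB setT t); first by [].
have {}comps x : x \notin X -> exists2 t, adm_dec BB (component e (~: X) x :|: X) t & root_bag t = X.
  by case/comps.
have glue (xs : seq T) : exists (D : {set T}) t, [/\ D \subset ~: X, (forall x, x \in xs -> x \in D :|: X),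
     (forall x y, x \in D -> e x y -> y \notin X -> y \in D),
     adm_dec BB (D :|: X) t & root_bag t = X].
  elim: xs => [|x xs [D [t [sD xsD Dcl [vt Vt et at_] rt]]]].
    exists set0, (Node X (Leaf T) (Leaf T)); split=> //.
    - exact: sub0set.
    - by move=> x y; rewrite inE.
    - split=> /=.
      + by rewrite !set0I !sub0set.
      + by rewrite !setU0 set0U.
      + move=> x y; rewrite set0U => xX yX _; exists X; rewrite ?mem_head //.
        by rewrite xX.
      + by move=> V; rewrite inE => /eqP ->; rewrite /admissible Xk.
  have [xD|] := boolP (x \in D :|: X).
    exists D, t; split=> // y; rewrite inE => /predU1P[->//|]; exact: xsD.
  rewrite inE negb_or => /andP[xD xX].
  have [t' [vt' Vt' et' at'] rt'] := comps x xX.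
  pose C := component e (~: X) x.
  have xC : x \in ~: X by rewrite inE.
  have CD : ~~ meets C D.
    apply/negP => mt; move/negP: xD; apply.
    suff /subsetP : C \subset D by apply; apply: component_refl.
    apply: (conn_subX (component_conn e_sym xC) mt) => y z yC zC yD eyz.
    apply: (Dcl y) => //.
    by have := subsetP (component_sub _ _ _) z zC; rewrite inE.
  have CX : C \subset ~: X := component_sub _ _ _.
  have inCX y : y \in C -> y \notin X by move/(subsetP CX); rewrite inE.
  have inDX y : y \in D -> y \notin X by move/(subsetP sD); rewrite inE.
  have Ccl y z : y \in C -> e y z -> z \notin X -> z \in C.
    by move=> yC eyz zX; apply: component_closed yC _ eyz => //; rewrite inE.
  have xinC : x \in C by exact: component_refl.
  rewrite -/C in Vt' et'; clearbody C.
  exists (C :|: D), (Node X t' t); split=> //.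
  - by rewrite subUset CX.
  - move=> y; rewrite inE => /predU1P[->|/xsD].
      by rewrite !inE xinC.
    by rewrite !inE; case/orP=> ->; rewrite ?orbT.
  - move=> y z; rewrite !inE => /orP[yC|yD] eyz zX.
      by rewrite (Ccl y).
    by rewrite (Dcl y) ?orbT.
  - split=> /=.
    + rewrite Vt Vt' rt rt'; split=> //; rewrite ?subsetIr //.
      apply/subsetP => y; rewrite !inE => /andP[/orP[yC|//] /orP[yD|//]].
      by have := nmeetsP CD yC; rewrite yD.
    + rewrite Vt Vt'; apply/setP => y; rewrite !inE.
      by case: (y \in C); case: (y \in D); case: (y \in X).
    + have up1 y z : inbag t' y z -> inbag (Node X t' t) y z.
        by move=> [V Vt1 h]; exists V; rewrite //= inE mem_cat Vt1 orbT.
      have up2 y z : inbag t y z -> inbag (Node X t' t) y z.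
        by move=> [V Vt1 h]; exists V; rewrite //= inE mem_cat Vt1 !orbT.
      have mD z : z \in D -> z \in D :|: X by move=> h; rewrite inE h.
      have mC z : z \in C -> z \in C :|: X by move=> h; rewrite inE h.
      have mXD z : z \in X -> z \in D :|: X by move=> h; rewrite inE h orbT.
      have mXC z : z \in X -> z \in C :|: X by move=> h; rewrite inE h orbT.
      move=> y z; rewrite !inE => /orP[/orP[yC|yD]|yX] /orP[/orP[zC|zD]|zX] eyz.
      * by apply/up1/et'; auto.
      * by have := nmeetsP CD (Ccl _ _ yC eyz (inDX _ zD)); rewrite zD.
      * by apply/up1/et'; auto.
      * by have := nmeetsP CD zC; rewrite (Dcl _ _ yD eyz (inCX _ zC)).
      * by apply/up2/et; auto.
      * by apply/up2/et; auto.
      * by apply/up1/et'; auto.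
      * by apply/up2/et; auto.
      * by apply/up2/et; auto.
    + move=> V; rewrite inE mem_cat => /orP[/eqP ->|/orP[/at'|/at_]] //.
      by rewrite /admissible Xk.
have [D [t [sD xsD _ dt _]]] := glue (enum T).
exists t; suff <- : D :|: X = setT by [].
by apply/setP => x; rewrite xsD ?mem_enum // inE.
Qed.
End Duality.

(** * Tree-decompositions from rooted ones *)

Section ToTree.
Variable T : finType.
Implicit Types (V : {set T}).

(** Trees are handled as connected graphs in which every edge is a bridge.  This
    form of acyclicity is easy to preserve when two trees are joined by an
    edge. *)
Definition bridges (N : finType) (r : rel N) :=
  forall a b, r a b ->
    ~~ connect (fun x y => r x y && ~~ (((x, y) == (a, b)) || ((x, y) == (b, a)))) a b.

Record tdec (N : finType) (r : rel N) (B : N -> {set T}) (W : {set T}) : Prop := TDec {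
  td_sym : symmetric r;
  td_conn : conn r setT;
  td_bridges : bridges r;
  td_cover : forall x, x \in W <-> exists n, x \in B n;
  td_vconn : forall x, x \in W -> conn r [set n | x \in B n] }.

Lemma connect_map (S S' : finType) (q : rel S) (q' : rel S') (pr : S -> S') :
  (forall x y, q x y -> connect q' (pr x) (pr y)) ->
  forall x y, connect q x y -> connect q' (pr x) (pr y).
Proof.
move=> h x y /connectP[p pp ->]; elim: p x pp => [|z p IH] x /=; first by rewrite connect0.
by case/andP=> /h hz /IH; apply: connect_trans.
Qed.

Definition join_rel (N1 N2 : finType) (r1 : rel N1) (r2 : rel N2) (n1 : N1) (n2 : N2) : rel (N1 + N2) :=
  fun x y => match x, y with
  | inl a, inl b => r1 a b
  | inr a, inr b => r2 a b
  | inl a, inr b => (a == n1) && (b == n2)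
  | inr a, inl b => (a == n2) && (b == n1)
  end.

Definition join_bag (N1 N2 : finType) (B1 : N1 -> {set T}) (B2 : N2 -> {set T}) (x : N1 + N2) :=
  match x with inl a => B1 a | inr a => B2 a end.

Lemma conn_imset (S S' : finType) (r : rel S) (r' : rel S') (f : S -> S') A :
  symmetric r' -> (forall x y, r x y -> r' (f x) (f y)) -> conn r A ->
  conn r' [set f x | x in A].
Proof.
move=> rs h [/set0Pn[x xA] cA]; apply: (@conn_from _ _ rs _ (f x)); first exact: imset_f.
move=> _ /imsetP[y yA ->]; apply: connect_map (cA x y xA yA) => u v /and3P[uA vA uv].
by apply: connect1; apply/and3P; split; [exact: imset_f|exact: imset_f|exact: h].
Qed.

(** A bridge on one side remains a bridge, because the other side can be
    collapsed to its end of the new edge. *)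
Lemma tdec_join (N1 N2 : finType) (r1 : rel N1) (r2 : rel N2) B1 B2 n1 n2 W1 W2 :
  tdec r1 B1 W1 -> tdec r2 B2 W2 -> W1 :&: W2 \subset B1 n1 :&: B2 n2 ->
  tdec (join_rel r1 r2 n1 n2) (join_bag B1 B2) (W1 :|: W2).
Proof.
move=> [s1 c1 b1 cv1 v1] [s2 c2 b2 cv2 v2] /subsetP sW.
have js : symmetric (join_rel r1 r2 n1 n2) by move=> [a|a] [b|b] //=; rewrite andbC.
have edge : join_rel r1 r2 n1 n2 (inl n1) (inr n2) by rewrite /= !eqxx.
split=> //.
- have -> : [set: N1 + N2] = [set inl x | x in [set: N1]] :|: [set inr x | x in [set: N2]].
    by apply/setP => -[x|x]; rewrite !inE imset_f ?orbT.
  by apply: (connE js (x := inl n1) (y := inr n2)) edge;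
    rewrite ?imset_f //; [exact: conn_imset js _ c1|exact: conn_imset js _ c2].
- have pl a b : r1 a b -> ~~ connect (fun x y => join_rel r1 r2 n1 n2 x y && ~~ (((x, y) == (inl a, inl b)) || ((x, y) == (inl b, inl a)))) (inl a) (inl b).
    move=> rab; apply: contra (b1 a b rab).
    pose pr (x : N1 + N2) := if x is inl c then c else n1.
    apply: (@connect_map _ _ _ _ pr _ (inl a) (inl b)) => x y h.
    case: x y h => [x|x] [y|y] //=.
    + by rewrite !xpair_eqE => h; apply: connect1; rewrite !xpair_eqE.
    + by case/andP=> /andP[/eqP -> _] _; rewrite connect0.
    + by case/andP=> /andP[_ /eqP ->] _; rewrite connect0.
  have prr a b : r2 a b -> ~~ connect (fun x y => join_rel r1 r2 n1 n2 x y && ~~ (((x, y) == (inr a, inr b)) || ((x, y) == (inr b, inr a)))) (inr a) (inr b).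
    move=> rab; apply: contra (b2 a b rab).
    pose pr (x : N1 + N2) := if x is inr c then c else n2.
    apply: (@connect_map _ _ _ _ pr _ (inr a) (inr b)) => x y h.
    case: x y h => [x|x] [y|y] //=.
    + by case/andP=> /andP[_ /eqP ->] _; rewrite connect0.
    + by case/andP=> /andP[/eqP -> _] _; rewrite connect0.
    + by rewrite !xpair_eqE => h; apply: connect1; rewrite !xpair_eqE.
  have side (a b : N1 + N2) (q : rel (N1 + N2)%type) : (if a is inl _ then true else false) != (if b is inl _ then true else false) ->
      (forall x y, q x y -> join_rel r1 r2 n1 n2 x y && ((if x is inl _ then true else false) == (if y is inl _ then true else false))) -> ~~ connect q a b.
    move=> nab h; apply: contra nab => /connectP[p + ->].
    elim: p a => //= y p IH x /andP[/h/andP[_ /eqP ->]]; exact: IH.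
  move=> [a|a] [b|b] rab; [exact: pl| | |exact: prr]; apply: side => //.
    move=> [x|x] [y|y] //= /andP[]; case/andP: rab => /eqP -> /eqP ->.
      by move=> -> _.
      by case/andP=> /eqP -> /eqP ->; rewrite ?eqxx ?orbT.
      by case/andP=> /eqP -> /eqP ->; rewrite ?eqxx ?orbT.
      by move=> -> _.
    move=> [x|x] [y|y] //= /andP[]; case/andP: rab => /eqP -> /eqP ->.
      by move=> -> _.
      by case/andP=> /eqP -> /eqP ->; rewrite ?eqxx ?orbT.
      by case/andP=> /eqP -> /eqP ->; rewrite ?eqxx ?orbT.
      by move=> -> _.
- move=> x; rewrite inE; split.
    by case/orP=> [/cv1|/cv2] [n h]; [exists (inl n)|exists (inr n)].
  by move=> [[n|n] /= h]; apply/orP; [left; apply/cv1|right; apply/cv2]; exists n.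
- move=> x xW.
  have -> : [set n | x \in join_bag B1 B2 n] = [set inl n | n in [set n | x \in B1 n]] :|: [set inr n | n in [set n | x \in B2 n]].
    apply/setP => -[n|n]; rewrite !inE /=.
      rewrite mem_imset ?inE; last by move=> ? ? [].
      by rewrite orbC; case: imsetP => // -[? _].
    case: imsetP => [[? _]|_] //=.
    by rewrite mem_imset ?inE // => ? ? [].
  have e0 (N : finType) (B : N -> {set T}) (W : {set T}) : (x \in W <-> exists n, x \in B n) -> x \notin W -> [set n | x \in B n] = set0.
    by move=> h xn; apply/setP => n; rewrite !inE; apply/negP => xB; move/negP: xn; apply; apply/h; exists n.
  case x1: (x \in W1); case x2: (x \in W2).
  + have := sW x; rewrite !inE x1 x2 => /(_ isT)/andP[xB1 xB2].
    by apply: (connE js (x := inl n1) (y := inr n2)) edge;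
      rewrite ?imset_f ?inE //; [exact: conn_imset js _ (v1 x x1)|exact: conn_imset js _ (v2 x x2)].
  + by rewrite (e0 _ _ _ (cv2 x)) ?x2 // imset0 setU0; exact: conn_imset js _ (v1 x x1).
  + by rewrite (e0 _ _ _ (cv1 x)) ?x1 // imset0 set0U; exact: conn_imset js _ (v2 x x2).
  + by move: xW; rewrite inE x1 x2.
Qed.

Lemma tdec_unit V : tdec (fun _ _ : unit => false) (fun _ => V) V.
Proof.
have s : symmetric (fun _ _ : unit => false) by [].
have c (A : {set unit}) : tt \in A -> conn (fun _ _ : unit => false) A.
  by move=> h; apply: (conn_from s h) => -[] _; rewrite connect0.
split=> //.
- by apply: c; rewrite inE.
- by move=> x; split=> [|[]] //; exists tt.
- by move=> x xV; apply: c; rewrite inE.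
Qed.

Lemma bagtree_tdec t : valid t -> t <> Leaf T ->
  exists (N : finType) (r : rel N) (B : N -> {set T}) (n0 : N),
    [/\ tdec r B (verts t), B n0 = root_bag t
      & forall V, V \in bags t <-> exists n, B n = V].
Proof.
elim: t => // V l IHl r IHr [vl vr /subsetP lV /subsetP rV /subsetP lr] _.
have [N1 [r1 [B1 [n1 [t1 b1 e1]]]]] : exists (N : finType) (r : rel N) (B : N -> {set T}) (n0 : N),
    [/\ tdec r B (V :|: verts l), B n0 = V
      & forall W, W \in V :: bags l <-> exists n, B n = W].
  have [->|nl] := pselect (l = Leaf T).
    exists unit, (fun _ _ => false), (fun _ => V), tt; rewrite /= setU0; split=> //.
      exact: tdec_unit.
    by move=> W; rewrite inE; split=> [/eqP ->|[_ ->]] //; exists tt.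
  have [N1 [r1 [B1 [n1 [t1 b1 e1]]]]] := IHl vl nl.
  exists (unit + N1)%type, (join_rel (fun _ _ => false) r1 tt n1), (join_bag (fun _ => V) B1), (inl tt).
  split=> //.
    apply: tdec_join (tdec_unit V) t1 _; apply/subsetP => x; rewrite !inE b1 => /andP[xV xl].
    by rewrite xV lV // inE xl.
  move=> W; rewrite inE; split.
    by case/predU1P=> [->|/e1[n <-]]; [exists (inl tt)|exists (inr n)].
  by move=> [[n|n] /= <-]; rewrite ?eqxx //; apply/orP; right; apply/e1; exists n.
have [->|nr] := pselect (r = Leaf T).
  exists N1, r1, B1, n1; rewrite /= setU0 cats0; split=> //.
have [N2 [r2 [B2 [n2 [t2 b2 e2]]]]] := IHr vr nr.
exists (N1 + N2)%type, (join_rel r1 r2 n1 n2), (join_bag B1 B2), (inl n1); split=> //.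
  apply: tdec_join t1 t2 _; apply/subsetP => x; rewrite !inE b1 b2 => /andP[/orP[xV|xl] xr].
    by rewrite xV rV // inE xr.
  have xV : x \in V by apply: lr; rewrite inE xl.
  by rewrite xV rV // inE xr.
move=> W; rewrite /= -cat_cons mem_cat; split.
  by case/orP=> [/e1|/e2] [n <-]; [exists (inl n)|exists (inr n)].
by move=> [[n|n] /= <-]; apply/orP; [left; apply/e1|right; apply/e2]; exists n.
Qed.

Lemma bridges_irr (N : finType) (r : rel N) : bridges r -> irreflexive r.
Proof. by move=> b a; apply/negP => /b; rewrite connect0. Qed.

(** The rest of a cycle connects the ends of any of its edges. *)
Lemma bridges_acyclic (N : finType) (r : rel N) p : symmetric r -> bridges r -> 2 < size p -> ~ ucycle r p.
Proof.
move=> rs b; case: p => [|x [|y [|z p]]] // _ /andP[/= /and3P[rxy ryz pz] U].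
have nxy : x != y by move: U; rewrite inE negb_or => /andP[/andP[]].
have nxz : x != z by move: U; rewrite !inE !negb_or => /andP[/and3P[]].
have nyz : y != z by move: U; rewrite !inE !negb_or => /andP[_ /andP[/andP[]]].
have yzp : y \notin rcons (z :: p) x.
  by case/and3P: U => _ yzp _; rewrite mem_rcons in_cons eq_sym negb_or nxy.
case/negP: (b x y rxy).
pose q u v := r u v && ~~ (((u, v) == (x, y)) || ((u, v) == (y, x))).
have nyx : (y == x) = false by rewrite eq_sym (negPf nxy).
have nzx : (z == x) = false by rewrite eq_sym (negPf nxz).
have qyz : q y z by rewrite /q ryz !xpair_eqE nyx nzx andbF.
have qs u v : u != y -> v != y -> r u v -> q u v.
  by move=> uy vy ruv; rewrite /q ruv !xpair_eqE (negPf uy) (negPf vy) andbF.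
have pq : path q z (rcons p x).
  move: yzp pz; rewrite /=; elim: (rcons p x) z {U ryz nxz nyz qyz nzx} => //= w s IH z.
  rewrite !inE !negb_or => /and3P[yz yw ys] /andP[rzw pw].
  by rewrite qs 1?eq_sym // IH // inE negb_or yw.
have cyx : connect q y x.
  by apply: (connect_trans (connect1 qyz)); apply/connectP; exists (rcons p x); rewrite ?last_rcons.
have qsym : symmetric q.
  by move=> u v; rewrite /q rs !xpair_eqE orbC (andbC (u == x)) (andbC (u == y)).
by rewrite (sym_connect_sym qsym).
Qed.
End ToTree.

(** Apply [dec_exists] to the empty bramble. *)
Theorem treewidth_le_bramble (G : sgraph) k :
  (forall BB, bramble (@adj G) BB -> exists2 X, covers X BB & #|X| <= k.+1) ->
  treewidth G <= k.
Proof.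
move=> sc.
have [|t [vt Vt et at_]] := dec_exists (@adj_sym G) sc (leqnn _) (BB := set0).
  by split=> [A|A B]; rewrite inE.
(* The empty bag gives a nonempty tree even if t is a leaf. *)
have [||N [r [B [n0 [[s c b cv vc] _ bE]]]]] := @bagtree_tdec _ (Node set0 t (Leaf G)) => //.
  by split=> //=; rewrite ?setI0 ?set0I ?sub0set.
pose TT := SGraph s (bridges_irr b).
have hw : has_width G (@width G TT B).
  exists TT, B; split=> //; split.
  - by split=> // p; exact: bridges_acyclic.
  - move=> x y xy; have [|||V Vb xyV] := et x y => //; try by rewrite inE.
    have [|n Bn] := (bE V).1; first by rewrite /= inE cats0 Vb orbT.
    by exists n; rewrite Bn.
  - by move=> x; apply: (vc x); rewrite /= Vt !inE orbT.
have -> : k = k.+1.-1 by [].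
rewrite /treewidth; case: ex_minnP => m _ /(_ _ (introT (asboolP _) hw)) mw.
apply: leq_trans mw _; rewrite /width -!subn1 leq_sub2r //.
apply/bigmax_leqP => n _; have : B n \in bags (Node set0 t (Leaf G)) by apply/bE; exists n.
rewrite /= inE cats0 => /predU1P[->|/at_]; first by rewrite cards0.
rewrite /admissible => /orP[//|/negP[]]; apply/coversP => A; by rewrite inE.
Qed.

(** * Covering paths of brambles *)

Section CoverPath.
Variables (T : finType) (e : rel T).
Hypothesis e_sym : symmetric e.
Implicit Types (A B M X Y S : {set T}) (BB : {set {set T}}) (P Q : seq T).

Definition order_ge BB k := forall X, covers X BB -> k <= #|X|.

Definition avoid BB X := [set B in BB | ~~ meets B X].

Lemma avoid_bramble BB X : bramble e BB -> bramble e (avoid BB X).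
Proof.
move=> [c t]; split=> [A|A B]; rewrite !inE; first by move=> /andP[/c].
by move=> /andP[hA _] /andP[hB _]; apply: t.
Qed.

Lemma avoid_order BB X k : order_ge BB k -> order_ge (avoid BB X) (k - #|X|).
Proof.
move=> o Y /coversP cY; rewrite leq_subLR; apply: leq_trans (leq_card_setU X Y).
apply: o; apply/coversP => B BB_B; rewrite meetsUl.
have [//|nX] := boolP (meets X B).
by apply: cY; rewrite inE BB_B meetsC.
Qed.

Lemma order_nonempty BB X : order_ge BB #|X|.+1 -> exists2 B, B \in BB & ~~ meets X B.
Proof.
move=> o; apply: contrapT => h.
have /o : covers X BB; last by rewrite ltnn.
apply/coversP => B BB_B; have [//|n] := boolP (meets X B); case: h.
by exists B.
Qed.

Lemma order_ex BB X k : order_ge BB k -> #|X| < k -> exists2 B, B \in BB & ~~ meets X B.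
Proof. by move=> o l; apply: order_nonempty => Y /o; apply: leq_trans. Qed.

(** Let the last vertex of the path be its only vertex in some member B, and let
    the path miss the member B'.  As B and B' touch, the path can be prolonged
    inside B until its first vertex in B', which keeps the invariant and
    increases the number of members met. *)
Lemma covering_path BB : bramble e BB -> exists P, [/\ uniq P, sorted e P
   & covers [set x in P] BB].
Proof.
move=> [cB tB].
have [[B0 B0B]|nB] := pselect (exists B, B \in BB); last first.
  exists [::]; split=> //; apply/coversP => B BB_B; case: nB; by exists B.
pose good P := exists x p B, [/\ P = rcons p x, uniq P, sorted e P, B \in BB
   & x \in B /\ forall y, y \in p -> y \notin B].
pose cov P := [set B in BB | meets [set x in P] B].
have [n0] := ubnP (#|BB| - 0).
have start : exists2 P, good P & 0 <= #|cov P|.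
  have [x xB] := conn_ex (cB _ B0B).
  by exists [:: x] => //; exists x, [::], B0; split.
move: start; move: {1 2}0 => m [P gP lm]; elim: n0 m P gP lm => // n IH m P gP lm hn.
have [cP|] := boolP (covers [set x in P] BB).
  by exists P; case: gP => x [p [B [_ ? ? _ _]]].
rewrite negb_forall => /existsP[B']; rewrite negb_imply => /andP[BB' nB'].
have [x [p [B [PE uP sP BB_B [xB pB]]]]] := gP.
have [Q [gQ PQ QB']] : exists Q, [/\ good Q, {subset P <= Q} & meets [set x in Q] B'].
  have cU : conn e (B :|: B') by apply: conn_touch; auto.
  have [z zB'] := conn_ex (cB _ BB').
  have xU : x \in B :|: B' by rewrite inE xB.
  have zU : z \in B :|: B' by rewrite inE zB' orbT.
  have [q [pq lq uq sq]] := conn_upath cU xU zU.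
  have [|r [s [t [rE ab ur _ rB']] rs]] := @abpath_lpath _ e [set x] B' (x :: q).
    by rewrite /= inE eqxx pq lq.
  move: ab ur rB' rs; rewrite rE => /and3P[/set1P -> pt lt] ut rB' rs {s r rE}.
  have nP w : w \in P -> w \notin B'.
    by move=> wP; apply: (nmeetsP nB'); rewrite inE.
  have xP : x \in P by rewrite PE mem_rcons mem_head.
  case/lastP: t pt lt ut rB' rs => [|t w] pt; first by rewrite /= (negPf (nP _ xP)).
  rewrite last_rcons => wB' ut rB' rs.
  have tB' v : v \in t -> v \notin B'.
    move=> vt; apply/negP => vB'; have vw : v = w.
      by apply: rB' => //; rewrite inE mem_rcons inE vt !orbT.
    by move: ut; rewrite /= rcons_uniq -vw vt andbF.
  exists (P ++ rcons t w); split.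
  - exists w, (P ++ t), B'; split=> //.
    + by rewrite -rcons_cat.
    + move: ut; rewrite [uniq (x :: _)]/= cat_uniq uP => /andP[xt ->].
      rewrite andbT; apply/hasPn => v vt /=; apply/negP => vP.
      have := rs v; rewrite inE vt orbT => /(_ isT)/sq; rewrite inE (negPf (nP _ vP)) orbF => vB.
      move: vP; rewrite PE mem_rcons inE => /predU1P[vx|/pB]; last by rewrite vB.
      by move: xt; rewrite -vx vt.
    + by move: sP; rewrite PE; case: (p) => [|p0 p'] //= ; rewrite cat_path last_rcons => ->.
    + split=> // v; rewrite mem_cat => /orP[/nP|/tB'] //.
  - by move=> v vP; rewrite mem_cat vP.
  - by apply: (@meetsI _ w); rewrite // inE mem_cat mem_rcons mem_head orbT.
apply: (IH m.+1 Q gQ) => //.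
  apply: (leq_ltn_trans lm); apply: proper_card; apply/properP; split.
    apply/subsetP => C; rewrite !inE => /andP[-> /meetsP[y yP yC]] /=.
    by apply: (meetsI _ yC); rewrite inE; apply: PQ; rewrite inE in yP.
  by exists B'; rewrite !inE BB' // (negPf nB').
have mB : m < #|BB|.
  apply: (leq_ltn_trans lm); apply: proper_card; apply/properP; split.
    by apply/subsetP => C; rewrite inE => /andP[].
  by exists B' => //; rewrite inE BB' (negPf nB').
by move: hn mB; lia.
Qed.

(** The order drops by at most one at each vertex, so the shortest initial
    segment after which it is at most u leaves it equal to u. *)
Lemma hub_path BB k u : bramble e BB -> order_ge BB k -> u <= k ->
  exists P, [/\ uniq P, sorted e P, order_ge (avoid BB [set x in P]) u
    & exists2 Y, covers Y (avoid BB [set x in P]) & #|Y| <= u].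
Proof.
move=> bB o uk; have [P [uP sP cP]] := covering_path bB.
pose av i := avoid BB [set x in take i P].
have ex : exists i, [exists Y, covers Y (av i) && (#|Y| <= u)].
  exists (size P); apply/existsP; exists set0; rewrite cards0 andbT.
  apply/coversP => B; rewrite /av take_size inE meetsC => /andP[/(coversP _ _ cP) ->] //.
have [i /existsP[Y /andP[cY Yu]] imin] := ex_minnP ex.
exists (take i P); split.
- exact: take_uniq.
- exact: take_sorted.
- case: i imin cY => [|i] imin cY.
    have /coversP E : covers Y BB.
      apply/coversP => B BB_B; move/coversP: cY; apply; rewrite !inE BB_B take0.
      by apply/negP => /meetsP[x _]; rewrite inE.
    by move=> X cX; apply: leq_trans uk _; apply: o; apply/coversP => B BB_B;
      move/coversP: cX; apply; rewrite !inE BB_B take0;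
      apply/negP => /meetsP[x _]; rewrite inE.
  have oi : order_ge (av i) u.+1.
    move=> X cX; rewrite ltnNge; apply/negP => Xu.
    have /imin : [exists Y, covers Y (av i) && (#|Y| <= u)] by apply/existsP; exists X; rewrite cX.
    by rewrite ltnn.
  have [iP|iP] := ltnP i (size P); last first.
    have /imin : [exists Y, covers Y (av i) && (#|Y| <= u)].
      apply/existsP; exists Y; rewrite Yu andbT; move: cY; rewrite /av !take_oversize //.
      exact: leqW.
    by rewrite ltnn.
  have [z zP] : exists z, take i.+1 P = rcons (take i P) z.
    by case: (P) iP => // z0 P' iP; exists (nth z0 (z0 :: P') i); rewrite -take_nth.
  move=> X cX; have : u.+1 <= #|z |: X|.
    apply: oi; apply/coversP => B; rewrite inE => /andP[BB_B nB].
    rewrite meetsUl meets1l; have [//|zB] := boolP (z \in B); rewrite /=.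
    move/coversP: cX; apply; rewrite inE BB_B /= zP; apply: contra nB.
    case/meetsP=> y yB; rewrite inE mem_rcons inE => /predU1P[yz|yP].
      by rewrite -yz yB in zB.
    by apply: (meetsI yB); rewrite inE.
  rewrite cardsU1; case: (z \in X) => /=; lia.
- by exists Y.
Qed.

(** * Linkage through the hub *)

Variables (U : {set T}) (BU : {set {set T}}).

(** BU will consist of the members that avoid the path, U of the component in
    which they lie.  The set S fails to cut X off from BU if a vertex of X
    outside S can enter U and reach a whole member without meeting S. *)
Definition hits X S := exists x M, [/\ x \in X :\: S, conn e M, M \subset U :\: S,
  (exists2 y, y \in M & e x y) & exists2 B, B \in BU & B \subset M].

Definition rank_ge X m := forall S, #|S| < m -> hits X S.

Lemma not_rank_ge X m : ~ rank_ge X m -> exists2 S : {set T}, #|S| < m & ~ hits X S.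
Proof.
move=> /existsNP[S /not_implyP[? ?]]; by exists S.
Qed.

(** The two properties of a minimal initial segment of given rank: without its
    last vertex it is cut off by few vertices. *)
Lemma min_prefix Q m : 0 < m -> rank_ge [set x in Q] m ->
  exists Q1 a Q2, [/\ Q = Q1 ++ a :: Q2, rank_ge [set x in rcons Q1 a] m
    & exists2 S : {set T}, #|S| < m & ~ hits [set x in Q1] S].
Proof.
move=> m0; elim/last_ind: Q => [|Q a IH] r.
  have [|x [M [+ _ _ _ _]]] := r set0; first by rewrite cards0.
  by rewrite !inE.
have [/IH[Q1 [a' [Q2 [-> r' b]]]]|/not_rank_ge b] := pselect (rank_ge [set x in Q] m).
  by exists Q1, a', (rcons Q2 a); rewrite rcons_cat.
by exists Q, a, [::]; rewrite cats1.
Qed.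

Hypothesis BU_touch : forall A B, A \in BU -> B \in BU -> touch e A B.

(** The members reached from X and from Y touch. *)
Lemma linked_sep X Y S m : rank_ge X m -> rank_ge Y m -> #|S| < m ->
  exists x y M, [/\ x \in X :\: S, y \in Y :\: S, conn e M, M \subset U :\: S
    & (exists2 u, u \in M & e x u) /\ (exists2 v, v \in M & e y v)].
Proof.
move=> rX rY Sm; have [x [M1 [xX c1 s1 [u uM xu] [B1 B1U sB1]]]] := rX S Sm.
have [y [M2 [yY c2 s2 [v vM yv] [B2 B2U sB2]]]] := rY S Sm.
exists x, y, (M1 :|: M2); split=> //.
- apply: conn_touch => //; have /touchP[p [q [pB qB pq]]] := BU_touch B1U B2U.
  by apply/touchP; exists p, q; split; [exact: (subsetP sB1)|exact: (subsetP sB2)|].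
- by rewrite subUset s1.
- by split; [exists u|exists v]; rewrite // inE ?uM ?vM ?orbT.
Qed.

(** Menger's theorem in the graph of the edges with an end in U: a path of this
    graph that meets X and Y only at its ends has its inner vertices in U, and
    it has some. *)
Lemma linked X Y m : [disjoint X & Y] -> [disjoint X & U] -> [disjoint Y & U] ->
  rank_ge X m -> rank_ge Y m ->
  exists (a z : 'I_m -> T) (N : 'I_m -> seq T),
   [/\ (forall i, [/\ a i \in X, z i \in Y & {subset N i <= U}]),
       injective a, injective z,
       (forall i, [/\ N i != [::], path e (a i) (rcons (N i) (z i)) & uniq (N i)])
     & forall i j v, v \in N i -> v \in N j -> i = j].
Proof.
move=> dXY dXU dYU rX rY.
pose e' := restr [rel u v | ((u \in U) || (v \in U)) && e u v] (X :|: Y :|: U).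
have [S sS|f [f1 f2]] := @menger _ e' X Y m.
  rewrite leqNgt; apply/negP => Sm.
  have [x [y [M [+ + cM sM [[u uM xu] [v vM yv]]]]]] := linked_sep rX rY Sm.
  rewrite !inE => /andP[xS xX] /andP[yS yY].
  have [p [pp lp _ sp]] := conn_upath cM uM vM.
  have inM w : w \in M -> w \in U /\ w \notin S.
    by move/(subsetP sM); rewrite inE => /andP[].
  have : has (mem S) (x :: u :: rcons p y).
    apply: sS; rewrite /abpath xX [last _ _]/= last_rcons yY andbT /= rcons_path lp.
    have e'I a b : a \in X :|: Y :|: U -> b \in X :|: Y :|: U -> (a \in U) || (b \in U) -> e a b -> e' a b.
      by move=> ha hb hab eab; apply/and3P; split=> //; apply/andP.
    rewrite !e'I ?inE ?xX ?yY ?(inM _ uM).1 ?(inM _ vM).1 ?orbT ?xu 1?e_sym ?yv //= andbT.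
    elim: p u uM pp sp {xu lp} => //= w p IH u uM /andP[uw pp] sp.
    have wM : w \in M by apply: sp; rewrite !inE eqxx orbT.
    rewrite e'I ?inE ?(inM _ uM).1 ?(inM _ wM).1 ?orbT //=; apply: IH => // t tp.
    by apply: sp; rewrite inE tp orbT.
  have := fun w h => (inM w (sp w h)).2; move=> nS.
  case/hasP=> w + wS; rewrite /= in wS; rewrite inE -rcons_cons mem_rcons inE.
  by case/or3P=> [/eqP E|/eqP E|/nS]; rewrite ?wS //; move: xS yS; rewrite -E wS.
have nXY w : w \in X -> w \in Y -> False by move=> h; rewrite (disjointFr dXY h).
have nXU w : w \in X -> w \in U -> False by move=> h; rewrite (disjointFr dXU h).
have nYU w : w \in Y -> w \in U -> False by move=> h; rewrite (disjointFr dYU h).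
have /choice[g gP] : forall i, exists g : T * T * seq T, f i = g.1.1 :: rcons g.2 g.1.2
     /\ [/\ g.1.1 \in X, g.1.2 \in Y, {subset g.2 <= U}, g.2 != [::] &
            path e g.1.1 (rcons g.2 g.1.2) /\ uniq g.2].
  move=> i; have [x [q [E ab uq hX hY]]] := f1 i.
  move: ab uq hX hY; rewrite E => /and3P[xX pq lq] uq hX hY.
  case/lastP: q pq lq uq hX hY E => [|N z] pq; first by move=> /= /(nXY _ xX).
  rewrite last_rcons => zY uq hX hY E; exists (x, z, N) => /=; split=> //.
  have NU : {subset N <= U}.
    move=> w wN; have wr : w \in x :: rcons N z by rewrite inE mem_rcons inE wN !orbT.
    have : w \in X :|: Y :|: U.
      case/splitPr: wN pq => p1 p2; rewrite rcons_cat cat_path /= => /and3P[_ + _].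
      by rewrite /e' /= => /and3P[].
    rewrite !inE => /orP[/orP[wX|wY]|//].
      by have := hX w wr wX => wx; move: uq; rewrite /= mem_rcons inE -wx wN orbT.
    by have := hY w wr wY => wz; move: uq; rewrite /= rcons_uniq -wz wN /= andbF.
  split=> //.
  - case: N pq {uq hX hY E NU} => //= /andP[/and3P[_ _ /andP[/orP[/(nXU _ xX)|/(nYU _ zY)] //]]].
  - split; last by move: uq; rewrite /= rcons_uniq => /and3P[].
    by apply: sub_path pq => v w /and3P[_ _ /andP[]].
exists (fun i => (g i).1.1), (fun i => (g i).1.2), (fun i => (g i).2); split.
- by move=> i; case: (gP i) => _ [].
- move=> i j ij; apply: (f2 i j (g i).1.1).
    by rewrite (gP i).1 mem_head.
  by rewrite ij (gP j).1 mem_head.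
- move=> i j ij; apply: (f2 i j (g i).1.2).
    by rewrite (gP i).1 inE mem_rcons mem_head orbT.
  by rewrite ij (gP j).1 inE mem_rcons mem_head orbT.
- by move=> i; case: (gP i) => _ [_ _ _ ? []].
- move=> i j v vi vj; apply: (f2 i j v).
    by rewrite (gP i).1 inE mem_rcons inE vi !orbT.
  by rewrite (gP j).1 inE mem_rcons inE vj !orbT.
Qed.
End CoverPath.

(** * Covers of the bramble from blocked parts of the path *)

Section Cover.
Variables (T : finType) (e : rel T).
Hypothesis e_sym : symmetric e.
Implicit Types (A B M X Y S P : {set T}) (BB : {set {set T}}).

(** The members that avoid P touch each other, so that they lie in the same
    component of the complement of P. *)
Lemma hub_exists BB P u : bramble e BB -> 0 < u -> order_ge (avoid BB P) u ->
  exists U, [/\ conn e U, [disjoint U & P], (forall B, B \in avoid BB P -> B \subset U)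
    & forall M, conn e M -> [disjoint M & P] -> meets M U -> M \subset U].
Proof.
move=> bB u0 o; have [cB tB] := avoid_bramble P bB.
have [B0 B0B _] : exists2 B, B \in avoid BB P & ~~ meets set0 B.
  by apply: order_ex o _; rewrite cards0.
have [x xB0] := conn_ex (cB _ B0B).
have av B : B \in avoid BB P -> B \subset ~: P.
  by rewrite inE => /andP[_ h]; apply: nmeets_sub; rewrite setCK.
have xD : x \in ~: P by apply: (subsetP (av _ B0B)).
exists (component e (~: P) x); split.
- exact: component_conn.
- by rewrite disjoints_subset component_sub.
- move=> B BB_B.
  have cU : conn e (B0 :|: B) by apply: conn_touch; auto.
  apply: subset_trans (subsetUr B0 B) _; apply: component_max => //.
    by rewrite subUset !av.
  by rewrite inE xB0.
- move=> M cM dM mM; apply: conn_component => //.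
  by rewrite -disjoints_subset.
Qed.

(** Otherwise some member B misses S0, the Si and Y.  It meets P, as Y covers the
    members that avoid P.  Since the Si have fewer than u vertices together,
    they also miss a member B' that avoids P.  As B and B' touch, an edge leads
    from a vertex y of P and B into a connected part of U that misses the Si
    and contains B'.  But y is neither in S0 nor, by the choice of the Si, in
    any Xi. *)
Lemma cover_blocked BB k u P (U Y S0 X1 X2 X3 S1 S2 S3 : {set T}) :
  bramble e BB -> order_ge BB k -> order_ge (avoid BB P) u ->
  covers Y (avoid BB P) -> #|Y| <= u ->
  (forall B, B \in avoid BB P -> B \subset U) ->
  (forall M, conn e M -> [disjoint M & P] -> meets M U -> M \subset U) ->
  ~ hits e U (avoid BB P) X1 S1 -> ~ hits e U (avoid BB P) X2 S2 ->
  ~ hits e U (avoid BB P) X3 S3 ->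
  (forall x y, x \in P -> y \in U -> e x y -> x \in S0 :|: X1 :|: X2 :|: X3) ->
  #|S1| + #|S2| + #|S3| < u ->
  k <= #|S0| + #|S1| + #|S2| + #|S3| + u.
Proof.
move=> bB oB oU cY Yu BU Umax h1 h2 h3 sP Su.
rewrite leqNgt; apply/negP => lk.
pose SS := S1 :|: S2 :|: S3.
have SSc : #|SS| <= #|S1| + #|S2| + #|S3|.
  by apply: leq_trans (leq_card_setU _ _) _; rewrite leq_add2r leq_card_setU.
have [B BB_B nB] : exists2 B, B \in BB & ~~ meets (S0 :|: SS :|: Y) B.
  apply: order_ex oB _; apply: leq_ltn_trans lk.
  apply: leq_trans (leq_card_setU _ _) _; apply: leq_add => //.
  by apply: leq_trans (leq_card_setU _ _) _; rewrite -!addnA leq_add2l addnA.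
move: nB; rewrite (meetsUl (S0 :|: SS)) (meetsUl S0) !negb_or => /andP[/andP[nB0 nBS] nBY].
have BP : meets B P.
  have [//|nP] := boolP (meets B P); move/negP: nBY; case; move/coversP: cY; apply.
  by rewrite inE BB_B.
have [B' B'U nB'] := order_ex oU (leq_ltn_trans SSc Su).
have [cB tB] := bB.
have /andP[B'B nB'P] : (B' \in BB) && ~~ meets B' P by move: B'U; rewrite inE.
have cBB : conn e (B :|: B') by apply: conn_touch; auto.
have [w wB'] := conn_ex (cB _ B'B).
pose D := (B :|: B') :\: P.
have B'D : B' \subset D.
  by apply/subsetP => x xB'; rewrite !inE xB' orbT andbT (nmeetsP nB'P).
have wD : w \in D := subsetP B'D _ wB'.
pose M := component e D w.
have cM : conn e M by apply: component_conn.
have B'M : B' \subset M by apply: component_max => //; auto.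
have MD : M \subset D := component_sub _ _ _.
have dMP : [disjoint M & P].
  rewrite disjoints_subset; apply: subset_trans MD _; apply/subsetP => x.
  by rewrite !inE => /andP[].
have MU : M \subset U.
  apply: Umax => //; apply: (@meetsI _ w); first exact: (subsetP B'M).
  exact: (subsetP (BU _ B'U)).
have MS : M \subset U :\: SS.
  apply/subsetP => x xM; rewrite inE (subsetP MU) // andbT.
  have := subsetP MD _ xM; rewrite 2!inE => /andP[_] /orP[xB|xB'].
    by move: nBS; rewrite meetsC; move/nmeetsP; apply.
  by move: nB'; rewrite meetsC; move/nmeetsP; apply.
have [x [y [xBB yBB xM yM xy]]] : exists x y, [/\ x \in B :|: B', y \in B :|: B', x \in M, y \notin M & e x y].
  apply: conn_cross => //.
    by apply: (@meetsI _ w); [rewrite inE wB' orbT|exact: (subsetP B'M)].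
  case/meetsP: BP => y yB yP; apply/subsetPn; exists y; first by rewrite inE yB.
  by apply/negP => /(disjointFr dMP); rewrite yP.
have yP : y \in P.
  have [//|nyP] := boolP (y \in P); move/negP: yM; case.
  by apply: component_closed xM _ xy; rewrite inE nyP.
have yB : y \in B.
  by move: yBB; rewrite inE => /orP[//|yB']; have := nmeetsP nB'P yB'; rewrite yP.
have eyx : e y x by rewrite e_sym.
have nyS (Z : {set T}) : Z \subset S0 :|: SS -> y \notin Z.
  move=> sZ; apply/negP => /(subsetP sZ); rewrite inE => /orP[y0|yS].
    by have := nmeetsP nB0 y0; rewrite yB.
  by have := nmeetsP nBS yS; rewrite yB.
have key X S : S \subset SS -> y \in X -> hits e U (avoid BB P) X S.
  move=> sS yX; exists y, M; split=> //.
  - by rewrite inE yX andbT nyS // (subset_trans sS) ?subsetUr.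
  - by apply: subset_trans MS _; apply: setDS.
  - by exists x.
  - by exists B'.
have := sP y x yP (subsetP MU _ xM) eyx; rewrite !inE.
case/orP=> [/orP[/orP[y0|y1]|y2]|y3].
- by have := nyS S0; rewrite subsetUl y0 => /(_ isT).
- by apply: h1; apply: key => //; rewrite /SS -setUA subsetUl.
- by apply: h2; apply: key => //; rewrite /SS (setUC S1) -setUA subsetUl.
- by apply: h3; apply: key => //; rewrite subsetUr.
Qed.
End Cover.

(** * Models of cycles *)

Section Models.
Variables (T : finType) (e : rel T).
Implicit Types (A B M X Y S R W : {set T}).

(** A cycle of length at least l inside W, in which one vertex or arc is replaced
    by the connected set R. *)
Definition cycle_model l W := exists x p R,
  [/\ uniq (x :: p), path e x p, l <= (size p).+2 & {subset x :: p <= W}] /\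
  [/\ conn e R, (forall v, v \in x :: p -> v \notin R), R \subset W,
      (exists2 v, v \in R & e x v) & exists2 v, v \in R & e (last x p) v].

Lemma cycle_model_le l l' W : l' <= l -> cycle_model l W -> cycle_model l' W.
Proof.
move=> ll [x [p [R [[? ? ? ?] h]]]]; exists x, p, R; split=> //.
by split=> //; apply: leq_trans ll _.
Qed.

(** The branch sets are the first l - 2 vertices of the path, the rest of the
    path, and R. *)
Lemma model_branches l W : symmetric e -> 3 <= l -> cycle_model l W ->
  exists b : 'I_l -> {set T},
    [/\ forall i, conn e (b i), forall i j, i != j -> [disjoint b i & b j],
        forall i j, cycle_adj i j -> exists u v, [/\ u \in b i, v \in b j & e u v]
      & forall i, b i \subset W].
Proof.
move=> e_sym l3 [x [p [R [[U pp lp sW] [cR dR RW [v0 v0R e0] [v1 v1R e1]]]]]].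
pose s := x :: p; have ss : size s = (size p).+1 by [].
pose b (i : 'I_l) := if i < l.-2 then [set nth x s i] else
  if i < l.-1 then [set w in drop l.-2 s] else R.
have nb (i : 'I_l) : i < l.-1 -> nth x s i \in b i.
  rewrite /b => i1; case: ltnP => i2; first by rewrite set11.
  rewrite i1 inE; have -> : i = l.-2 :> nat by move: i1 i2; lia.
  by rewrite -[X in nth _ _ X]addn0 -nth_drop mem_nth // size_drop ss; move: l3 lp; lia.
have bs (i : 'I_l) w : i < l.-1 -> w \in b i -> w \in s /\
    exists k, [/\ k < size s, w = nth x s k, i <= k & (i < l.-2 -> k = i)].
  rewrite /b => i1; case: ltnP => i2.
    move=> /set1P ->; split; first by rewrite mem_nth // ss; move: i2 lp; lia.
    by exists i; split=> //; rewrite ss; move: i2 lp; lia.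
  rewrite i1 inE => wd; split; first exact: mem_drop wd.
  exists (l.-2 + index w (drop l.-2 s)).
  have iw : index w (drop l.-2 s) < size (drop l.-2 s) by rewrite index_mem.
  split; [|by rewrite -nth_drop nth_index| |by []].
    by move: iw; rewrite size_drop; lia.
  by move: i1; lia.
have bR (i : 'I_l) : l.-1 <= i -> b i = R.
  by move=> i1; rewrite /b !ltnNge i1 (leq_trans _ i1) //; lia.
have bd (i j : 'I_l) : i < j -> [disjoint b i & b j].
  move=> ij; rewrite -nmeets_disj; apply/negP => /meetsP[w wi wj].
  have i1 : i < l.-1 by move: (ltn_ord j) ij; lia.
  have [ws [k [ks wk ik ki]]] := bs _ _ i1 wi.
  have [j1|j1] := ltnP j l.-1; last by move: (dR _ ws); rewrite -(bR j j1) wj.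
  have [_ [k' [ks' wk' jk' _]]] := bs _ _ j1 wj.
  have kk : k = k'.
    by apply/eqP; rewrite -(nth_uniq x ks ks' U) -wk -wk'.
  have ik2 : k = i by apply: ki; clear -j1 ij; lia.
  by clear -ij jk' kk ik2; lia.
have es k : k.+1 < size s -> e (nth x s k) (nth x s k.+1).
  by move=> ks; apply: (pathP x pp).
have ad (i j : 'I_l) : j == ordS i -> i != j -> exists u v, [/\ u \in b i, v \in b j & e u v].
  move=> /eqP -> nij; have [i1|i1] := ltnP i l.-2.
    have jE : ordS i = i.+1 :> nat by rewrite /= modn_small //; move: i1; lia.
    exists (nth x s i), (nth x s i.+1); split.
    - by apply: nb; move: i1; lia.
    - by rewrite -jE; apply: nb; rewrite jE; move: i1; lia.
    - by apply: es; rewrite ss; move: i1 lp; lia.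
  have [i2|i2] := ltnP i l.-1.
    have jE : ordS i = i.+1 :> nat by rewrite /= modn_small //; move: i2; lia.
    exists (last x p), v1; split=> //.
      have -> : b i = [set w in drop l.-2 s] by rewrite /b ltnNge i1 i2.
      rewrite inE; have : last x p \in take l.-2 s ++ drop l.-2 s by rewrite cat_take_drop mem_last.
      rewrite mem_cat => /orP[lt|//].
      have : index (last x p) s < l.-2.
        rewrite -(cat_take_drop l.-2 s) index_cat lt.
        apply: leq_trans (_ : size (take l.-2 s) <= _); first by rewrite index_mem.
        by rewrite size_take; case: ltnP.
      have -> : last x p = nth x s (size p) by rewrite (last_nth x).
      by rewrite index_uniq // ?ss //; clear -lp l3; lia.
    by rewrite bR // jE; move: i1; lia.
  have iE : i = l.-1 :> nat by move: i2 (ltn_ord i); lia.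
  have jE : ordS i = 0 :> nat by rewrite /= iE prednK ?modnn //; move: l3; lia.
  exists v0, x; split=> //; last by rewrite e_sym.
    by rewrite bR.
  by rewrite -[x]/(nth x s 0) -jE; apply: nb; rewrite jE; move: l3; lia.
exists b; split.
- move=> i; rewrite /b; case: ltnP => i1; first exact: conn1.
  case: ltnP => i2 //.
  have : drop l.-2 s != [::] by rewrite -size_eq0 size_drop ss; move: lp l3; lia.
  case E: (drop l.-2 s) => [|y q] // _; apply: conn_path => //.
  have := pp; rewrite -[path e x p]/(sorted e s) => /(drop_sorted l.-2); by rewrite E.
- move=> i j; rewrite neq_ltn => /orP[]; first exact: bd.
  by rewrite disjoint_sym; apply: bd.
- move=> i j /andP[nij /orP[/ad|/ad]]; first exact.
  rewrite eq_sym => /(_ nij)[u [v [? ? ?]]]; exists v, u; split=> //.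
  by rewrite e_sym.
- move=> i; apply/subsetP => w wb; have [i1|i1] := ltnP i l.-1.
    by apply: sW; case: (bs _ _ i1 wb).
  by move: wb; rewrite bR // => /(subsetP RW).
Qed.
End Models.

Lemma model_restr (T : finType) (e : rel T) D l W :
  symmetric e -> 3 <= l -> cycle_model (restr e D) l W -> cycle_model e l (W :&: D).
Proof.
move=> e_sym l3 [x [p [R [[U pp lp sW] [cR dR RW [v0 v0R e0] [v1 v1R e1]]]]]].
have sub : subrel (restr e D) e by move=> u v /and3P[].
exists x, p, R; split; split=> //.
- exact: sub_path pp.
- move=> v vp; rewrite inE sW //=; move: vp; rewrite inE => /predU1P[->|].
    by case/and3P: e0.
  elim: (p) x pp {U lp sW dR e0 e1} => //= y q IH x /andP[/and3P[_ yD _] pq].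
  by rewrite inE => /predU1P[->//|]; apply: IH pq.
- by apply: conn_rel cR => u v _ _ /sub.
- rewrite subsetI RW /=; apply: (conn_subX cR); first by apply: (meetsI v0R); case/and3P: e0.
  by move=> u v _ _ _ /and3P[].
- by exists v0 => //; apply: sub.
- by exists v1 => //; apply: sub.
Qed.

Lemma minor_iso (H H' G : sgraph) : iso H H' -> minor H' G -> minor H G.
Proof.
move=> [phi bphi hphi] [B [B1 B2 B3]]; exists (fun x => B (phi x)); split=> //.
- by move=> x y nxy; apply: B2; rewrite (inj_eq (bij_inj bphi)).
- by move=> x y xy; apply: B3; rewrite hphi.
Qed.

Lemma minor_of_models (G : sgraph) r (l : 'I_r -> nat) (W : 'I_r -> {set G}) :
  (forall i, 3 <= l i) -> (forall i, cycle_model (@adj G) (l i) (W i)) ->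
  (forall i j, i != j -> [disjoint W i & W j]) ->
  minor (disjoint_union (fun i : 'I_r => cycle_graph (l i))) G.
Proof.
move=> l3 cm dW.
have h i := model_branches (@adj_sym G) (l3 i) (cm i).
pose b i := projT1 (cid (h i)).
have hb i := projT2 (cid (h i)).
exists (fun u => b (tag u) (tagged u)); split.
- by move=> [i x]; case: (hb i) => c _ _ _; exact: (c x).
- move=> [i x] [j y] /= nxy; have [ij|nij] := eqVneq i j.
    subst j; case: (hb i) => _ + _ _; apply; apply: contra nxy => /eqP ->; exact: eqxx.
  have [_ _ _ si] := hb i; have [_ _ _ sj] := hb j.
  exact: disjointW (si x) (sj y) (dW _ _ nij).
- move=> [i x] [j y]; rewrite /adj /= /union_adj /= => /andP[/eqP ij]; subst j.
  rewrite tagged_asE /= => xy; case: (hb i) => _ _ + _; exact.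
Qed.

(** * Separators in linear order *)

Section Chain.
Variables (T : finType) (e : rel T).
Hypothesis e_sym : symmetric e.
Implicit Types (A B C D M N S U X Y : {set T}).

Lemma split_first (a : pred T) s : has a s ->
  exists s1 x s2, [/\ s = s1 ++ x :: s2, a x & ~~ has a s1].
Proof.
elim: s => //= x s IH; have [ax _|nax /= /IH[s1 [y [s2 [-> ay h]]]]] := boolP (a x).
  by exists [::], x, s.
by exists (x :: s1), y, s2; rewrite /= (negPf nax).
Qed.

Lemma split_last (a : pred T) s : has a s ->
  exists s1 x s2, [/\ s = s1 ++ x :: s2, a x & ~~ has a s2].
Proof.
elim: s => //= x s IH; have [/IH[s1 [y [s2 [-> ay h]]]] _|h] := boolP (has a s).
  by exists (x :: s1), y, s2.
by rewrite orbF => ax; exists [::], x, s.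
Qed.

Lemma nhas_meets s A : ~~ has (mem A) s = ~~ meets [set x in s] A.
Proof.
congr (~~ _); apply/hasP/meetsP => [[x xs xA]|[x]]; first by exists x; rewrite ?inE.
by rewrite inE => xs xA; exists x.
Qed.

Lemma conn_sorted s x : sorted e s -> x \in s -> conn e [set y in s].
Proof. by case: s => // y s; move=> ps _; apply: conn_path. Qed.

(** Seen from S, the set A comes before B. *)
Definition sreach D S A B :=
  exists C, [/\ conn e C, C \subset D, meets C S, meets C A & ~~ meets C B].

(** A connected set that joins x to N; outside N it contains only vertices that
    are connected to x off N. *)
Definition attach U N x := N :|: component e (U :\: N) x.

Lemma attach_conn U N x : conn e U -> conn e N -> N \subset U -> x \in U ->
  conn e (attach U N x).
Proof.
move=> cU cN sN xU; rewrite /attach.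
have [xN|xN] := boolP (x \in N).
  rewrite (_ : component e (U :\: N) x = set0) ?setU0 //.
  apply/setP => y; rewrite !inE; apply/negP => /andP[yU /connectP[[|z p] /= +]].
    by move=> _ E; rewrite E xN in yU.
  by case/andP=> /andP[+ _] _; rewrite inE xN.
have xD : x \in U :\: N by rewrite inE xN.
have cC := component_conn e_sym xD; have xC := component_refl e xD.
have [z zN] := conn_ex cN.
have nzC : z \notin component e (U :\: N) x.
  by apply/negP => /(subsetP (component_sub _ _ _)); rewrite inE zN.
have [||y [w [_ wU yC wC yw]]] := @conn_cross _ e U (component e (U :\: N) x) cU.
- exact: meetsI xU xC.
- by apply/subsetPn; exists z => //; exact: (subsetP sN).
rewrite setUC; apply: (connE e_sym cC cN yC _ yw).
have [//|wN] := boolP (w \in N); move/negP: wC; case.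
by apply: component_closed yC _ yw => //; rewrite inE wN.
Qed.

Lemma attach_in U N x : x \in U -> x \in attach U N x.
Proof.
move=> xU; rewrite /attach inE; case xN: (x \in N) => //=.
by apply: component_refl; rewrite inE xN.
Qed.

Lemma attach_sub U N x : N \subset U -> attach U N x \subset U.
Proof.
move=> sN; rewrite subUset sN /=.
exact: subset_trans (component_sub _ _ _) (subsetDl _ _).
Qed.

Lemma find_lt_split (a b : pred T) s : find a s < find b s ->
  exists s1 x s2, [/\ s = s1 ++ x :: s2, a x & ~~ has b (rcons s1 x)].
Proof.
elim: s => //= x s IH; case ax: (a x); case bx: (b x) => //=.
  by move=> _; exists [::], x, s; rewrite /= bx.
rewrite ltnS => /IH[s1 [y [s2 [-> ay h]]]].
by exists (x :: s1), y, s2; rewrite /= bx.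
Qed.

(** The first hits along a path from S to S' order the disjoint connected sets
    that separate S from S'.  The path up to its first vertex in N misses N'.
    The rest of the path after its last vertex in N meets N', since otherwise
    these two parts and N would connect S to S' off N'. *)
Lemma chain D S S' N N' x p :
  (forall M, conn e M -> M \subset D -> meets M S -> meets M S' -> meets M N') ->
  conn e N -> N \subset D -> ~~ meets N N' ->
  path e x p -> {subset x :: p <= D} -> x \in S -> last x p \in S' ->
  find (mem N) (x :: p) < find (mem N') (x :: p) ->
  sreach D S N N' /\ sreach D S' N' N.
Proof.
move=> sepN' cN sND nNN' pp sp xS lS' /find_lt_split[s1 [n [s2 [E nN h1]]]].
have ss : sorted e (s1 ++ n :: s2) by rewrite -E.
have ss1 : sorted e (rcons s1 n).
  by move: ss; rewrite -cat_rcons => /cat_sorted2[].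
pose C1 := [set y in rcons s1 n].
have cC1 : conn e C1 by apply: (conn_sorted ss1 (x := n)); rewrite mem_rcons mem_head.
have sC1 : C1 \subset D.
  by apply/subsetP => y; rewrite inE => ys; apply: sp; rewrite E -cat_rcons mem_cat ys.
have C1S : meets C1 S.
  apply: (meetsI _ xS); rewrite inE; move: E; case: (s1) => [|y s1'] [-> _].
    by rewrite mem_head.
  by rewrite rcons_cons mem_head.
have nC1 : n \in C1 by rewrite inE mem_rcons mem_head.
split.
  exists C1; split=> //; first exact: meetsI nC1 nN.
  by rewrite -nhas_meets.
have [t1 [w [t2 [E' wN h2]]]] : exists t1 w t2, [/\ n :: s2 = t1 ++ w :: t2, w \in N & ~~ has (mem N) t2].
  by apply: split_last; apply/hasP; exists n; rewrite ?mem_head.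
rewrite E' in ss E.
have lw : last w t2 \in S' by move: lS'; rewrite -[last x p]/(last x (x :: p)) E !last_cat.
pose C2 := [set y in w :: t2].
have st2 : path e w t2 by move: ss; rewrite catA => /cat_sorted2[].
have cC2 : conn e C2 by apply: conn_path.
have sC2 : C2 \subset D.
  by apply/subsetP => y; rewrite inE => ys; apply: sp; rewrite E catA mem_cat ys orbT.
have cM : conn e (C1 :|: N :|: C2).
  apply: connU => //; first by apply: connU => //; apply: meetsI nC1 nN.
  by apply: (@meetsI _ w); rewrite !inE ?wN ?eqxx ?orbT.
have : meets (C1 :|: N :|: C2) N'.
  apply: sepN' => //; first by rewrite !subUset sC1 sND.
    by rewrite -setUA meetsUl C1S.
  by rewrite meetsUl; apply/orP; right; apply: (meetsI _ lw); rewrite inE mem_last.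
rewrite !meetsUl (negPf nNN') orbF -[meets C1 N']negbK -nhas_meets h1 /=.
case/meetsP=> v; rewrite inE in_cons => /predU1P[->|vt vN'].
  by move=> wN'; move/negP: nNN'; case; apply: meetsI wN wN'.
(* the part of the path after its last vertex in N *)
case: t2 E E' h2 lw st2 vt {C2 cC2 sC2 cM ss} => // t t2 E E' h2 lw /andP[_ st2] vt.
exists [set y in t :: t2]; split.
- exact: conn_path.
- apply/subsetP => y; rewrite inE => ys; apply: sp; rewrite E catA mem_cat.
  by rewrite [y \in w :: _]inE ys !orbT.
- have {}lw : last t t2 \in S' := lw.
  by apply: (meetsI _ lw); rewrite inE mem_last.
- by apply: (@meetsI _ v) => //; rewrite inE.
- by rewrite -nhas_meets.
Qed.

(** * Snaking through columns and rows *)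

(** In the application U is the hub, and NA, NZ, Lset, Rset, St, Sb are the
    neighbourhoods in U of A, Z, JL, JR, t and b.  The columns N i start at
    al i next to A, and c0 is the column of the first cycle; H1 and H2 express
    that there are no two disjoint cycles. *)
Section Snake.
Variables (U NA NZ Lset Rset St Sb : {set T}) (p j : nat).
Variables (N : 'I_(2 * j).+1 -> {set T}) (al : 'I_(2 * j).+1 -> T) (c0 : 'I_(2 * j).+1).
Variable (Y : 'I_p -> seq T).
Hypothesis cU : conn e U.
Hypothesis StU : exists2 t, t \in St & t \in U.
Hypothesis SbU : exists2 b, b \in Sb & b \in U.
Hypothesis StL : St \subset Lset.

Definition column M := [/\ conn e M, M \subset U, meets M NA & meets M NZ].

Hypothesis H1 : forall C M, column C -> conn e M -> M \subset U ->
  meets M Lset -> meets M Sb -> meets C M.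
Hypothesis H2 : forall C M, column C -> conn e M -> M \subset U ->
  meets M St -> meets M Rset -> meets C M.
Hypothesis colN : forall i, column (N i).
Hypothesis alN : forall i, al i \in N i /\ al i \in NA.
Hypothesis disN : forall i k, i != k -> ~~ meets (N i) (N k).
Hypothesis rowY : forall i, exists x q, [/\ Y i = x :: q, path e x q, uniq (x :: q),
  {subset x :: q <= U} & x \in Lset /\ last x q \in Rset].
Hypothesis disY : forall i k v, v \in Y i -> v \in Y k -> i = k.
Hypothesis p0 : 0 < p.
Hypothesis j0 : 0 < j.

(** Column i lies between St and column k, and column k between column i and
    Sb. *)
Definition prec i k := sreach U St (N i) (N k) /\ sreach U Sb (N k) (N i).

Lemma st_sb M i : conn e M -> M \subset U -> meets M St -> meets M Sb -> meets M (N i).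
Proof.
move=> cM sM mt mb; rewrite meetsC; apply: (H1 (colN i)) => //.
exact: meetsS mt (subxx _) StL.
Qed.

Lemma prec_asym i k : prec i k -> ~ prec k i.
Proof.
move=> [[C [cC sC mS mN nN]] _] [_ [C' [cC' sC' mS' mN' nN']]].
have [cNi sNi _ _] := colN i.
have [ik|nik] := eqVneq i k; first by subst; rewrite mN in nN.
have : meets (C :|: N i :|: C') (N k).
  apply: st_sb.
  - by apply: connU => //; [apply: connU|rewrite meetsUl (meetsC (N i)) mN' orbT].
  - by rewrite !subUset sC sC' sNi.
  - by rewrite !meetsUl mS.
  - by rewrite meetsUl mS' orbT.
by rewrite !meetsUl (negPf nN) (negPf nN') (negPf (disN nik)).
Qed.

(** A path from St to Sb meets every column, so its first hits order them. *)
Lemma prec_rank : exists f : 'I_(2 * j).+1 -> nat,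
  (forall i k, i != k -> f i != f k) /\ forall i k, f i < f k -> prec i k.
Proof.
have [t tS tU] := StU; have [b bS bU] := SbU.
have [q [pq lq uq sq]] := conn_upath cU tU bU.
pose f i := find (mem (N i)) (t :: q).
have fN i : has (mem (N i)) (t :: q).
  rewrite -[has _ _]negbK nhas_meets negbK; apply: st_sb.
  - exact: conn_path.
  - by apply/subsetP => y; rewrite inE => /sq.
  - by apply: (meetsI _ tS); rewrite inE mem_head.
  - by apply: (meetsI _ bS); rewrite inE -lq mem_last.
exists f; split=> i k.
  move=> nik; apply/eqP => E.
  have h1 := nth_find t (fN i); have h2 := nth_find t (fN k).
  rewrite -/(f i) -/(f k) E in h1 h2; move/negP: (disN nik); apply.
  exact: meetsI h1 h2.
move=> lf; have nik : i != k by apply: contraTneq lf => ->; rewrite ltnn.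
have [cNi sNi _ _] := colN i.
apply: (chain (x := t) (p := q)) lf => //; try by rewrite ?lq.
- by move=> M; apply: st_sb.
- exact: disN.
Qed.

Hypothesis c0_min : forall k, k != c0 -> prec c0 k.

Lemma col_order : exists c : nat -> 'I_(2 * j).+1,
  c 0 = c0 /\ forall i k, i < k -> k <= 2 * j -> prec (c i) (c k).
Proof.
have [f [finj fprec]] := prec_rank.
pose le i k := f i <= f k.
pose s := sort le (enum 'I_(2 * j).+1).
have ss : sorted le s by apply: sort_sorted => i k; exact: leq_total.
have sz : size s = (2 * j).+1 by rewrite size_sort size_enum_ord.
have us : uniq s by rewrite sort_uniq enum_uniq.
have lt i k : i < k -> k <= 2 * j -> prec (nth c0 s i) (nth c0 s k).
  move=> ik kj; apply: fprec; rewrite ltn_neqAle; apply/andP; split.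
    apply: finj; rewrite nth_uniq ?sz //; last exact: leq_trans ik (leqW kj).
    by rewrite neq_ltn ik.
  apply: (sorted_ltn_nth (leT := le)) => //; rewrite ?inE ?sz //.
    by move=> x y z; apply: leq_trans.
  exact: leq_trans ik (leqW kj).
exists (nth c0 s); split=> //.
have c0s : c0 \in s by rewrite mem_sort mem_enum.
apply/eqP; apply: contraT => n0.
have i0 : 0 < index c0 s.
  by rewrite lt0n; apply/eqP => E; move: n0 (nth_index c0 c0s); rewrite E => /eqP n0 /n0.
have ij : index c0 s <= 2 * j by move: (c0s); rewrite -index_mem sz ltnS.
have := lt _ _ i0 ij; rewrite nth_index // => h.
by case: (prec_asym (c0_min n0) h).
Qed.

Lemma size_ge_hits (x : T) q (Z : 'I_p -> {set T}) :
  (forall i k v, v \in Z i -> v \in Z k -> i = k) ->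
  (forall i, meets [set y in x :: q] (Z i)) -> p <= size (x :: q).
Proof.
move=> dZ mZ; have /choice[g gP] : forall i, exists v, v \in x :: q /\ v \in Z i.
  by move=> i; have /meetsP[v + vZ] := mZ i; rewrite inE => vq; exists v.
have g_inj : injective g.
  by move=> i k E; apply: (dZ _ _ (g i)); [case: (gP i)|rewrite E; case: (gP k)].
rewrite -[p]card_ord -(card_imset _ g_inj) /=.
apply: leq_trans (card_size (x :: q)); apply: subset_leq_card.
by apply/subsetP => _ /imsetP[i _ ->]; case: (gP i).
Qed.

(** A path from column 1 is prolonged column by column.  Up to column m it lies
    beyond column 0, meets column m only in its last vertex, and does not meet
    the part R m of U beyond column m.  From this vertex it follows column m to
    the last vertex on it of a turning row, and then the turning row until
    column m + 1.  The rows are ordered along column 1; the turning row is the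
    last one, G, for odd m and the first one, F, for even m.  Hence every
    segment of the path inside a column connects NA or F to G, and so meets
    all p rows. *)
Theorem snake : exists i k x s, [/\ i != c0, k != c0, uniq (x :: s) & path e x s] /\
  [/\ x = al i, last x s = al k, {subset x :: s <= U :\: N c0}
    & 2 * j * p <= size (x :: s)].
Proof.
have [c [cc0 cprec]] := col_order.
pose X m := N (c m); pose a m := al (c m).
pose R m := reach e (U :\: X m) Sb.
have cX m : conn e (X m) by case: (colN (c m)).
have sX m : X m \subset U by case: (colN (c m)).
have dX m k : m < k -> k <= 2 * j -> ~~ meets (X m) (X k).
  move=> mk kj; apply: disN; apply/eqP => E.
  by have [[C [_ _ _]]] := cprec _ _ mk kj; rewrite E => ->.
have dXin m k v : m < k -> k <= 2 * j -> v \in X m -> v \notin X k.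
  by move=> mk kj; apply: nmeetsP; apply: dX.
have RU m : R m \subset U :\: X m := reach_sub _ _ _.
have RnX m v : v \in R m -> v \notin X m by move/(subsetP (RU m)); rewrite inE => /andP[].
have RinU m v : v \in R m -> v \in U by move/(subsetP (RU m)); rewrite inE => /andP[].
have subD (A B : {set T}) : A \subset U -> ~~ meets A B -> A \subset U :\: B.
  by move=> sA nm; rewrite subsetD sA -nmeets_disj.
have XR m k : m < k -> k <= 2 * j -> X k \subset R m.
  move=> mk kj; have [_ [C [cC sC mS mX nX]]] := cprec _ _ mk kj.
  apply: subset_trans (subsetUr C (X k)) _; apply: (reach_conn0 e_sym).
  - exact: connU.
  - by rewrite subUset !subD //; rewrite meetsC dX.
  - by rewrite meetsUl mS.
have RR m k : m < k -> k <= 2 * j -> R k \subset R m.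
  move=> mk kj; apply/subsetP => y /(reachP e_sym)[A [cA sA mA yA]]; apply/(reachP e_sym).
  have [[C [cC sC mS mX nX]] _] := cprec _ _ mk kj.
  move: sA; rewrite subsetD -nmeets_disj => /andP[sA nA].
  exists A; split=> //; apply: subD => //; apply/negP => mAX.
  have : meets (C :|: X m :|: A) (X k).
    apply: st_sb.
    - by apply: connU => //; [apply: connU|rewrite meetsUl (meetsC (X m)) mAX orbT].
    - by rewrite !subUset sC sA sX.
    - by rewrite !meetsUl mS.
    - by rewrite meetsUl mA orbT.
  by rewrite !meetsUl (negPf nX) (negPf nA) (negPf (dX _ _ mk kj)).
have tail m k M : m < k -> k <= 2 * j -> conn e M -> M \subset U -> meets M (X m) ->
    meets M Rset -> meets M (X k).
  move=> mk kj cM sM mM mR; have [[C [cC sC mS mX nX]] _] := cprec _ _ mk kj.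
  have : meets (X k) (C :|: X m :|: M).
    apply: (H2 (colN (c k))).
    - by apply: connU => //; [apply: connU|rewrite meetsUl (meetsC (X m)) mM orbT].
    - by rewrite !subUset sC sM sX.
    - by rewrite !meetsUl mS.
    - by rewrite meetsUl mR orbT.
  by rewrite meetsC !meetsUl (negPf nX) (negPf (dX _ _ mk kj)).
have j1 : 1 <= 2 * j by move: j0; lia.
(* A row that misses column 0 cannot reach Sb off it, by H1.  But linked to St
   through column 0 it meets column 1, by H2, and column 1 is connected to Sb
   off column 0. *)
have rowX0 i : has (mem (X 0)) (Y i).
  have [x [q [E pq uq sq [xL lR]]]] := rowY i.
  rewrite -[has _ _]negbK nhas_meets E; apply/negP => nm.
  pose M := [set y in x :: q].
  have cM : conn e M by apply: conn_path.
  have sM : M \subset U by apply/subsetP => y; rewrite inE => /sq.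
  have xM : x \in M by rewrite inE mem_head.
  have lM : last x q \in M by rewrite inE mem_last.
  have nMR v : v \in M -> v \notin R 0.
    move=> vM; apply/negP => /(reachP e_sym)[A [cA sA mA vA]].
    move: sA; rewrite subsetD -nmeets_disj => /andP[sA nA].
    have : meets (X 0) (M :|: A).
      apply: (H1 (colN (c 0))); rewrite ?meetsUl ?mA ?orbT //.
      - by apply: connU => //; apply: meetsI vM vA.
      - by rewrite subUset sM.
      - by rewrite (meetsI xM xL).
    by rewrite meetsC meetsUl (negPf nm) (negPf nA).
  have [[C [cC sC mS mX nX]] _] := cprec _ _ (ltn0Sn 0) j1.
  have xU : x \in U by apply: sq; rewrite mem_head.
  have xX0 : x \notin X 0 := nmeetsP nm xM.
  have xD : x \in U :\: X 0 by rewrite inE xX0.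
  have cK := attach_conn cU (cX 0) (sX 0) xU.
  have MK : M \subset component e (U :\: X 0) x by apply: component_max => //; apply: subD.
  have : meets (X 1) (C :|: attach U (X 0) x).
    apply: (H2 (colN (c 1))); rewrite ?meetsUl ?mS //.
    - by apply: connU => //; rewrite meetsC /attach meetsUl meetsC mX.
    - by rewrite subUset sC attach_sub.
    - by apply/or3P; constructor 3; exact: meetsI (subsetP MK _ lM) lR.
  rewrite meetsC /attach !meetsUl (negPf nX) (negPf (dX _ _ (ltn0Sn 0) j1)) /=.
  case/meetsP=> y yK yX1; move/negP: (nMR _ xM); apply.
  have yR : y \in R 0 by apply: (subsetP (XR _ _ (ltn0Sn 0) j1)).
  suff /subsetP : component e (U :\: X 0) x \subset R 0 by apply; apply: component_refl.
  by apply: (reach_conn e_sym); [exact: component_conn|exact: component_sub|exact: meetsI yK yR].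
(* the part of each row after its last vertex on the first column *)
have /choice[Y' Y'P] : forall i, exists y : seq T, exists w,
    [/\ w \in X 0, path e w y, uniq (w :: y), {subset w :: y <= U} &
        [/\ last w y \in Rset, {subset y <= Y i} & ~~ has (mem (X 0)) y]].
  move=> i; have [y1 [w [y2 [E wX h]]]] := split_last (rowX0 i).
  have [x [q [E' pq uq sq [xL lR]]]] := rowY i.
  have so : sorted e (y1 ++ w :: y2) by rewrite -E E'.
  exists y2, w; split=> //.
  - by case/cat_sorted2: so.
  - by move: uq; rewrite -E' E cat_uniq => /and3P[].
  - by move=> v vy; apply: sq; rewrite -E' E mem_cat vy orbT.
  - split=> //; last by move=> v vy; rewrite E mem_cat inE vy !orbT.
    by move: lR; rewrite -[last x q]/(last x (x :: q)) -E' E last_cat.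
pose Z i := [set y in Y' i].
have dZ i k v : v \in Z i -> v \in Z k -> i = k.
  rewrite !inE => vi vk; have [? [_ _ _ _ [_ si _]]] := Y'P i.
  by have [? [_ _ _ _ [_ sk _]]] := Y'P k; apply: (disY (v := v)); auto.
have ZX i m : 0 < m -> m <= 2 * j -> meets (Z i) (X m).
  move=> m0 mj; have [w [wX pw uw sw [lw _ _]]] := Y'P i.
  have /meetsP[v] : meets [set y in w :: Y' i] (X m).
    apply: (tail 0) => //.
    - exact: conn_path.
    - by apply/subsetP => v; rewrite inE => /sw.
    - by apply: (meetsI _ wX); rewrite inE mem_head.
    - by apply: (meetsI _ lw); rewrite inE mem_last.
  rewrite 2!inE => /predU1P[->|vY] vX; first by rewrite (negPf (dXin _ _ _ m0 mj wX)) in vX.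
  by apply: (meetsI _ vX); rewrite inE.
have Zs i : sorted e (Y' i).
  by have [w [_ pw _ _ _]] := Y'P i; apply: path_sorted pw.
have cZ i : conn e (Z i).
  have /meetsP[v + _] := ZX i 1 isT j1; rewrite inE => vY; exact: conn_sorted vY.
have sZ i : Z i \subset R 0.
  apply: reach_conn => //.
    have [w [_ _ _ sw [_ _ nX]]] := Y'P i; apply: subD; last by rewrite -nhas_meets.
    by apply/subsetP => v; rewrite inE => vY; apply: sw; rewrite inE vY orbT.
  exact: meetsS (ZX i 1 isT j1) (subxx _) (XR _ _ (ltn0Sn 0) j1).
have R0U : R 0 \subset U by apply: subset_trans (RU 0) (subsetDl _ _).
(* The row followed back to column 0, and from there to St, meets the column P
   by H2.  As P lies beyond column 0, it meets this connection in the row. *)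
have cross i P : conn e P -> P \subset R 0 -> meets P NA -> meets P NZ -> meets P (Z i).
  move=> cP sP mA mZ; have [t tS tU] := StU; have [w [wX pw uw sw [lw _ nX]]] := Y'P i.
  pose M := attach U (X 0) t.
  have cM : conn e M by apply: attach_conn.
  have wM : w \in M by rewrite /M /attach inE wX.
  have cP' : conn e (M :|: [set y in w :: Y' i]).
    apply: connU => //; first exact: conn_path.
    by apply: (meetsI wM); rewrite inE mem_head.
  have : meets P (M :|: [set y in w :: Y' i]).
    apply: H2 => //; first by split=> //; apply: subset_trans R0U.
    - rewrite subUset attach_sub //=; by apply/subsetP => v; rewrite inE => /sw.
    - by rewrite meetsUl (@meetsI _ t) // attach_in.
    - by rewrite meetsUl; apply/orP; right; apply: (meetsI _ lw); rewrite inE mem_last.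
  case/meetsP=> v vP; have vR := subsetP sP _ vP.
  have vX : v \notin X 0 := RnX _ _ vR.
  rewrite /M /attach 4!inE (negPf vX) /= => /orP[vK|].
    (* v would connect St to Sb off the first column *)
    exfalso; have tX : t \notin X 0.
      move: vK; case/andP => _ /connectP[[|z q] /=]; first by move=> _ <-.
      by move=> /andP[/andP[+ _] _] _; rewrite inE => /andP[].
    have tD : t \in U :\: X 0 by rewrite inE tX.
    have cK := component_conn e_sym tD.
    have vK' : v \in component e (U :\: X 0) t by rewrite inE; case/andP: vK => *; apply/andP; split=> //; rewrite inE vX (RinU 0).
    have /(reachP e_sym)[A [cA sA mA' vA]] := vR.
    have : meets (component e (U :\: X 0) t :|: A) (X 0).
      apply: st_sb.
      - by apply: connU => //; apply: meetsI vK' vA.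
      - by rewrite subUset (subset_trans (component_sub _ _ _) (subsetDl _ _)) (subset_trans sA (subsetDl _ _)).
      - by rewrite meetsUl (@meetsI _ t) // component_refl.
      - by rewrite meetsUl mA' orbT.
    rewrite meetsUl => /orP[]/meetsP[y].
      by move/(subsetP (component_sub _ _ _)); rewrite inE => /andP[/negPf ->].
    by move/(subsetP sA); rewrite inE => /andP[/negPf ->].
  rewrite inE => /predU1P[vw|vY]; first by rewrite vw wX in vX.
  by apply: (meetsI vP); rewrite inE.
(* the order of the rows along the second column *)
have [_ _ _ /meetsP[z zX zNZ]] := colN (c 1).
have [aX aNA] := alN (c 1).
have [Q [pQ lQ uQ sQ]] := conn_upath (cX 1) aX zX.
have sQR v : v \in al (c 1) :: Q -> v \in R 0.
  by move/sQ; apply: (subsetP (XR _ _ (ltn0Sn 0) j1)).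
pose f i := find (mem (Z i)) (al (c 1) :: Q).
have hQ i : has (mem (Z i)) (al (c 1) :: Q).
  rewrite -[has _ _]negbK nhas_meets negbK; apply: cross.
  - exact: conn_path.
  - by apply/subsetP => v; rewrite inE => /sQR.
  - by apply: (meetsI _ aNA); rewrite inE mem_head.
  - by apply: (meetsI _ zNZ); rewrite inE -lQ mem_last.
have fprec i k : f i < f k -> sreach (R 0) NA (Z i) (Z k) /\ sreach (R 0) NZ (Z k) (Z i).
  move=> lf; apply: (chain (x := al (c 1)) (p := Q)) (lf) => //; last by rewrite lQ.
    by move=> M cM sM mA mZ; apply: cross.
  apply/negP => /meetsP[v vi vk]; move: lf; by rewrite (dZ _ _ _ vi vk) ltnn.
have fne i k : i != k -> f i != f k.
  move=> nik; apply/eqP => E.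
  have h1 := nth_find z (hQ i); have h2 := nth_find z (hQ k).
  rewrite -/(f i) -/(f k) E in h1 h2.
  by move/eqP: nik; apply; apply: dZ h1 h2.
pose i0 := Ordinal p0.
pose F := [arg min_(i < i0) f i]; pose G := [arg max_(i > i0) f i].
have Fmin i : i != F -> f F < f i.
  move=> nF; rewrite ltn_neqAle eq_sym fne //= /F; case: arg_minnP => // k _; exact.
have Gmax i : i != G -> f i < f G.
  move=> nG; rewrite ltn_neqAle fne //= /G; case: arg_maxnP => // k _ h; exact: h.
(* Row G, and a connection from it to NZ off row i, prolong P to NZ. *)
have segA i P : conn e P -> P \subset R 0 -> meets P NA -> meets P (Z G) -> meets P (Z i).
  move=> cP sP mA mG; have [->//|nG] := eqVneq i G.
  have [_ [C [cC sC mC mCG nC]]] := fprec _ _ (Gmax _ nG).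
  have : meets (P :|: Z G :|: C) (Z i).
    apply: cross.
    - by apply: connU => //; [apply: connU|rewrite meetsUl (meetsC (Z G)) mCG orbT].
    - by rewrite !subUset sP sC sZ.
    - by rewrite !meetsUl mA.
    - by rewrite meetsUl mC orbT.
  rewrite !meetsUl (negPf nC) orbF => /orP[//|/meetsP[v vG vi]].
  by move/eqP: nG; case; apply: dZ vi vG.
(* Row F, and a connection from it to NA off row i, prolong P to NA. *)
have segFG i P : conn e P -> P \subset R 0 -> meets P (Z F) -> meets P (Z G) -> meets P (Z i).
  move=> cP sP mF mG; have [->//|nF] := eqVneq i F.
  have [[C [cC sC mC mCF nC]] _] := fprec _ _ (Fmin _ nF).
  have : meets (P :|: Z F :|: C) (Z i).
    apply: segA.
    - by apply: connU => //; [apply: connU|rewrite meetsUl (meetsC (Z F)) mCF orbT].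
    - by rewrite !subUset sP sC sZ.
    - by rewrite !meetsUl mC orbT.
    - by rewrite !meetsUl mG.
  rewrite !meetsUl (negPf nC) orbF => /orP[//|/meetsP[v vF vi]].
  by move/eqP: nF; case; apply: dZ vi vF.
(* The path enters column m on the side opposite to its turning row there. *)
pose tc m v := if odd m then (v \in NA) || (v \in Z F) else v \in Z G.
pose Inv m := exists x s, [/\ uniq (x :: s), path e x s, x = a 1 & {subset x :: s <= R 0}] /\
  [/\ last x s \in X m, (forall v, v \in x :: s -> v \in X m -> v = last x s),
      (forall v, v \in x :: s -> v \notin R m), (m.-1 * p).+1 <= size (x :: s)
    & tc m (last x s)].
have cq x q : path e x q -> conn e [set y in x :: q] := @conn_path _ _ e_sym x q.
have XR0 m v : 0 < m -> m <= 2 * j -> v \in X m -> v \in R 0.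
  by move=> m0 mj; apply: (subsetP (XR _ _ m0 mj)).
have inv m : 0 < m -> m <= 2 * j -> Inv m.
  elim: m => // m IH _ mj; have [m1|m0] := posnP m.
    subst m; exists (a 1), [::]; split; split=> //=.
    - by move=> v; rewrite inE => /eqP ->; exact: (XR0 1).
    - by move=> v; rewrite inE => /eqP.
    - by move=> v; rewrite inE => /eqP ->; apply/negP => /RnX; rewrite aX.
    - by rewrite /tc /= aNA.
  have mj' : m <= 2 * j by apply: ltnW.
  have [x [s [[us ps xa sR] [lX onlyX nR sz tm]]]] := IH m0 mj'.
  set es := last x s in lX onlyX tm.
  pose r := if odd m then G else F.
  have /split_last[y1 [w [y2 [E wX ny2]]]] : has (mem (X m)) (Y' r).
    by rewrite -[has _ _]negbK nhas_meets negbK; exact: ZX.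
  have [w0 [w0X pw0 uw0 sw0 [lw0 _ _]]] := Y'P r.
  have so : sorted e (y1 ++ w :: y2) by rewrite -E; exact: Zs.
  have pwy2 : path e w y2 by case/cat_sorted2: so.
  have wZ : w \in Z r by rewrite inE E mem_cat mem_head orbT.
  have wX1 : w \notin X m.+1 by apply: dXin wX.
  have y2Z v : v \in y2 -> v \in Z r by move=> vy; rewrite inE E mem_cat inE vy !orbT.
  have hy2 : has (mem (X m.+1)) y2.
    have /meetsP[v] : meets [set y in w :: y2] (X m.+1).
      apply: (tail m) => //.
      - exact: cq.
      - apply/subsetP => v; rewrite 2!inE => /predU1P[->|/y2Z vZ].
          exact: (subsetP (sX m)).
        by apply: (subsetP R0U); apply: (subsetP (sZ r)).
      - by apply: (meetsI _ wX); rewrite inE mem_head.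
      - by apply: (@meetsI _ (last w y2)); [rewrite inE mem_last|move: lw0; rewrite E last_cat].
    rewrite 2!inE => /predU1P[->|vy vX]; first by rewrite (negPf wX1).
    by apply/hasP; exists v.
  have y2R v : v \in y2 -> v \in R m.
    have [v0 v0y v0X] := hasP hy2.
    have sy2 : [set y in y2] \subset R m.
      apply: reach_conn => //.
      - apply: conn_sorted v0y; exact: path_sorted pwy2.
      - apply: subD; last by rewrite -nhas_meets.
        apply/subsetP => u; rewrite inE => /y2Z uZ.
        by apply: (subsetP R0U); apply: (subsetP (sZ r)).
      - apply: (@meetsI _ v0); first by rewrite inE.
        exact: (subsetP (XR _ _ (ltnSn m) mj)).
    by move=> vy; apply: (subsetP sy2); rewrite inE.
  have [z1 [e' [z2 [Ez eX nz1]]]] := split_first hy2.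
  have [q [pq lq uq sq]] := conn_upath (cX m) lX wX.
  have qX v : v \in q -> v \in X m by move=> vq; apply: sq; rewrite inE vq orbT.
  have xsX v : v \in x :: s -> v \notin X m.+1.
    by move=> vs; apply/negP => vX; move/negP: (nR _ vs); apply; apply: (subsetP (XR _ _ (ltnSn m) mj)).
  have zy2 v : v \in rcons z1 e' -> v \in y2.
    by rewrite mem_rcons inE Ez mem_cat inE => /predU1P[->|->]; rewrite ?eqxx ?orbT.
  have pz : path e w (rcons z1 e').
    by move: pwy2; rewrite Ez -cat_rcons cat_path => /andP[].
  have lall : last x (s ++ q ++ rcons z1 e') = e' by rewrite !last_cat last_rcons.
  exists x, (s ++ q ++ rcons z1 e'); rewrite lall; split; split=> //.
  - rewrite -cat_cons cat_uniq us /=; apply/andP; split.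
      apply/hasPn => v; rewrite mem_cat => /orP[vq|/zy2/y2R vR]; apply/negP => /= vs.
        have ve := onlyX _ vs (qX _ vq).
        by move: uq; rewrite /= -/es -ve vq.
      by move/negP: (nR _ vs).
    move: (uq); rewrite cons_uniq cat_uniq => /andP[_ ->]; rewrite /=; apply/andP; split.
      by apply/hasPn => v /zy2/y2R/RnX vR; apply: contra vR; exact: qX.
    have : uniq (Y' r) by move: uw0 => /= /andP[].
    by rewrite E Ez cat_uniq /= => /and4P[_ _ _]; rewrite -cat_rcons cat_uniq => /and3P[].
  - by rewrite !cat_path ps pq lq.
  - move=> v; rewrite -cat_cons !mem_cat => /or3P[/sR//|/qX vX|/zy2/y2R vR].
      exact: (XR0 m).
    by apply: (subsetP (RR _ _ m0 mj')).
  - move=> v; rewrite -cat_cons !mem_cat mem_rcons inE => /or4P[/xsX/negPf->//|/qX vX|/eqP->//|vz].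
      by rewrite (negPf (dXin _ _ _ (ltnSn m) mj vX)).
    by move=> vX; move/hasPn: nz1 => /(_ _ vz) /=; rewrite vX.
  - have RRm := subsetP (RR _ _ (ltnSn m) mj).
    move=> v; rewrite -cat_cons !mem_cat mem_rcons inE => /or4P[vs|/qX vX|/eqP->|vz0]; apply/negP => vR.
    + by move/negP: (nR _ vs); apply; exact: RRm.
    + by move/negP: (RnX _ _ (RRm _ vR)).
    + by move/negP: (RnX _ _ vR).
    + have vz : v \in z1 := vz0.
      have /(reachP e_sym)[A [cA sA mA vA]] := vR.
      move: sA; rewrite subsetD -nmeets_disj => /andP[sA nA].
      have [[C [cC sC mS mX nX]] _] := cprec _ _ (ltnSn m) mj.
      have pwz : path e w z1 by move: pz; rewrite rcons_path => /andP[].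
      have cwz := cq _ _ pwz.
      have swz : [set y in w :: z1] \subset U.
        apply/subsetP => u; rewrite 2!inE => /predU1P[->|uz]; first exact: (subsetP (sX m)).
        by apply: (RinU m); apply: y2R; apply: zy2; rewrite mem_rcons inE uz orbT.
      have nwz : ~~ meets [set y in w :: z1] (X m.+1).
        by rewrite -nhas_meets /= negb_or wX1.
      have : meets (C :|: X m :|: [set y in w :: z1] :|: A) (X m.+1).
        apply: st_sb.
        * apply: connU => //.
            apply: connU => //; first exact: connU.
            by rewrite meetsUl; apply/orP; right; apply: (meetsI wX); rewrite inE mem_head.
          by rewrite meetsUl; apply/orP; right; apply: (meetsI _ vA); rewrite inE in_cons vz orbT.
        * by rewrite !subUset sC sX swz sA.
        * by rewrite !meetsUl mS.
        * by rewrite meetsUl mA orbT.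
      by rewrite !meetsUl (negPf nX) (negPf nwz) (negPf nA) (negPf (dX _ _ (ltnSn m) mj)).
  - have pseg : p <= size (es :: q).
      apply: (size_ge_hits dZ) => i.
      have sP : [set y in es :: q] \subset R 0.
        by apply/subsetP => v; rewrite inE => /sq; exact: (XR0 m).
      have wP : w \in [set y in es :: q] by rewrite inE -lq mem_last.
      have eP : es \in [set y in es :: q] by rewrite inE mem_head.
      have cP := cq _ _ pq.
      move: tm wZ; rewrite /tc /r; case: (odd m) => [/orP[eA|eF]|eG] wZ.
      + by apply: segA => //; [apply: meetsI eP eA|apply: meetsI wP wZ].
      + by apply: segFG => //; [apply: meetsI eP eF|apply: meetsI wP wZ].
      + by apply: segFG => //; [apply: meetsI wP wZ|apply: meetsI eP eG].
    move: sz pseg; rewrite /= !size_cat size_rcons -{2}(prednK m0) mulSn.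
    clear; lia.
  - have e'Z : e' \in Z r by apply: y2Z; rewrite Ez mem_cat mem_head orbT.
    move: e'Z; rewrite /tc /r /=; case: (odd m) => //= ->; by rewrite orbT.
(* along the last column back to its end in NA *)
have odd2j : odd (2 * j) = false by rewrite oddM.
have [x [s [[us ps xa sR] [lX onlyX nR sz tm]]]] := inv _ j1 (leqnn _).
have [aqX aqA] := alN (c (2 * j)).
have [q [pq lq uq sq]] := conn_upath (cX _) lX aqX.
have qX v : v \in q -> v \in X (2 * j) by move=> vq; apply: sq; rewrite inE vq orbT.
have cne m : 0 < m -> m <= 2 * j -> c m != c0.
  move=> m0 mj; apply/eqP => E; have [v vX] := conn_ex (cX m).
  by have := dXin 0 m v m0 mj; rewrite /X cc0 -E vX => /(_ isT).
exists (c 1), (c (2 * j)), x, (s ++ q); split; split=> //; try exact: cne.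
- rewrite -cat_cons cat_uniq us /=; move: (uq); rewrite cons_uniq => /andP[eq ->]; rewrite andbT.
  apply/hasPn => v vq; apply/negP => /= vs.
  by have ve := onlyX _ vs (qX _ vq); rewrite -ve vq in eq.
- by rewrite cat_path ps.
- by rewrite last_cat.
- rewrite -cc0; move=> v; rewrite -cat_cons mem_cat => /orP[/sR|/qX vX]; apply: (subsetP (RU 0)) => //.
  exact: (XR0 (2 * j)).
- have pseg : p <= size (last x s :: q).
    apply: (size_ge_hits dZ) => i; have cP := cq _ _ pq; apply: segA => //.
    + by apply/subsetP => v; rewrite inE => /sq; exact: (XR0 (2 * j)).
    + by apply: (meetsI _ aqA); rewrite inE -lq mem_last.
    + move: tm; rewrite /tc odd2j /= => eG; apply: (meetsI _ eG).
      by rewrite inE mem_head.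
  have -> : 2 * j * p = (2 * j).-1 * p + p by rewrite -{1}(prednK j1) mulSn addnC.
  move: sz pseg; rewrite /= size_cat; move: ((2 * j).-1 * p).
  clear; lia.
Qed.
End Snake.
End Chain.

(** * Two cycles *)

Section Hub.
Variables (T : finType) (e : rel T).
Hypothesis e_sym : symmetric e.
Implicit Types (B C D M S U X W R : {set T}).

Lemma feed2 (A B C D : Prop) : A -> B -> (C -> D) -> (A -> B -> C) -> D.
Proof. by move=> a b cd abc; apply/cd/abc. Qed.

Lemma hits0 U BU S : ~ hits e U BU set0 S.
Proof. by move=> [x [M [+ _ _ _ _]]]; rewrite !inE andbF. Qed.

(** The conclusion of [cover_blocked], for all blocked parts of P. *)
Definition blocked_bound k u (P : seq T) U BU := forall S0 X1 X2 X3 S1 S2 S3,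
  ~ hits e U BU X1 S1 -> ~ hits e U BU X2 S2 -> ~ hits e U BU X3 S3 ->
  (forall x y, x \in P -> y \in U -> e x y -> x \in S0 :|: X1 :|: X2 :|: X3) ->
  #|S1| + #|S2| + #|S3| < u -> k <= #|S0| + #|S1| + #|S2| + #|S3| + u.

(** BU consists of the members that avoid P. *)
Lemma hub BB k u : bramble e BB -> order_ge BB k -> 0 < u -> u <= k ->
  exists P U (BU : {set {set T}}), [/\ uniq P, sorted e P, conn e U & forall v, v \in P -> v \notin U] /\
   [/\ forall A B, A \in BU -> B \in BU -> touch e A B,
     order_ge (avoid BB [set x in P]) u & blocked_bound k u P U BU].
Proof.
move=> bB oB u0 uk; have [P [uP sP oU [Y cY Yu]]] := hub_path e_sym bB oB uk.
have [U [cU dU BU Umax]] := hub_exists e_sym bB u0 oU.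
exists P, U, (avoid BB [set x in P]); split; split=> //.
- move=> v vP; apply/negP => vU; have := disjointFr dU vU; by rewrite inE vP.
- by case: (avoid_bramble [set x in P] bB).
- move=> S0 X1 X2 X3 S1 S2 S3 h1 h2 h3 hP.
  apply: (cover_blocked e_sym bB oB oU cY Yu BU Umax h1 h2 h3).
  by move=> x y; rewrite inE; apply: hP.
Qed.

(** Without its last vertex a0, the first segment is cut off by fewer than q
    vertices; if the part of P after the next l - 2 vertices were cut off as
    well, the bound on k would be exceeded. *)
Lemma segments k u P U BU q l : blocked_bound k u P U BU ->
  0 < q -> 2 < l -> 2 * q <= u + 1 -> u + (l + 2 * q - 2) <= k ->
  exists A1 a0 I Q, [/\ P = rcons A1 a0 ++ I ++ Q, size I = l.-2,
    rank_ge e U BU [set x in rcons A1 a0] q, rank_ge e U BU [set x in Q] q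
  & exists2 S : {set T}, #|S| < q & ~ hits e U BU [set x in A1] S].
Proof.
move=> blocked q0 l2 qu uk.
have rP : rank_ge e U BU [set x in P] q.
  apply: contrapT => /not_rank_ge[S Sq hS].
  have := blocked set0 [set x in P] set0 set0 S set0 set0 hS (@hits0 _ _ _) (@hits0 _ _ _).
  rewrite !cards0; apply: feed2.
  - by move=> x y xP _ _; rewrite !inE xP.
  - by move: Sq qu; clear; lia.
  - by move: Sq uk l2; clear; lia.
have [A1 [a0 [Q1 [PE rA [SA SAq hA]]]]] := min_prefix q0 rP.
pose I := take l.-2 Q1; pose Q := drop l.-2 Q1.
have Q1E : Q1 = I ++ Q by rewrite cat_take_drop.
have sI : size I <= l.-2 by rewrite size_take; case: ltnP => //; move=> /ltnW.
have rQ : rank_ge e U BU [set x in Q] q.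
  apply: contrapT => /not_rank_ge[S Sq hS].
  have := blocked [set x in a0 :: I] [set x in A1] [set x in Q] set0 SA S set0 hA hS (@hits0 _ _ _).
  rewrite !cards0; apply: feed2.
  - move=> x y; rewrite PE Q1E !inE mem_cat inE mem_cat => + _ _.
    by case/or4P=> ->; rewrite ?orbT.
  - by move: Sq SAq qu; clear; lia.
  - have : #|[set x in a0 :: I]| <= (size I).+1 by rewrite cardsE; apply: card_size.
    by move: Sq SAq uk l2 sI; clear; lia.
exists A1, a0, I, Q; split=> //; last by exists SA.
  by rewrite PE Q1E cat_rcons.
apply/eqP; rewrite eqn_leq sI /=; rewrite size_take; case: ltnP => // h.
have Qn : Q = [::] by rewrite /Q drop_oversize.
have [|x [M [+ _ _ _ _]]] := rQ set0; first by rewrite cards0.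
by rewrite Qn !inE.
Qed.

Lemma filter_split (a : pred T) s s1 x s2 : filter a s = s1 ++ x :: s2 ->
  exists t1 t2, [/\ s = t1 ++ x :: t2, filter a t1 = s1 & filter a t2 = s2].
Proof.
elim: s s1 => [|y s IH] s1 /=; first by case: s1.
case ay: (a y).
  case: s1 => [|z s1] /= [yz E]; subst; first by exists [::], s.
  by have [t1 [t2 [-> <- <-]]] := IH _ E; exists (z :: t1), t2; rewrite /= ay.
by move=> /IH[t1 [t2 [-> <- <-]]]; exists (y :: t1), t2; rewrite /= ay.
Qed.

Definition nbrs U X := [set y in U | [exists x in X, e x y]].

Lemma nbrsP U X y : reflect (y \in U /\ exists2 x, x \in X & e x y) (y \in nbrs U X).
Proof.
rewrite inE; apply: (iffP andP) => [[yU /existsP[x /andP[xX xy]]]|[yU [x xX xy]]].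
  by split=> //; exists x.
by split=> //; apply/existsP; exists x; rewrite xX.
Qed.

Lemma meets_nbrs U X M : meets M (nbrs U X) -> exists2 x, x \in X & exists2 y, y \in M & e x y.
Proof. by case/meetsP=> y yM /nbrsP[_ [x xX xy]]; exists x => //; exists y. Qed.

(** Let c0 be the column that leaves A last, so that the part A' of A before its
    end avoids the cycle through c0.  If c0 comes first among the columns, the
    snake runs through the others and is closed by A'.  If it comes last, the
    rows are reversed and t and b exchanged.  Otherwise a column before c0, a
    column after c0 and A' connect t to b off c0, which closes a second cycle
    with J. *)
Theorem two_cycles BB k l1 l2 p j : bramble e BB -> order_ge BB k ->
  3 <= l2 -> l2 <= l1 -> 0 < j -> 0 < p -> l2 <= (2 * j * p).+1 ->
  l1 + l2 + 8 * j + 2 * p <= k + 2 ->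
  exists W1 W2, [/\ cycle_model e l1 W1, cycle_model e l2 W2 & [disjoint W1 & W2]].
Proof.
move=> bB oB l23 l21 j0 p0 ljp lk.
pose q := (2 * j).+1; pose u := p + 4 * j.
have q0 : 0 < q by [].
have [||P [U [BU [[uP sP cU PU] [tBU _ blocked]]]]] := @hub BB k u bB oB.
- by rewrite /u; lia.
- by rewrite /u; move: lk l23 l21; lia.
have [|||A1 [a0 [I [Q2 [PE sI2 rA rQ2 [SA SAq hA]]]]]] := segments blocked q0 (l := l1).
- exact: leq_trans l23 l21.
- by move: p0; rewrite /u /q; clear; lia.
- by move: lk l23 p0; rewrite /u /q; clear; lia.
have [Z1 [z0 [J [QE rZ [SZ SZq hZ]]]]] := min_prefix q0 rQ2.
pose A := rcons A1 a0; pose Z := rcons Z1 z0.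
have {}PE : P = A ++ I ++ Z ++ J by rewrite PE QE /A /Z (cat_rcons z0 Z1).
pose J' := [seq x <- J | [exists y in U, e x y]].
pose d := size J' - l2.-2.
pose JL := take d J'; pose JR := drop l2.-2 J'.
have rJ (X X' : seq T) : J' =i X ++ X' -> size X' <= l2.-2 -> rank_ge e U BU [set x in X] p.
  move=> JE sX'; apply: contrapT => /not_rank_ge[S Sp hS].
  have := blocked [set x in a0 :: z0 :: I ++ X'] [set x in A1] [set x in Z1] [set x in X] SA SZ S hA hZ hS.
  apply: feed2.
  - move=> x y xP yU xy; move: xP.
    rewrite PE !(inE, mem_cat, mem_rcons) => /or4P[/orP[]->|->|/orP[]->|xJ]; rewrite ?orbT //.
    have : x \in J' by rewrite mem_filter xJ andbT; apply/existsP; exists y; rewrite yU.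
    by rewrite JE mem_cat => /orP[]->; rewrite ?orbT.
  - by move: SAq SZq Sp; rewrite /u /q; clear; lia.
  - have : #|[set x in a0 :: z0 :: I ++ X']| <= (size I + size X').+2.
      by rewrite -size_cat cardsE; apply: (card_size (a0 :: z0 :: _)).
    by move: SAq SZq Sp lk l23 l21 sI2 sX'; rewrite /u /q; clear; lia.
have rL : rank_ge e U BU [set x in JL] p.
  apply: (rJ JL (drop d J')); first by rewrite cat_take_drop.
  by rewrite size_drop /d; clear; lia.
have rR : rank_ge e U BU [set x in JR] p.
  apply: (rJ JR (take l2.-2 J')); last by rewrite size_take; case: ltnP => // /ltnW.
  by move=> x; rewrite mem_cat orbC -mem_cat cat_take_drop.
have rank_ne X m : 0 < m -> rank_ge e U BU X m -> X != set0.
  move=> m0 r; apply/eqP => E; have [|x [M [+ _ _ _ _]]] := r set0; first by rewrite cards0.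
  by rewrite E !inE.
have dpos : 0 < d.
  rewrite lt0n; apply/eqP => d0; have := rank_ne _ _ p0 rL.
  by rewrite /JL d0 take0; case/set0Pn => x; rewrite inE.
have J'd : size J' = d + l2.-2 by move: dpos; rewrite /d; clear; lia.
have [t [J1 J't]] : exists t J1, J' = t :: J1.
  by case: (J') J'd => [|t J1]; [rewrite /= => h; exfalso; move: h dpos l23; clear; lia|exists t, J1].
pose b := last t J1.
have posL x : x \in JL -> exists s1 s2, J' = s1 ++ x :: s2 ++ [:: b] /\ l2 <= size s2 + 3.
  move=> xL; have := cat_take_drop d J'; rewrite -/JL; case/splitPr: xL => s1 s2 JE.
  have sd : size (drop d J') = l2.-2 by rewrite size_drop J'd addKn.
  case/lastP: (drop d J') sd JE => [|w b']; first by move=> /= h; exfalso; move: h l23; clear; lia.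
  rewrite size_rcons => sd JE; exists s1, (s2 ++ w); split; last by rewrite size_cat; move: sd; clear; lia.
  have -> : b = b' by rewrite /b -[last t J1]/(last t (t :: J1)) -J't -JE !last_cat last_rcons.
  by rewrite -JE -!catA cats1.
have posR y : y \in JR -> exists s2 s3, J' = [::] ++ t :: s2 ++ y :: s3 /\ l2 <= size s2 + 3.
  move=> yR; have := cat_take_drop l2.-2 J'; rewrite -/JR; case/splitPr: yR => s1 s3 JE.
  have sd : size (take l2.-2 J') = l2.-2 by rewrite size_takel // J'd leq_addl.
  case: (take l2.-2 J') sd JE => [|t' w]; first by move=> /= h; exfalso; move: h l23; clear; lia.
  rewrite J't => /= sd [_ JE]; exists (w ++ s1), s3; split; last by rewrite size_cat; move: sd; clear; lia.
  by rewrite -JE -catA.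
have tL : t \in JL by rewrite /JL J't; case: (d) dpos => //= d' _; rewrite mem_head.
have bR : b \in JR.
  suff : forall s, size s = d -> take l2.-2 J' ++ s = J' -> b \in s.
    by apply; rewrite ?cat_take_drop // size_drop J'd addnK.
  case/lastP => [|w b']; first by move=> h; exfalso; move: h dpos; rewrite /= => <-.
  move=> _ JE; rewrite /b -[last t J1]/(last t (t :: J1)) -J't -JE last_cat last_rcons.
  by rewrite mem_rcons mem_head.
have inP v : v \in P = [|| v \in A, v \in I, v \in Z | v \in J] by rewrite PE !mem_cat.
have [uA uI uZ] : [/\ forall v, v \in A -> v \notin I ++ Z ++ J,
    forall v, v \in I -> v \notin Z ++ J & forall v, v \in Z -> v \notin J].
  move: uP; rewrite PE cat_uniq => /and3P[_ /hasPn hA' ]; rewrite cat_uniq => /and3P[_ /hasPn hI].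
  rewrite cat_uniq => /and3P[_ /hasPn hZ' _]; split=> v h; apply/negP.
  - by move/hA'; rewrite /= h.
  - by move/hI; rewrite /= h.
  - by move/hZ'; rewrite /= h.
have uJ : uniq J by move: uP; rewrite PE !cat_uniq => /and3P[_ _ /and3P[_ _ /and3P[]]].
have sJ : sorted e J by move: sP; rewrite PE => /cat_sorted2[_ /cat_sorted2[_ /cat_sorted2[]]].
have UP v : v \in U -> v \notin P by apply: contraTN => /PU.
apply: contrapT => noC.
have fin W1 W2 : cycle_model e l1 W1 -> cycle_model e l2 W2 -> ~~ meets W1 W2 -> False.
  by move=> m1 m2 n; apply: noC; exists W1, W2; rewrite -nmeets_disj.
(* the first cycle: a column closed by P *)
have mk1 (A' : seq T) a A'' C : A = A' ++ a :: A'' -> conn e C -> C \subset U ->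
    (exists2 y, y \in C & e a y) -> (exists2 z, z \in Z & exists2 y, y \in C & e z y) ->
    cycle_model e l1 ([set v in a :: A'' ++ I ++ Z] :|: C).
  move=> AE cC sC aC [z zZ zC].
  have PCn v : v \in P -> v \notin C by move=> vP; apply/negP => /(subsetP sC); apply/negP/PU.
  have [Z' [Z'' ZE]] : exists Z' Z'', Z = Z' ++ z :: Z'' by case/splitPr: zZ => Z' Z''; exists Z', Z''.
  have PE2 : P = A' ++ (a :: A'' ++ I ++ rcons Z' z) ++ (Z'' ++ J).
    by rewrite PE AE ZE -!catA /= -!catA cat_rcons.
  exists a, (A'' ++ I ++ rcons Z' z), C; split; split=> //.
  - by move: uP; rewrite PE2 cat_uniq cat_uniq => /and3P[_ _ /and3P[]].
  - by move: sP; rewrite PE2 => /cat_sorted2[_ /cat_sorted2[]].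
  - by rewrite !size_cat size_rcons sI2; move: l21 l23; clear; lia.
  - move=> v; rewrite !inE !mem_cat ZE mem_cat mem_rcons !inE.
    by case/predU1P=> [->|/or3P[->|->|/orP[->|->]]]; rewrite ?eqxx ?orbT.
  - by move=> v vs; apply: PCn; rewrite PE2 !mem_cat vs orbT.
  - exact: subsetUr.
  - by rewrite !last_cat last_rcons.
(* a second cycle off the column C: a connected set closed by a long part of J *)
have kill (A' : seq T) a A'' C R s1 x s2 y s3 : A = A' ++ a :: A'' -> conn e C -> C \subset U ->
    (exists2 y, y \in C & e a y) -> (exists2 z, z \in Z & exists2 y, y \in C & e z y) ->
    J' = s1 ++ x :: s2 ++ y :: s3 -> l2 <= size s2 + 3 ->
    conn e R -> (forall v, v \in R -> v \in U \/ v \in A') -> ~~ meets C R ->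
    (exists2 v, v \in R & e x v) -> (exists2 v, v \in R & e y v) -> False.
  move=> AE cC sC aC zC JE sz cR RUA nCR xR yR.
  have [t1 [t2 [Jt ft1 /filter_split[t3 [t4 [t2E ft3 _]]]]]] := filter_split JE.
  have uAE : uniq (A' ++ a :: A'').
    by move: uP; rewrite PE AE cat_uniq => /and3P[].
  have RJ v : v \in R -> v \notin J /\ v \notin a :: A'' ++ I ++ Z.
    case/RUA => [/UP|vA].
      rewrite inP AE -[a :: _ ++ _]/((a :: A'') ++ I ++ Z) !mem_cat.
      by case: (v \in J); case: (v \in a :: A''); case: (v \in I); case: (v \in Z); rewrite ?orbT.
    have nIZJ : v \notin I ++ Z ++ J by apply: uA; rewrite AE mem_cat vA.
    have [nI nZ nJ] : [/\ v \notin I, v \notin Z & v \notin J].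
      by move: nIZJ; rewrite !mem_cat !negb_or => /and3P.
    have nvs : v \notin (a :: A'') ++ I ++ Z.
      apply/negP; rewrite !mem_cat (negPf nI) (negPf nZ) !orbF => vs.
      by move: uAE; rewrite cat_uniq => /and3P[_ /hasPn/(_ _ vs)]; rewrite /= vA.
    by split.
  have m2 : cycle_model e l2 ([set v in J] :|: R).
    have JE2 : J = t1 ++ (x :: rcons t3 y) ++ t4 by rewrite Jt t2E /= cat_rcons.
    exists x, (rcons t3 y), R; split; split=> //.
    - by move: uJ; rewrite JE2 cat_uniq => /and3P[_ _]; rewrite cat_uniq => /and3P[].
    - by move: sJ; rewrite JE2 => /cat_sorted2[_ /cat_sorted2[]].
    - have : size s2 <= size t3 by rewrite -ft3 size_filter count_size.
      by move=> h; apply: leq_trans sz _; rewrite addn3 size_rcons !ltnS.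
    - by move=> v vt; rewrite !inE JE2 !mem_cat vt ?orbT.
    - move=> v vt; apply/negP => /RJ[+ _]; by rewrite JE2 !mem_cat vt orbT.
    - exact: subsetUr.
    - by rewrite last_rcons.
  apply: (fin _ _ (mk1 _ _ _ _ AE cC sC aC zC) m2).
  apply/negP => /meetsP[v]; rewrite !in_setU ![v \in [set _ in _]]inE => h1 h2.
  have vC : v \in C -> v \notin J.
    by move/(subsetP sC)/UP; rewrite inP !negb_or => /and4P[].
  case/orP: h1 => [vs|vC']; case/orP: h2 => [vJ|vR].
  - have {}vs : v \in (a :: A'') ++ I ++ Z := vs.
    move: vs; rewrite !mem_cat => /or3P[vA|vI|vZ].
    + have := uA v; rewrite AE mem_cat vA orbT => /(_ isT); by rewrite !mem_cat vJ !orbT.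
    + by have := uI v vI; rewrite mem_cat vJ orbT.
    + by have := uZ v vZ; rewrite vJ.
  - by have [_] := RJ v vR; rewrite vs.
  - by have := vC vC'; rewrite vJ.
  - by move/negP: nCR; apply; apply: meetsI vC' vR.
pose NA := nbrs U [set x in A]; pose NZ := nbrs U [set x in Z].
pose Lset := nbrs U [set x in JL]; pose Rset := nbrs U [set x in JR].
pose St := nbrs U [set t]; pose Sb := nbrs U [set b].
have splitA a : a \in A -> exists A' A'', A = A' ++ a :: A''.
  by case/splitPr => A' A''; exists A', A''.
have colE C : column e U NA NZ C -> exists A' a A'', [/\ A = A' ++ a :: A'', conn e C, C \subset U,
    exists2 y, y \in C & e a y & exists2 z, z \in Z & exists2 y, y \in C & e z y].
  move=> [cC sC /meets_nbrs[a + aC] /meets_nbrs[z + zC]]; rewrite !inE => aA zZ.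
  have [A' [A'' AE]] := splitA a aA; exists A', a, A''; split=> //; by exists z.
have H1 C M : column e U NA NZ C -> conn e M -> M \subset U -> meets M Lset -> meets M Sb -> meets C M.
  move=> /colE[A' [a [A'' [AE cC sC aC zC]]]] cM sM /meets_nbrs[x + xM] /meets_nbrs[b' /set1P -> bM].
  rewrite inE => /posL[s1 [s2 [JE sz]]]; apply: contraT => nCM.
  by case: (kill _ _ _ _ M _ _ _ _ _ AE cC sC aC zC JE sz cM) => // v /(subsetP sM); left.
have H2 C M : column e U NA NZ C -> conn e M -> M \subset U -> meets M St -> meets M Rset -> meets C M.
  move=> /colE[A' [a [A'' [AE cC sC aC zC]]]] cM sM /meets_nbrs[b' /set1P -> bM] /meets_nbrs[x + xM].
  rewrite inE => /posR[s1 [s2 [JE sz]]]; apply: contraT => nCM.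
  by case: (kill _ _ _ _ M _ _ _ _ _ AE cC sC aC zC JE sz cM) => // v /(subsetP sM); left.
have nbrs_ne x : x \in J' -> exists2 y, y \in nbrs U [set x] & y \in U.
  rewrite mem_filter => /andP[/existsP[y /andP[yU xy]] _]; exists y => //.
  by apply/nbrsP; split=> //; exists x; rewrite ?set11.
have StU : exists2 y, y \in St & y \in U by apply: nbrs_ne; rewrite J't mem_head.
have SbU : exists2 y, y \in Sb & y \in U by apply: nbrs_ne; rewrite J't mem_last.
have StL : St \subset Lset.
  apply/subsetP => y /nbrsP[yU [x /set1P -> ty]]; apply/nbrsP; split=> //.
  by exists t; rewrite // inE.
have SbR : Sb \subset Rset.
  apply/subsetP => y /nbrsP[yU [x /set1P -> ty]]; apply/nbrsP; split=> //.
  by exists b; rewrite // inE.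
have [|||||a [z [N [h1 a_inj _ h3 h4]]]] := @linked _ e e_sym U BU tBU [set x in A] [set x in Z] q.
- rewrite -nmeets_disj; apply/negP => /meetsP[v]; rewrite !inE => /uA; rewrite !mem_cat.
  by move=> + vZ; rewrite vZ orbT.
- rewrite -nmeets_disj; apply/negP => /meetsP[v]; rewrite inE => vA /UP; by rewrite inP vA.
- rewrite -nmeets_disj; apply/negP => /meetsP[v]; rewrite inE => vA /UP; by rewrite inP vA !orbT.
- exact: rA.
- exact: rZ.
pose al i := head (a i) (N i); pose NN i := [set y in N i].
have NE i : exists w, [/\ N i = al i :: w, e (a i) (al i), path e (al i) w & e (last (al i) w) (z i)].
  have [n0 pN _] := h3 i; rewrite /al; case: (N i) n0 pN => //= y w _; rewrite rcons_path => /and3P[*].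
  by exists w.
have aA i : a i \in A by case: (h1 i); rewrite inE.
have zZ i : z i \in Z by case: (h1 i) => _; rewrite inE.
have sN i : NN i \subset U by apply/subsetP => y; rewrite inE; case: (h1 i) => _ _; apply.
have alN i : al i \in NN i /\ al i \in NA.
  have [w [E aal _ _]] := NE i; have aN : al i \in NN i by rewrite inE E mem_head.
  split=> //; apply/nbrsP; split; first exact: (subsetP (sN i)).
  by exists (a i); rewrite // inE.
have cN i : conn e (NN i).
  by have [w [E _ pw _]] := NE i; rewrite /NN E; apply: conn_path.
have zN i : exists2 y, y \in NN i & e (z i) y.
  have [w [E _ _ lz]] := NE i; exists (last (al i) w); last by rewrite e_sym.
  by rewrite inE E mem_last.
have colN i : column e U NA NZ (NN i).
  split=> //; first by have [? ?] := alN i; apply: (@meetsI _ (al i)).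
  have [y yN zy] := zN i; apply: (meetsI yN); apply/nbrsP; split; first exact: (subsetP (sN i)).
  by exists (z i); rewrite // inE.
have disN i i' : i != i' -> ~~ meets (NN i) (NN i').
  move=> nik; apply/negP => /meetsP[v]; rewrite !inE => vi vk; move/eqP: nik; apply; exact: h4 vi vk.
have [Y [Y1 Y2]] : exists Y : 'I_p -> seq T,
    (forall i, lpath (restr e U) Lset Rset (Y i)) /\ (forall i i' v, v \in Y i -> v \in Y i' -> i = i').
  apply: menger => S sS; rewrite leqNgt; apply/negP => Sp.
  have [x [y [M [+ + cM sM [[v vM xv] [w wM yw]]]]]] := linked_sep e_sym tBU rL rR Sp.
  rewrite !inE => /andP[_ xL] /andP[_ yR].
  have [s [ps ls us ss]] := conn_upath cM vM wM.
  have MU r : r \in M -> r \in U by move/(subsetP sM); rewrite inE => /andP[].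
  have : has (mem S) (v :: s).
    apply: sS; rewrite /abpath ls; apply/and3P; split.
    - by apply/nbrsP; split; [exact: MU|exists x; rewrite // inE].
    - rewrite restr_path ?MU // ps /=; apply/allP => r rs; apply: MU; apply: ss.
      by rewrite inE rs orbT.
    - by apply/nbrsP; split; [exact: MU|exists y; rewrite // inE].
  case/hasP=> r /ss/(subsetP sM); rewrite inE => /andP[nr _]; by rewrite /= (negPf nr).
have rowY i : exists x s, [/\ Y i = x :: s, path e x s, uniq (x :: s),
    {subset x :: s <= U} & x \in Lset /\ last x s \in Rset].
  have [x [s [E + us _ _]]] := Y1 i; rewrite E => /and3P[xL ps lR].
  have xU : x \in U by case/nbrsP: xL.
  move: ps; rewrite restr_path // => /andP[ps /allP sU].
  exists x, s; split=> //; first by rewrite -E.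
  by move=> v; rewrite inE => /predU1P[->//|/sU].
have [A' [a1 [A'' [AE aC nA'']]]] : exists A' a1 A'', [/\ A = A' ++ a1 :: A'',
    a1 \in codom a & ~~ has (mem (codom a)) A''].
  by apply: split_last; apply/hasP; exists (a ord0); rewrite //= codom_f.
have [c0 a1E] : exists c0, a1 = a c0 by case/codomP: aC => c0 ->; exists c0.
have aA' i : i != c0 -> a i \in A'.
  move=> nk; have := aA i; rewrite AE mem_cat inE => /or3P[//|/eqP E|h].
    by move: nk; rewrite (a_inj i c0) ?eqxx // E a1E.
  by move/hasPn: nA'' => /(_ _ h); rewrite /= codom_f.
have aN0 : exists2 y, y \in NN c0 & e a1 y.
  have [w [E aal _ _]] := NE c0; exists (al c0); first by rewrite inE E mem_head.
  by rewrite a1E.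
have zN0 : exists2 z, z \in Z & exists2 y, y \in NN c0 & e z y by exists (z c0).
have cA' i : i != c0 -> conn e [set v in A'].
  move=> /aA'; apply: conn_sorted => //.
  by move: sP; rewrite PE AE -catA => /cat_sorted2[].
have win : (exists i k x s, [/\ i != c0, k != c0, uniq (x :: s) & path e x s] /\
    [/\ x = al i, last x s = al k, {subset x :: s <= U :\: NN c0}
      & 2 * j * p <= size (x :: s)]) -> False.
  move=> [i [i' [x [s [[ni nk us ps] [xE lE ss sz]]]]]].
  have m2 : cycle_model e l2 ([set v in x :: s] :|: [set v in A']).
    exists x, s, [set v in A']; split; split=> //.
    - by move: ljp sz => /=; move: (2 * j * p); clear; lia.
    - by move=> v vs; rewrite !inE in vs *; rewrite vs.
    - exact: cA' ni.
    - move=> v /ss; rewrite !inE => /andP[_ /UP]; rewrite inP AE mem_cat !negb_or.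
      by case/andP=> /andP[].
    - exact: subsetUr.
    - by exists (a i); [rewrite inE aA'|have [w [_ ? _ _]] := NE i; rewrite xE e_sym].
    - by exists (a i'); [rewrite inE aA'|have [w [_ ? _ _]] := NE i'; rewrite lE e_sym].
  apply: (fin _ _ (mk1 _ _ _ _ AE (cN c0) (sN c0) aN0 zN0) m2).
  have uAE : uniq (A' ++ a1 :: A'') by move: uP; rewrite PE AE cat_uniq => /and3P[].
  apply/negP => /meetsP[v]; rewrite !in_setU ![v \in [set _ in _]]inE => h1' h2'.
  have {}h1' : (v \in (a1 :: A'') ++ I ++ Z) || (v \in N c0) by move: h1'; rewrite inE.
  case/orP: h2' => [/ss|vA'].
    rewrite inE => /andP[nv vU]; move: h1' => /orP[vs|vN].
      have := UP v vU; rewrite inP AE mem_cat; move: vs; rewrite !mem_cat.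
      by case: (v \in a1 :: A''); case: (v \in I); case: (v \in Z); rewrite ?orbT.
    by move: nv; rewrite inE vN.
  case/orP: h1' => [vs|vN]; last first.
    have /UP : v \in U by apply: (subsetP (sN c0)); rewrite inE.
    by rewrite inP AE mem_cat vA'.
  have := uA v; rewrite AE mem_cat vA' => /(_ isT); rewrite !mem_cat !negb_or => /and3P[nI nZ _].
  move: vs; rewrite !mem_cat (negPf nI) (negPf nZ) !orbF => vs.
  by move: uAE; rewrite cat_uniq => /and3P[_ /hasPn /(_ _ vs)]; rewrite /= vA'.
have [f [fne fprec]] := prec_rank e_sym cU StU SbU StL H1 colN disN.
have [mn|/existsNP[k1 /not_implyP[nk1 np1]]] := pselect (forall k, k != c0 -> prec e U St Sb NN c0 k).
  apply: win; exact: (snake e_sym cU StU SbU StL H1 H2 colN alN disN rowY Y2 p0 j0 mn).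
have [mx|/existsNP[k2 /not_implyP[nk2 np2]]] := pselect (forall k, k != c0 -> prec e U St Sb NN k c0).
  apply: win; apply: (@snake _ e e_sym U NA NZ Rset Lset Sb St p j NN al c0 (fun i => rev (Y i)) cU SbU StU SbR _ _ colN alN disN _ _ p0 j0 _).
  - by move=> C M cC cM sM mR mt; apply: H2.
  - by move=> C M cC cM sM mR mt; apply: H1.
  - move=> i; have [x [s [E ps us ss [xL lR]]]] := rowY i.
    exists (last x s), (rev (belast x s)); have rE : rev (Y i) = last x s :: rev (belast x s).
      by rewrite E lastI rev_rcons.
    split=> //.
    + by rewrite rev_path; apply: sub_path ps => u' v'; rewrite e_sym.
    + by rewrite -rE E rev_uniq.
    + by move=> v; rewrite -rE mem_rev E; apply: ss.
    + split=> //; have -> : last (last x s) (rev (belast x s)) = x; last by [].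
      by rewrite -[LHS]/(last x (last x s :: rev (belast x s))) -rE E rev_cons last_rcons.
  - by move=> i i' v; rewrite !mem_rev; apply: Y2.
  - by move=> i ni; have [? ?] := mx i ni; split.
have [[C1 [cC1 sC1 mC1 mN1 nN1]] _] : prec e U St Sb NN k1 c0.
  by have := fne _ _ nk1; rewrite neq_ltn => /orP[/fprec|/fprec].
have [_ [C2 [cC2 sC2 mC2 mN2 nN2]]] : prec e U St Sb NN c0 k2.
  by have := fne _ _ nk2; rewrite neq_ltn => /orP[/fprec|/fprec].
have [s1 [s2 [JE sz]]] := posL t tL.
pose D1 := C1 :|: NN k1; pose D2 := NN k2 :|: C2.
have cD1 : conn e D1 by apply: connU.
have cD2 : conn e D2 by apply: connU => //; rewrite meetsC.
have eal i : e (a i) (al i) by have [w [_ ? _ _]] := NE i.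
have cR : conn e (D1 :|: [set v in A'] :|: D2).
  apply: (connE e_sym (x := a k2) (y := al k2)) => //.
  - apply: (connE e_sym (x := al k1) (y := a k1)) => //; first exact: cA' nk1.
    + by rewrite inE (alN k1).1 orbT.
    + by rewrite inE aA'.
    + by rewrite e_sym.
  - by rewrite !inE aA' ?orbT.
  - by rewrite inE (alN k2).1.
apply: (kill _ _ _ _ _ _ _ _ _ _ AE (cN c0) (sN c0) aN0 zN0 JE sz cR).
- move=> v; rewrite !in_setU => /orP[/orP[/orP[|]|]|/orP[|]].
  + by move/(subsetP sC1); left.
  + by move/(subsetP (sN _)); left.
  + by rewrite inE; right.
  + by move/(subsetP (sN _)); left.
  + by move/(subsetP sC2); left.
- rewrite meetsC !meetsUl (negPf nN1) (negPf nN2) (negPf (disN _ _ nk1)) (negPf (disN _ _ nk2)) /= orbF.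
  apply/negP => /meetsP[v]; rewrite inE => vA /(subsetP (sN _))/UP.
  by rewrite inP AE mem_cat vA.
- have [x /set1P -> [y yC ty]] := meets_nbrs mC1.
  by exists y; rewrite // !inE yC.
- have [x /set1P -> [y yC ty]] := meets_nbrs mC2.
  by exists y; rewrite // !inE yC !orbT.
Qed.
End Hub.

(** * Small dense subgraphs of multigraphs *)

Section Multigraph.
Variables (V E : finType) (src tgt : E -> V).
Implicit Types (S D B : {set V}) (v x y : V) (f g : E).

Definition inner S := [set f | (src f \in S) && (tgt f \in S)].

Definition inc x f := (src f == x) || (tgt f == x).

Definition other x f := if src f == x then tgt f else src f.

Lemma inc_other x f : inc x f -> inc (other x f) f.
Proof.
by rewrite /inc /other; case: eqP => [->|_ /=]; rewrite eqxx ?orbT.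
Qed.

Lemma inner_inc S x f : inc x f -> (f \in inner S) = (x \in S) && (other x f \in S).
Proof.
rewrite /inc /other inE; case: eqP => [->|_ /= /eqP ->] //.
by rewrite andbC.
Qed.

Lemma innerS S D : S \subset D -> inner S \subset inner D.
Proof.
by move=> /subsetP s; apply/subsetP => f; rewrite !inE => /andP[/s -> /s ->].
Qed.

Section Ball.
Variables (V0 : {set V}) (v : V).

Fixpoint ball i :=
  if i is j.+1 then
    ball j :|: [set x in V0 | [exists f, inc x f && (other x f \in ball j)]]
  else [set v].

Lemma ball_mono i j : i <= j -> ball i \subset ball j.
Proof.
elim: j => [|j IH]; first by rewrite leqn0 => /eqP ->.
rewrite leq_eqVlt ltnS => /predU1P[->//|/IH h].
exact: subset_trans h (subsetUl _ _).
Qed.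

Lemma ball_v i : v \in ball i.
Proof. by apply: (subsetP (ball_mono (leq0n i))); rewrite set11. Qed.

Lemma ball_sub i : v \in V0 -> ball i \subset V0.
Proof.
move=> vV; elim: i => [|i IH] /=; first by rewrite sub1set.
by rewrite subUset IH; apply/subsetP => x; rewrite inE => /andP[].
Qed.

Lemma ball_edge i f : f \in inner V0 -> src f \in ball i \/ tgt f \in ball i ->
  f \in inner (ball i.+1).
Proof.
rewrite inE => /andP[s0 t0]; have nx x y : inc x f -> other x f = y -> y \in ball i -> x \in V0 ->
    x \in ball i.+1.
  move=> xf <- yb x0; rewrite /= inE; apply/orP; right; rewrite inE x0.
  by apply/existsP; exists f; rewrite xf.
have bS x : x \in ball i -> x \in ball i.+1 by apply: (subsetP (ball_mono (leqnSn i))).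
case=> h; rewrite inE (bS _ h) ?andbT /=.
  have [st|st] := eqVneq (src f) (tgt f); first by rewrite -st; apply: bS.
  by apply: nx h t0; rewrite /inc /other ?eqxx ?orbT // (negPf st).
by apply: nx h s0; rewrite /inc /other eqxx.
Qed.

Lemma ball_parent i x : x \in ball i -> x != v ->
  exists f, inc x f /\ exists2 j, j < i & x \in ball j.+1 /\ (x \notin ball j /\ other x f \in ball j).
Proof.
elim: i => [|i IH]; first by rewrite inE => /eqP ->; rewrite eqxx.
have [xi _ nxv|nxi] := boolP (x \in ball i).
  by have [f [xf [j ji h]]] := IH xi nxv; exists f; split=> //; exists j; rewrite ?ltnS 1?ltnW.
move=> xb; move: (xb); rewrite /= inE (negPf nxi) inE => /andP[_ /existsP[f /andP[xf ob]]] _.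
by exists f; split=> //; exists i.
Qed.

(** Choosing for every vertex but v an edge towards v gives one edge less than
    vertices, so a dense ball has a further edge g.  The chosen edges from the
    two ends of g back to v, together with g, are at least as many as their
    vertices, and each of the two ways back has at most i + 1 vertices. *)
Lemma dense_ball i : v \in V0 -> #|ball i| <= #|inner (ball i)| ->
  exists S, [/\ S \subset V0, S != set0, #|S| <= #|inner S| & #|S| <= i.*2.+1].
Proof.
move=> vV0 dens.
have /choice[par parP] : forall x, exists f, x \in ball i -> x != v ->
    inc x f /\ exists2 j, j < i & x \in ball j.+1 /\ (x \notin ball j /\ other x f \in ball j).
  move=> x; have [xb|nxb] := boolP (x \in ball i); last first.
    have [f0 _|noE] := pickP (fun _ : E => true); first by exists f0.
    (* without edges the ball would have more vertices than edges *)
    have : #|inner (ball i)| = 0 by apply: eq_card0 => f; have := noE f.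
    by move=> E0; move: dens; rewrite E0 leqn0 cards_eq0 => /eqP b0; have := ball_v i; rewrite b0 inE.
  have [xv|xv] := eqVneq x v.
    have : 0 < #|inner (ball i)|.
      by apply: leq_trans dens; rewrite card_gt0; apply/set0Pn; exists v; exact: ball_v.
    by rewrite card_gt0 => /set0Pn[f _]; exists f.
  by have [f h] := ball_parent xb xv; exists f.
have lev x j k : x \notin ball j -> x \in ball k -> j < k.
  by move=> nj xk; rewrite ltnNge; apply: contra nj => kj; apply: (subsetP (ball_mono kj)).
have par_inj : {in ball i :\ v &, injective par}.
  move=> x y; rewrite !inE => /andP[xv xb] /andP[yv yb] Exy.
  have [xf [j _ [xj [nxj oxj]]]] := parP x xb xv.
  have [yf [k _ [yk [nyk oyk]]]] := parP y yb yv.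
  rewrite -Exy in yf oyk; apply/eqP; apply: contraT => nxy.
  have oy : other x (par x) = y.
    move: xf yf nxy; rewrite /other /inc; case: eqP => [->|_ /= /eqP ->].
      by move=> _ /orP[/eqP ->|/eqP ->]; rewrite ?eqxx.
    by case: eqP => [//|_ /= /eqP ->]; rewrite eqxx.
  have ox : other y (par x) = x.
    move: xf yf nxy; rewrite /other /inc; case: (src _ =P y) => [->|_ +  /= /eqP E'].
      by case: eqP => [->|_ /= /eqP -> //]; rewrite eqxx.
    by rewrite E'; case: eqP => [//|_ /= /eqP ->]; rewrite eqxx.
  rewrite oy in oxj; rewrite ox in oyk.
  by have := lev _ _ _ nxj oyk; have := lev _ _ _ nyk oxj; clear; lia.
have [g gb gp] : exists2 g, g \in inner (ball i) & g \notin par @: (ball i :\ v).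
  apply/subsetPn; apply/negP => /subset_leq_card; rewrite card_in_imset //.
  have := cardsD1 v (ball i); rewrite ball_v /= => bE.
  by move: dens; rewrite bE => h1 h2; have := leq_trans h1 h2; rewrite ltnn.
have anc k x : x \in ball k -> k <= i -> exists A : {set V}, [/\ x \in A, v \in A, A \subset ball i, #|A| <= k.+1
    & forall y, y \in A -> y != v -> other y (par y) \in A].
  elim/ltn_ind: k x => k IH x xk ki.
  have [->|xv] := eqVneq x v.
    exists [set v]; rewrite cards1 sub1set ball_v set11; split=> // y /set1P ->.
    by rewrite eqxx.
  have xb : x \in ball i by apply: (subsetP (ball_mono ki)).
  have [xf [j ji [xj [nxj oxj]]]] := parP x xb xv.
  have jk := lev _ _ _ nxj xk.
  have [A [oA vA sA cA clA]] := IH j jk _ oxj (ltnW ji).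
  exists (x |: A); split; rewrite ?setU11 //.
  - by rewrite inE vA orbT.
  - by rewrite subUset sub1set xb.
  - by rewrite cardsU1; move: cA jk; clear; case: (x \in A) => /=; lia.
  - move=> y /setU1P[->|yA] yv; rewrite inE; first by rewrite oA orbT.
    by rewrite clA ?orbT.
move: (gb); rewrite inE => /andP[sgb tgb].
have [A1 [s1 v1 sub1 c1 cl1]] := anc i _ sgb (leqnn _).
have [A2 [s2 v2 sub2 c2 cl2]] := anc i _ tgb (leqnn _).
pose S := A1 :|: A2.
have clS y : y \in S -> y != v -> other y (par y) \in S.
  by rewrite !inE => /orP[y1|y2] yv; [rewrite cl1|rewrite cl2 ?orbT].
have vS : v \in S by rewrite inE v1.
have Sb : S \subset ball i by rewrite subUset sub1.
exists S; split.
- exact: subset_trans Sb (ball_sub i vV0).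
- by apply/set0Pn; exists v.
- have sp : g |: par @: (S :\ v) \subset inner S.
    rewrite subUset sub1set inE [_ \in S]inE s1 [_ \in S]inE s2 orbT /=.
    apply/subsetP => _ /imsetP[y + ->]; rewrite inE => /andP[]; rewrite inE => yv yS.
    have [yf _] := parP y (subsetP Sb _ yS) yv.
    by rewrite (inner_inc _ yf) yS clS.
  apply: leq_trans (subset_leq_card sp).
  have sD : S :\ v \subset ball i :\ v by apply: setSD.
  have gn : g \notin par @: (S :\ v).
    by apply: contra gp => /imsetP[y yS ->]; apply: imset_f; apply: (subsetP sD).
  rewrite cardsU1 gn card_in_imset; first by rewrite (cardsD1 v S) vS.
  by move=> x y xS yS; apply: par_inj; apply: (subsetP sD).
- have : 0 < #|A1 :&: A2| by rewrite card_gt0; apply/set0Pn; exists v; rewrite inE v1.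
  by rewrite cardsU; move: c1 c2; clear; lia.
Qed.
End Ball.

(** A ball doubling at every step would exceed V0, so some ball of radius i <= h
    at most doubles in the next step.  If the next ball is not dense, delete the
    ball of radius i: all edges lost lie in the next ball, so they are fewer
    than twice the vertices lost, and the assumption persists. *)
Lemma short_dense V0 h : V0 != set0 -> 2 * #|V0| <= #|inner V0| -> #|V0| < 2 ^ h.+1 ->
  exists S, [/\ S \subset V0, S != set0, #|S| <= #|inner S| & #|S| <= (h.+1).*2.+1].
Proof.
have [n] := ubnP #|V0|; elim: n V0 => // n IH V0 Vn V00 dens Vh.
have [v vV] := set0Pn _ V00.
have ex : exists i, #|ball V0 v i.+1| <= 2 * #|ball V0 v i|.
  apply: contrapT => no.
  have grow i : 2 ^ i <= #|ball V0 v i|.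
    elim: i => [|i IHi]; first by rewrite cards1.
    rewrite expnS; have : ~ (#|ball V0 v i.+1| <= 2 * #|ball V0 v i|) by move=> hi; apply: no; exists i.
    move/negP; rewrite -ltnNge => /ltnW; apply: leq_trans.
    by rewrite leq_mul2l.
  have := grow h.+1; rewrite leqNgt => /negP; apply.
  exact: leq_ltn_trans (subset_leq_card (ball_sub _ vV)) Vh.
have [i dbl imin] := ex_minnP ex.
have grow j : j <= i -> 2 ^ j <= #|ball V0 v j|.
  elim: j => [|j IHj] ji; first by rewrite cards1.
  rewrite expnS; have : ~~ (#|ball V0 v j.+1| <= 2 * #|ball V0 v j|).
    by apply/negP => /imin; rewrite leqNgt ji.
  rewrite -ltnNge => /ltnW; apply: leq_trans.
  by rewrite leq_mul2l IHj // ltnW.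
have ih : i <= h.
  rewrite -ltnS -(ltn_exp2l _ _ (isT : 1 < 2)); apply: leq_ltn_trans (grow i (leqnn _)) _.
  exact: leq_ltn_trans (subset_leq_card (ball_sub _ vV)) Vh.
have [d1|d1] := leqP #|ball V0 v i.+1| #|inner (ball V0 v i.+1)|.
  have [S [S1 S2 S3 S4]] := dense_ball vV d1; exists S; split=> //.
  by apply: leq_trans S4 _; rewrite ltnS leq_double.
pose V1 := V0 :\: ball V0 v i.
have cV : #|V1| = #|V0| - #|ball V0 v i| by rewrite cardsD (setIidPr (ball_sub i vV)).
have bV : #|ball V0 v i| <= #|V0| by apply: subset_leq_card; apply: ball_sub.
have b0 : 0 < #|ball V0 v i| by rewrite card_gt0; apply/set0Pn; exists v; exact: ball_v.
have eV : #|inner V0| <= #|inner V1| + #|inner (ball V0 v i.+1)|.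
  apply: leq_trans (leq_card_setU _ _); apply: subset_leq_card; apply/subsetP => f fV.
  rewrite inE; have [fb|] := boolP ((src f \in ball V0 v i) || (tgt f \in ball V0 v i)).
    by rewrite (ball_edge fV) ?orbT //; apply/orP.
  rewrite negb_or => /andP[sb tb]; apply/orP; left.
  by move: fV; rewrite !inE sb tb.
have d2 : 2 * #|V1| < #|inner V1|.
  by move: dens eV d1 dbl; rewrite cV; move: bV; clear; lia.
have [||||S [S1 S2 S3 S4]] := IH V1.
- by move: Vn b0 bV; rewrite cV; clear; lia.
- apply/eqP => V1e; move: d2; rewrite V1e cards0 muln0 => /= ; rewrite card_gt0 => /set0Pn[f].
  by rewrite !inE.
- exact: ltnW.
- by apply: leq_ltn_trans Vh; rewrite cV leq_subr.
by exists S; split=> //; apply: subset_trans S1 (subsetDl _ _).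
Qed.

Lemma inner_del S d : (forall x, #|[set f | inc x f]| <= d) ->
  #|E| <= #|inner (~: S)| + d * #|S|.
Proof.
move=> deg; have -> : #|E| = #|[set: E]| by rewrite cardsT.
have sub : [set: E] \subset inner (~: S) :|: \bigcup_(x in S) [set f | inc x f].
  apply/subsetP => f _; rewrite inE; have [sS|sS] := boolP (src f \in S).
    by apply/orP; right; apply/bigcupP; exists (src f) => //; rewrite inE /inc eqxx.
  have [tS|tS] := boolP (tgt f \in S).
    by apply/orP; right; apply/bigcupP; exists (tgt f) => //; rewrite inE /inc eqxx orbT.
  by rewrite !inE sS tS.
apply: leq_trans (subset_leq_card sub) _; apply: leq_trans (leq_card_setU _ _) _.
rewrite leq_add2l; apply: leq_trans (_ : \sum_(x in S) #|[set f | inc x f]| <= _).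
  elim/big_rec2: _ => [|x n B _ IH]; first by rewrite cards0.
  by apply: leq_trans (leq_card_setU _ _) _; rewrite leq_add2l.
by rewrite mulnC -sum_nat_const; apply: leq_sum => x _.
Qed.

(** Deleting the at most #|V| / 4 vertices of the subgraphs found so far costs at
    most 8 edges per vertex, which leaves at least twice as many edges as
    vertices. *)
Lemma many_short r h : (forall x, #|[set f | inc x f]| <= 8) ->
  4 * #|V| <= #|E| -> #|V| < 2 ^ h.+1 -> 0 < #|V| -> 4 * (r * (h.+1).*2.+1) <= #|V| ->
  exists Ss : seq {set V}, [/\ size Ss = r, pairwise (fun A B => [disjoint A & B]) Ss
    & forall S, S \in Ss -> S != set0 /\ #|S| <= #|inner S|].
Proof.
move=> deg VE Vh V0 rV; set s := (h.+1).*2.+1 in rV.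
suff [Ss [D [S1 S2 S3 S4 _]]] : exists Ss : seq {set V}, exists D : {set V},
   [/\ size Ss = r, pairwise (fun A B => [disjoint A & B]) Ss,
      forall S, S \in Ss -> S != set0 /\ #|S| <= #|inner S|,
      forall S, S \in Ss -> S \subset D & #|D| <= r * s] by exists Ss.
elim: r rV => [|r IH] rV.
  by exists [::], set0; split; rewrite // cards0.
have [|Ss [D [S1 S2 S3 S4 S5]]] := IH.
  by apply: leq_trans rV; rewrite leq_mul2l leq_mul2r leqnSn orbT.
have cD : #|~: D| + #|D| = #|V| by rewrite addnC cardsC.
have Ds : 4 * #|D| + 4 * s <= #|V|.
  by apply: leq_trans rV; rewrite (mulSn r) mulnDr addnC leq_add2l leq_mul2l.
have eD := inner_del D deg.
have [||| S [T1 T2 T3 T4]] := @short_dense (~: D) h.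
- by rewrite -card_gt0; move: cD Ds V0; rewrite /s; clear; lia.
- by move: eD cD Ds VE; clear; lia.
- by apply: leq_ltn_trans Vh; rewrite -cD leq_addr.
exists (S :: Ss), (D :|: S); split.
- by rewrite /= S1.
- rewrite /= S2 andbT; apply/allP => A /S4 AD.
  by apply: disjointWr AD _; rewrite disjoints_subset.
- by move=> A; rewrite inE => /predU1P[->//|/S3].
- move=> A; rewrite inE => /predU1P[->|/S4 h']; first exact: subsetUr.
  exact: subset_trans h' (subsetUl _ _).
- by apply: leq_trans (leq_card_setU _ _) _; rewrite mulSn addnC leq_add.
Qed.

(** A cycle, given by a vertex b, two edges at b and a path off b that contains
    their other ends.  After deleting vertices of degree at most 1, the first
    vertex of a longest path has two edges, which both lead back to the path.
    The other ends of f and g may coincide, as parallel edges are allowed. *)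
Lemma dense_cycle S : (forall f, src f != tgt f) -> S != set0 -> #|S| <= #|inner S| ->
  exists b s f g, [/\ f != g, f \in inner S, g \in inner S & inc b f /\ inc b g] /\
    [/\ b \in S, {subset s <= S}, b \notin s, other b f \in s /\ other b g \in s
      & sorted (fun x y => [exists k in inner S, inc x k && (other x k == y)]) s /\ uniq s].
Proof.
move=> noloop; have [n] := ubnP #|S|; elim: n S => // n IH S Sn S0 dens.
pose R x y := [exists k in inner S, inc x k && (other x k == y)].
have [low|high] := pselect (exists2 x, x \in S & #|[set f in inner S | inc x f]| <= 1).
  have [x xS xlow] := low.
  have cS : #|S| = #|S :\ x|.+1 by rewrite (cardsD1 x) xS.
  have eS : #|inner S| <= #|inner (S :\ x)| + 1.
    apply: leq_trans (_ : #|inner (S :\ x) :|: [set f in inner S | inc x f]| <= _).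
      apply: subset_leq_card; apply/subsetP => f fS; move: (fS); rewrite inE => /andP[fs ft].
      rewrite inE [f \in [set _ in _ | _]]inE fS /= inE !inE fs ft !andbT /inc.
      by case: (src f == x); case: (tgt f == x).
    by apply: leq_trans (leq_card_setU _ _) _; rewrite leq_add2l.
  have d' : #|S :\ x| <= #|inner (S :\ x)| by move: cS eS dens; clear; lia.
  have S'0 : S :\ x != set0.
    apply/eqP => S'0; have Sx : S = [set x] by rewrite -(setD1K xS) S'0 setU0.
    have : 0 < #|inner S| by apply: leq_trans dens; rewrite card_gt0.
    rewrite card_gt0 => /set0Pn[f]; rewrite Sx !inE => /andP[/eqP fs /eqP ft].
    by have := noloop f; rewrite fs ft eqxx.
  have Sn' : #|S :\ x| < n by move: Sn; rewrite cS.
  have [b [s [f [g [[fg fi gi bfg] [bS sS bs og [ps us]]]]]]] := IH _ Sn' S'0 d'.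
  have sub : S :\ x \subset S := subsetDl _ _.
  exists b, s, f, g; split; split=> //.
  - exact: (subsetP (innerS sub)).
  - exact: (subsetP (innerS sub)).
  - exact: (subsetP sub).
  - by move=> y /sS/(subsetP sub).
  - split=> //; apply: sub_sorted ps => u w /existsP[k /andP[ki h]].
    by apply/existsP; exists k; rewrite h andbT (subsetP (innerS sub)).
(* a longest path of S *)
have [x0 x0S] := set0Pn _ S0.
pose good m := [exists t : m.-tuple V, [&& uniq t, sorted R t & all (mem S) t]].
have ex : exists m, good m.
  by exists 1; apply/existsP; exists [tuple x0]; rewrite /= x0S.
have bd m : good m -> m <= #|V|.
  move=> /existsP[t /and3P[ut _ _]]; rewrite -(size_tuple t) -(card_uniqP ut).
  exact: max_card.
have [m /existsP[t /and3P[ut st tS]] mmax] := ex_maxnP ex bd.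
have m1 : 1 <= m by apply: mmax; apply/existsP; exists [tuple x0]; rewrite /= x0S.
case: t ut st tS => [[|b s] /= /eqP szt]; first by move: m1; rewrite -szt.
move=> /andP[bs us] pbs /andP[bS /allP sS].
have Rsym f : f \in inner S -> inc b f -> R (other b f) b.
  move=> fi bf; apply/existsP; exists f; rewrite fi inc_other //=.
  move: bf (noloop f); rewrite /other /inc; case: (src f =P b) => [->|_ /= /eqP ->].
    by move=> _ /negPf ->.
  by rewrite eqxx.
have nbs f : f \in inner S -> inc b f -> other b f \in s.
  move=> fi bf; apply: contraT => no.
  have ob : other b f != b.
    move: bf (noloop f); rewrite /other /inc; case: (src f =P b) => [->|/eqP nb //].
    by rewrite eq_sym.
  have oS : other b f \in S by move: fi; rewrite (inner_inc _ bf) => /andP[].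
  have szt' : size [:: other b f, b & s] == m.+1 by rewrite /= szt.
  have := mmax m.+1; rewrite ltnn => -> //.
  apply/existsP; exists (Tuple szt') => /=.
  rewrite inE negb_or ob no bs us bS oS /= pbs Rsym //= .
  by apply/allP.
have : 1 < #|[set f in inner S | inc b f]|.
  by rewrite ltnNge; apply/negP => h; apply: high; exists b.
case/card_gt1P => f [g [+ + fg]]; rewrite !in_set => /andP[fi bf] /andP[gi bg].
have {}fi : f \in inner S by rewrite inE.
have {}gi : g \in inner S by rewrite inE.
exists b, s, f, g; split; split=> //.
- by split; apply: nbs.
- by split=> //; apply: path_sorted pbs.
Qed.
End Multigraph.

(** * Cycles in ladders with long rungs *)

Section Side.
Variables (T : finType) (e : rel T).
Hypothesis e_sym : symmetric e.

(** As f is monotone along the path, its level sets are segments. *)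
Lemma sorted_level (f : T -> nat) c (A : seq T) :
  sorted e A -> sorted leq (map f A) -> sorted e [seq y <- A | f y == c].
Proof.
elim: A => //= x A IH pA pf; have {}IH := IH (path_sorted pA) (path_sorted pf).
case: ifP => // /eqP fx; case: A pA pf IH => //= y A /andP[xy _] /andP[fxy pf].
case: eqP => [_ h|fy _]; first by rewrite /= xy.
(* the values after y exceed c *)
rewrite (_ : [seq z <- A | f z == c] = [::]) //.
apply/eqP; rewrite -[_ == _]negbK -has_filter; apply/hasPn => z zA.
have /allP/(_ (f z)) := order_path_min leq_trans pf; rewrite map_f // => /(_ isT) yz.
by apply/eqP => fz; apply: fy; apply/eqP; rewrite eqn_leq -{1}fz yz -fx.
Qed.

(** The block of x is the number of terminals before x, divided by 8. *)
Lemma side_blocks (A : seq T) m (a : 'I_(8 * m) -> T) :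
  uniq A -> sorted e A -> injective a -> (forall i, a i \in A) ->
  exists blk : T -> nat, [/\ forall i, blk (a i) < m,
    forall c, #|[set i | blk (a i) == c]| <= 8
  & forall x, x \in A -> conn e [set y in A | blk y == blk x]].
Proof.
move=> uA sA a_inj aA.
pose rk x := #|[set k | index (a k) A < index x A]|.
have rk_mono x y : index x A <= index y A -> rk x <= rk y.
  by move=> xy; apply: subset_leq_card; apply/subsetP => k; rewrite !inE => /leq_trans; apply.
have rk_lt i k : index (a i) A < index (a k) A -> rk (a i) < rk (a k).
  move=> ik; apply: proper_card; apply/properP; split.
    by apply/subsetP => h; rewrite !inE => /ltn_trans; apply.
  by exists i; rewrite !inE ?ltnn.
have rk_inj i k : rk (a i) = rk (a k) -> i = k.
  move=> E; apply: a_inj; apply: (@index_inj _ (a i) A) => //.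
  case: (ltngtP (index (a i) A) (index (a k) A)) => // /rk_lt; by rewrite E ltnn.
exists (fun x => rk x %/ 8); split.
- move=> i; rewrite ltn_divLR // mulnC -[X in _ < X]card_ord.
  rewrite -cardsT; apply: proper_card; apply/properP; split; first exact: subsetT.
  by exists i; rewrite !inE ?ltnn.
- move=> c; pose g (i : 'I_(8 * m)) : 'I_8 := inord (rk (a i) %% 8).
  have gi : {in [set i | rk (a i) %/ 8 == c] &, injective g}.
    move=> i k; rewrite !inE => /eqP ic /eqP kc /(congr1 val); rewrite /g /= !inordK ?ltn_mod // => E.
    by apply: rk_inj; rewrite (divn_eq (rk (a i)) 8) (divn_eq (rk (a k)) 8) ic kc E.
  by rewrite -(card_in_imset gi) -[X in _ <= X]card_ord max_card.
- move=> x xA; have so : sorted leq (map (fun y => rk y %/ 8) A).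
    rewrite sorted_map; apply/(sortedP x) => i iA /=; apply/leq_div2r/rk_mono.
    by rewrite !index_uniq // ltnW.
  have -> : [set y in A | rk y %/ 8 == rk x %/ 8] =
            [set y in [seq y <- A | rk y %/ 8 == rk x %/ 8]].
    by apply/setP => y; rewrite !inE mem_filter andbC.
  apply: (conn_sorted e_sym (x := x)); first exact: sorted_level.
  by rewrite mem_filter eqxx.
Qed.
End Side.

Section Ladder.
Variables (T : finType) (e : rel T).
Hypothesis e_sym : symmetric e.
Variables (A Z : seq T) (m l : nat) (a z : 'I_(8 * m) -> T) (N : 'I_(8 * m) -> seq T).
Hypothesis uA : uniq A.
Hypothesis sA : sorted e A.
Hypothesis uZ : uniq Z.
Hypothesis sZ : sorted e Z.
Hypothesis dAZ : forall v, v \in A -> v \notin Z.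
Hypothesis a_inj : injective a.
Hypothesis z_inj : injective z.
Hypothesis aA : forall i, a i \in A.
Hypothesis zZ : forall i, z i \in Z.
Hypothesis dN : forall i v, v \in N i -> v \notin A /\ v \notin Z.
Hypothesis pN : forall i, path e (a i) (rcons (N i) (z i)) /\ uniq (N i).
Hypothesis dNN : forall i k v, v \in N i -> v \in N k -> i = k.
Hypothesis l3 : 3 <= l.
Hypothesis lN : forall i, l <= 2 * size (N i).

Variables blk1 blk2 : T -> nat.
Hypothesis blk1m : forall i, blk1 (a i) < m.
Hypothesis blk2m : forall i, blk2 (z i) < m.
Hypothesis conn1 : forall x, x \in A -> conn e [set y in A | blk1 y == blk1 x].
Hypothesis conn2 : forall x, x \in Z -> conn e [set y in Z | blk2 y == blk2 x].

Let V : finType := ('I_m + 'I_m)%type.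
Let src (i : 'I_(8 * m)) : V := inl (Ordinal (blk1m i)).
Let tgt (i : 'I_(8 * m)) : V := inr (Ordinal (blk2m i)).
Let rinc := inc src tgt.
Let roth := other src tgt.
Let rinn := inner src tgt.

Definition block (v : V) : {set T} :=
  match v with
  | inl c => [set x in A | blk1 x == c]
  | inr c => [set x in Z | blk2 x == c]
  end.

Definition terminal (v : V) i := if v is inl _ then a i else z i.

Lemma noloop i : src i != tgt i. Proof. by []. Qed.

Lemma terminal_block v i : rinc v i -> terminal v i \in block v.
Proof. by case: v => c /orP[] // /eqP[<-]; rewrite !inE ?aA ?zZ eqxx. Qed.

Lemma conn_block v i : rinc v i -> conn e (block v).
Proof.
case: v => c /orP[] // /eqP[<-]; [exact: (conn1 (aA i))|exact: (conn2 (zZ i))].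
Qed.

Lemma other_inc v i : rinc v i -> rinc (roth v i) i. Proof. exact: inc_other. Qed.

Lemma other_other v i : rinc v i -> roth (roth v i) i = v.
Proof. by case: v => c /orP[] // /eqP[<-]; rewrite /roth /other /= ?eqxx. Qed.

Lemma inc_two v w i : rinc v i -> rinc w i -> w = v \/ w = roth v i.
Proof.
by case: v => c /orP[] // /eqP[<-] /orP[] /eqP <-; rewrite /roth /other /= ?eqxx; auto.
Qed.

Lemma rung_dir v i : rinc v i -> exists s, [/\ s =i N i, size s = size (N i), uniq s
  & path e (terminal v i) (rcons s (terminal (roth v i) i))].
Proof.
have [pi ui] := pN i; case: v => c /orP[] // /eqP[<-]; rewrite /roth /other /= ?eqxx /=.
  by exists (N i).
exists (rev (N i)); split; rewrite ?size_rev ?rev_uniq //; first by move=> x; rewrite mem_rev.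
have := rev_path e (a i) (rcons (N i) (z i)); rewrite last_rcons belast_rcons rev_cons => ->.
by apply: sub_path pi => u v; rewrite e_sym.
Qed.

Lemma block_disj v w x : x \in block v -> x \in block w -> v = w.
Proof.
case: v => c; case: w => d; rewrite !inE => /andP[xv /eqP E] /andP[xw /eqP E'].
- by congr inl; apply: val_inj; rewrite /= -E -E'.
- by have := dAZ xv; rewrite xw.
- by have := dAZ xw; rewrite xv.
- by congr inr; apply: val_inj; rewrite /= -E -E'.
Qed.

Lemma block_N v i x : x \in N i -> x \notin block v.
Proof. by move=> /dN[xA xZ]; case: v => c; rewrite inE ?(negPf xA) ?(negPf xZ). Qed.

(** C is the union of the blocks along a path of the multigraph and of the rungs
    between them; the last clause serves to show that it is disjoint from other
    blocks and rungs. *)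
Lemma chain_conn S v s : path (fun x y => [exists k in rinn S, rinc x k && (roth x k == y)]) v s ->
  (exists i, rinc v i) ->
  exists C, [/\ conn e C, forall w, w \in v :: s -> block w \subset C
    & forall x, x \in C -> (exists2 w, w \in v :: s & x \in block w) \/
        exists w k, [/\ k \in rinn S, rinc w k, w \in v :: s, roth w k \in v :: s & x \in N k]].
Proof.
elim: s v => [|w s IH] v /=.
  move=> _ [i iv]; exists (block v); split; first exact: conn_block iv.
    by move=> w; rewrite inE => /eqP ->.
  by move=> x xv; left; exists v; rewrite ?mem_head.
case/andP=> /existsP[k /and3P[kS vk /eqP ok]] pw _.
have wk : rinc w k by rewrite -ok; apply: other_inc.
have [C [cC sC CC]] := IH w pw (ex_intro _ k wk).
have [r [rN _ _ pr]] := rung_dir vk.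
have cN : conn e (block v :|: [set x in N k]) /\ exists2 y, y \in [set x in N k] & e y (terminal w k).
  case: r rN pr => [|y r] rN.
    have : 0 < size (N k) by move: (lN k) l3; clear; lia.
    by case: (N k) rN => // y n rN; have := rN y; rewrite mem_head in_nil.
  rewrite rcons_cons /= rcons_path => /and3P[vy pr lw].
  have NE : [set x in N k] = [set x in y :: r] by apply/setP => x; rewrite !inE -rN inE.
  split.
    apply: (connE e_sym (conn_block vk) _ (terminal_block vk) _ vy).
      by rewrite NE; apply: conn_path.
    by rewrite NE inE mem_head.
  by exists (last y r); [rewrite NE inE mem_last|rewrite -ok].
have [cVN [y yN yw]] := cN.
exists (block v :|: [set x in N k] :|: C); split.
- apply: (connE e_sym cVN cC (x := y) (y := terminal w k)) => //.
    by rewrite in_setU yN orbT.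
  by apply: (subsetP (sC w (mem_head _ _))); apply: terminal_block.
- move=> u; rewrite inE => /predU1P[->|/sC us]; first by rewrite -setUA subsetUl.
  exact: subset_trans us (subsetUr _ _).
- move=> x; rewrite !in_setU => /orP[/orP[xv|xN]|/CC[[u us xu]|[u [k' [h1 h2 h3 h4 h5]]]]].
  + by left; exists v; rewrite ?mem_head.
  + right; have vs : v \in v :: w :: s := mem_head _ _.
    have ws : w \in v :: w :: s by rewrite in_cons mem_head orbT.
    exists v, k; rewrite ok; split=> //; by move: xN; rewrite inE.
  + by left; exists u => //; rewrite inE us orbT.
  + by right; exists u, k'; split=> //; rewrite inE ?h3 ?h4 orbT.
Qed.

Definition span (S : {set V}) : {set T} :=
  (\bigcup_(v in S) block v) :|: \bigcup_(k in rinn S) [set x in N k].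

Lemma span_disj (S S' : {set V}) : [disjoint S & S'] -> [disjoint span S & span S'].
Proof.
move=> dS; have nS v : v \in S -> v \in S' -> False by move=> h; rewrite (disjointFr dS h).
rewrite -nmeets_disj; apply/negP => /meetsP[x].
rewrite !in_setU => /orP[] /bigcupP[i iS xi] /orP[] /bigcupP[k kS xk].
- by have ik := block_disj xi xk; subst; apply: nS iS kS.
- by rewrite inE in xk; have := block_N i xk; rewrite xi.
- by rewrite inE in xi; have := block_N k xi; rewrite xk.
- rewrite !inE in xi xk; have ik := dNN xi xk; subst k.
  by move: iS kS; rewrite !inE => /andP[h _] /andP[h' _]; apply: nS h h'.
Qed.

(** At the block b the rungs f and g of [dense_cycle] meet.  The path of the model
    runs through f, the block and g, which is long enough already; the rest of
    the cycle of the multigraph provides the connected set. *)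
Lemma span_cycle S : S != set0 -> #|S| <= #|rinn S| -> cycle_model e l (span S).
Proof.
move=> S0 dens; have [b [s [f [g [[fg fi gi [bf bg]] [bS sS bs [of_ og] [ss us]]]]]]] := dense_cycle noloop S0 dens.
have [C [cC sC CC]] : exists C, [/\ conn e C, forall w, w \in s -> block w \subset C
    & forall x, x \in C -> (exists2 w, w \in s & x \in block w) \/
        exists w k, [/\ k \in rinn S, rinc w k, w \in s, roth w k \in s & x \in N k]].
  case: s ss {sS bs og us} of_ => // v s ps of_; apply: chain_conn (ps) _.
  move: of_ ps; rewrite inE => /predU1P[<- _|]; first by exists f; apply: inc_other.
  case: s => // w s _ /andP[/existsP[k /and3P[_ vk _]] _]; by exists k.
have [sf [sfN sfs sfu]] := rung_dir (other_inc bf); rewrite other_other // => sfp.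
have [sg [sgN sgs sgu sgp]] := rung_dir bg.
have [t [pt lt ut st]] := conn_upath (conn_block bf) (terminal_block bf) (terminal_block bg).
have sf2 : 2 <= size sf by rewrite sfs; move: (lN f) l3; clear; lia.
have sg2 : 2 <= size sg by rewrite sgs; move: (lN g) l3; clear; lia.
have inS v k : k \in rinn S -> rinc v k -> v \in S.
  by rewrite inE => /andP[h h'] /orP[/eqP <-|/eqP <-].
case: sf sfN sfs sfu sfp sf2 => // x sf sfN sfs sfu sfp sf2.
pose p := sf ++ (terminal b f :: t) ++ sg.
have pin v : v \in x :: p -> v \in N f \/ v \in block b \/ v \in N g.
  rewrite /p -cat_cons mem_cat mem_cat => /or3P[h|h|h].
  - by left; rewrite -sfN.
  - by right; left; apply: st.
  - by right; right; rewrite -sgN.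
have bC k : rinc b k -> forall v, v \in N k -> v \notin C.
  move=> bk v vk; apply/negP => /CC[[w _]|[w [k' [_ wk' ws os vk']]]].
    by apply/negP; apply: block_N vk.
  have kk := dNN vk vk'; subst k'.
  by case: (inc_two wk' bk) => E; move: bs; rewrite E ?ws ?os.
have lastp : last x p = last (terminal b g) sg.
  by rewrite /p !last_cat /= lt.
exists x, p, C; split; split.
- rewrite /p -cat_cons cat_uniq sfu andTb [uniq (_ ++ sg)]cat_uniq ut sgu andTb andbT.
  apply/andP; split; apply/hasPn => v.
    rewrite mem_cat => /orP[/st vb|vg]; apply/negP; rewrite sfN => vf.
      by have := block_N b vf; rewrite vb.
    by move/eqP: fg; apply; apply: dNN vf _; rewrite -sgN.
  rewrite sgN => vg; apply/negP => /st vb.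
  by have := block_N b vg; rewrite vb.
- move: sfp sgp; rewrite /p /= !rcons_path => /and3P[_ psf esf] /andP[psg _].
  rewrite cat_path psf /= esf cat_path pt lt //=.
- rewrite /p !size_cat /= ; move: (lN f) (lN g); rewrite -sfs -sgs /=; clear; lia.
- move=> v /pin[h|[h|h]]; rewrite in_setU.
  + by apply/orP; right; apply/bigcupP; exists f; rewrite // inE.
  + by apply/orP; left; apply/bigcupP; exists b.
  + by apply/orP; right; apply/bigcupP; exists g; rewrite // inE.
- exact: cC.
- move=> v /pin[h|[h|h]]; [exact: bC bf _ h| |exact: bC bg _ h].
  apply/negP => /CC[[w ws vw]|[w [k' [_ _ _ _ vk]]]].
    by move: bs; rewrite (block_disj h vw) ws.
  by have := block_N b vk; rewrite h.
- apply/subsetP => v /CC[[w ws vw]|[w [k [kS _ _ _ vk]]]]; rewrite in_setU.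
  + by apply/orP; left; apply/bigcupP; exists w => //; apply: sS.
  + by apply/orP; right; apply/bigcupP; exists k; rewrite // inE.
- exists (terminal (roth b f) f).
    by apply: (subsetP (sC _ of_)); apply: terminal_block; apply: other_inc.
  by move: sfp => /andP[]; rewrite e_sym.
- exists (terminal (roth b g) g).
    by apply: (subsetP (sC _ og)); apply: terminal_block; apply: other_inc.
  by rewrite lastp; move: sgp; rewrite rcons_path => /andP[].
Qed.
End Ladder.

Theorem ladder (T : finType) (e : rel T) (A Z : seq T) m l h r
  (a z : 'I_(8 * m) -> T) (N : 'I_(8 * m) -> seq T) :
  symmetric e -> uniq A -> sorted e A -> uniq Z -> sorted e Z ->
  (forall v, v \in A -> v \notin Z) -> injective a -> injective z ->
  (forall i, a i \in A) -> (forall i, z i \in Z) ->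
  (forall i v, v \in N i -> v \notin A /\ v \notin Z) ->
  (forall i, path e (a i) (rcons (N i) (z i)) /\ uniq (N i)) ->
  (forall i k v, v \in N i -> v \in N k -> i = k) ->
  3 <= l -> (forall i, l <= 2 * size (N i)) ->
  0 < m -> 2 * m < 2 ^ h.+1 -> 4 * (r * (h.+1).*2.+1) <= 2 * m ->
  exists Ws : seq {set T}, [/\ size Ws = r, pairwise (fun B C : {set T} => [disjoint B & C]) Ws
    & forall W, W \in Ws -> cycle_model e l W].
Proof.
move=> e_sym uA sA uZ sZ dAZ ai zi aA zZ dN pN dNN l3 lN m0 hm rm.
have [blk1 [b1 d1 c1]] := side_blocks e_sym uA sA ai aA.
have [blk2 [b2 d2 c2]] := side_blocks e_sym uZ sZ zi zZ.
pose V : finType := ('I_m + 'I_m)%type.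
pose src i : V := inl (Ordinal (b1 i)); pose tgt i : V := inr (Ordinal (b2 i)).
have cV : #|V| = 2 * m by rewrite card_sum card_ord mul2n addnn.
have [|||||Ss [S1 S2 S3]] := @many_short V _ src tgt r h.
- move=> [c|c].
    apply: leq_trans (d1 c); apply: subset_leq_card; apply/subsetP => i; rewrite !inE.
    by case/orP => // /eqP[<-].
  apply: leq_trans (d2 c); apply: subset_leq_card; apply/subsetP => i; rewrite !inE.
  by case/orP => // /eqP[<-].
- by rewrite card_ord cV mulnA.
- by rewrite cV.
- by rewrite cV muln_gt0.
- by rewrite cV.
exists [seq span A Z N b1 b2 X | X <- Ss]; split.
- by rewrite size_map.
- rewrite pairwise_map; apply: sub_pairwise S2 => S S' dS; exact: span_disj.
- by move=> _ /mapP[S /S3[S0 dens] ->]; apply: span_cycle.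
Qed.

(** * Many cycles *)

Section Models.
Variable T : finType.
Implicit Types (e : rel T) (D W : {set T}) (ls : seq nat).

(** Disjoint models of cycles, in the order in which [many_cycles] finds
    them. *)
Fixpoint models e ls D : Prop :=
  if ls is l :: ls' then
    exists W, [/\ W \subset D, cycle_model e l W & models e ls' (D :\: W)]
  else True.

Lemma modelsS e ls D D' : D \subset D' -> models e ls D -> models e ls D'.
Proof.
elim: ls D D' => //= l ls IH D D' sD [W [WD cW mW]]; exists W; split=> //.
  exact: subset_trans WD sD.
by apply: IH mW; apply: setSD.
Qed.

Lemma models_restr e D0 ls D : symmetric e -> all (leq 3) ls ->
  models (restr e D0) ls D -> models e ls (D :&: D0).
Proof.
move=> e_sym; elim: ls D => //= l ls IH D /andP[l3 ls3] [W [WD cW mW]].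
exists (W :&: D0); split; first exact: setSI.
  exact: model_restr cW.
apply: modelsS (IH _ ls3 mW); apply/subsetP => x; rewrite !inE.
by case: (x \in W); case: (x \in D); case: (x \in D0).
Qed.

Lemma models_seq e l ls D (Ws : seq {set T}) : size ls <= size Ws ->
  all (fun l' => l' <= l) ls -> pairwise (fun B C : {set T} => [disjoint B & C]) Ws ->
  (forall W, W \in Ws -> cycle_model e l W /\ W \subset D) -> models e ls D.
Proof.
elim: ls Ws D => //= l' ls IH [|W Ws] D //= sz /andP[ll lsl] /andP[/allP dW dWs] h.
have [cW WD] := h W (mem_head _ _); exists W; split=> //; first exact: cycle_model_le cW.
apply: (IH Ws) => // W' W's; have [cW' W'D] := h W' (mem_behead (s := W :: Ws) W's).
by split=> //; rewrite subsetD W'D disjoint_sym dW.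
Qed.

Lemma models_nth e ls D : models e ls D -> exists W : nat -> {set T},
  (forall i, i < size ls -> cycle_model e (nth 0 ls i) (W i) /\ W i \subset D) /\
  forall i k, i < k -> k < size ls -> [disjoint W i & W k].
Proof.
elim: ls D => [|l ls IH] D /=; first by exists (fun _ => set0).
move=> [W [WD cW /IH[W' [h1 h2]]]]; exists (fun i => if i is i'.+1 then W' i' else W); split.
  case=> [|i] //= /h1[? h]; split=> //; exact: subset_trans h (subsetDl _ _).
case=> [|i] [|k] //=; last by rewrite !ltnS; apply: h2.
by move=> _ /h1[_]; rewrite subsetD disjoint_sym => /andP[].
Qed.
End Models.

Section ManyCycles.
Variables (T : finType) (m h r : nat).
Hypothesis m0 : 0 < m.
Hypothesis hm : 2 * m < 2 ^ h.+1.
Hypothesis rm : 4 * (r * (h.+1).*2.+1) <= 2 * m.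
Implicit Types (e : rel T).

(** With q = 8 * m, the path P consumes l + 2 * q - 2 of the order, and a short
    linking path uphalf l; the remaining 2 * q ensure that the order u left for
    the hub is at least 2 * q - 1. *)
Definition cost l := l + uphalf l + 32 * m.

(** The order left by P is u; a short linking path lowers it by at most uphalf l,
    and the induction takes place in the graph without P and this path.  If all
    linking paths are long, the ladder provides all remaining cycles at once,
    as l is the largest length. *)
Theorem many_cycles ls e BB k : symmetric e -> bramble e BB -> order_ge BB k ->
  all (leq 3) ls -> sorted geq ls -> size ls <= r -> sumn (map cost ls) <= k ->
  models e ls setT.
Proof.
elim: ls e BB k => //= l ls IH e BB k e_sym bB oB /andP[l3 ls3] pls szr lk.
have lsl : all (fun l' => l' <= l) ls.
  by apply: (order_path_min (leT := geq)) pls => x y z xy yz; apply: leq_trans yz xy.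
pose q := 8 * m; pose u := k - (l + 2 * q - 2).
have q0 : 0 < q by rewrite /q muln_gt0.
have uk : u + (l + 2 * q - 2) = k /\ 2 * q <= u + 1 /\ u >= sumn (map cost ls) + uphalf l.
  by move: lk q0; rewrite /u /cost /q; clear; lia.
have [ukE [uq us]] := uk; move: ukE uq us; clearbody u; move=> ukE uq us.
have [||P [U [BU [[uP sP cU PU] [tBU oP blocked]]]]] := @hub _ e e_sym BB k u bB oB.
- by move: uq q0; clear; lia.
- by move: ukE; clear; lia.
have [|A1 [a0 [I [Z [PE sI2 rA rZ _]]]]] := segments blocked q0 l3 uq.
  by rewrite ukE.
set A := rcons A1 a0 in PE rA *.
have inP v : v \in P = [|| v \in A, v \in I | v \in Z] by rewrite PE !mem_cat.
have UP v : v \in U -> v \notin P by apply: contraTN => /PU.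
have dAZ v : v \in A -> v \notin Z.
  move=> vA; move: uP; rewrite PE cat_uniq => /and3P[_ /hasPn hh _]; apply/negP => vZ.
  by have := hh v; rewrite mem_cat vZ orbT vA => /(_ isT).
have [|||||a [z [N [h1 a_inj z_inj h3 h4]]]] := @linked _ e e_sym U BU tBU [set x in A] [set x in Z] q.
- by rewrite -nmeets_disj; apply/negP => /meetsP[v]; rewrite !inE => /dAZ/negPf->.
- rewrite -nmeets_disj; apply/negP => /meetsP[v]; rewrite inE => vA /UP; by rewrite inP vA.
- rewrite -nmeets_disj; apply/negP => /meetsP[v]; rewrite inE => vA /UP; by rewrite inP vA !orbT.
- exact: rA.
- exact: rZ.
have aA i : a i \in A by case: (h1 i); rewrite inE.
have zZ i : z i \in Z by case: (h1 i) => _; rewrite inE.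
have NU i v : v \in N i -> v \in U by case: (h1 i) => _ _; apply.
have [[i short]|long] := pselect (exists i, size (N i) <= uphalf l); last first.
  have uA : uniq A by move: uP; rewrite PE cat_uniq => /and3P[].
  have sA : sorted e A by move: sP; rewrite PE => /cat_sorted2[].
  have uZ : uniq Z by move: uP; rewrite PE !cat_uniq => /and3P[_ _ /and3P[]].
  have sZ : sorted e Z by move: sP; rewrite PE => /cat_sorted2[_ /cat_sorted2[]].
  have dN i v : v \in N i -> v \notin A /\ v \notin Z.
    by move=> /NU/UP; rewrite inP !negb_or => /and3P[].
  have pN i : path e (a i) (rcons (N i) (z i)) /\ uniq (N i) by case: (h3 i).
  have lN i : l <= 2 * size (N i).
    have : ~~ (size (N i) <= uphalf l) by apply/negP => hl; apply: long; exists i.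
    by clear; lia.
  have [Ws [W1 W2 W3]] := ladder e_sym uA sA uZ sZ dAZ a_inj z_inj aA zZ dN pN h4 l3 lN m0 hm rm.
  apply: (@models_seq _ e l (l :: ls) setT Ws) => //.
  - by rewrite W1.
  - by rewrite /= leqnn.
  - by move=> W /W3; split=> //; exact: subsetT.
pose W := [set v in P] :|: [set v in N i].
have [n0 pN uN] := h3 i.
have PN v : v \in P -> v \notin N i by move=> /PU; apply: contra => /NU.
exists W; split; first exact: subsetT.
  have [A2 [A3 AE]] : exists A2 A3, A = A2 ++ a i :: A3 by case/splitPr: (aA i) => A2 A3; exists A2, A3.
  have [Z2 [Z3 ZE]] : exists Z2 Z3, Z = Z2 ++ z i :: Z3 by case/splitPr: (zZ i) => Z2 Z3; exists Z2, Z3.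
  have PE2 : P = A2 ++ (a i :: A3 ++ I ++ rcons Z2 (z i)) ++ Z3.
    by rewrite PE AE ZE -!catA /= -!catA cat_rcons.
  have PI v : v \in a i :: A3 ++ I ++ rcons Z2 (z i) -> v \in P by rewrite PE2 !mem_cat => ->; rewrite orbT.
  exists (a i), (A3 ++ I ++ rcons Z2 (z i)), [set v in N i]; split; split.
  - by move: uP; rewrite PE2 cat_uniq cat_uniq => /and3P[_ _ /and3P[]].
  - by move: sP; rewrite PE2 => /cat_sorted2[_ /cat_sorted2[]].
  - by rewrite !size_cat size_rcons sI2; move: l3; clear; lia.
  - by move=> v /PI vP; rewrite !inE vP.
  - case: (N i) n0 pN => //= y s _; rewrite rcons_path => /and3P[_ ps _]; exact: conn_path.
  - by move=> v /PI/PN; rewrite inE.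
  - exact: subsetUr.
  - case: (N i) n0 pN => //= y s _ /andP[ay _]; exists y => //; by rewrite inE mem_head.
  - rewrite !last_cat last_rcons; case: (N i) n0 pN => //= y s _; rewrite rcons_path => /and3P[_ _ lz].
    by exists (last y s); [rewrite inE mem_last|rewrite e_sym].
have e'_sym : symmetric (restr e (~: W)) := restr_sym e_sym _.
have [cB tB] := bB.
have bB' : bramble (restr e (~: W)) (avoid BB W).
  have avW B v : B \in avoid BB W -> v \in B -> v \in ~: W.
    by rewrite inE => /andP[_ nBW] /(nmeetsP nBW); rewrite in_setC.
  split=> [B|B C] hB.
    have : conn e B by apply: cB; move: hB; rewrite inE => /andP[].
    by apply: conn_rel => x y /(avW _ _ hB) xW /(avW _ _ hB) yW xy; apply/and3P.
  move=> hC; have /touchP[x [y [xB yC xy]]] : touch e B C.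
    by apply: tB; [move: hB|move: hC]; rewrite inE => /andP[].
  apply/touchP; exists x, y; split=> //; case/orP: xy => [->//|xy].
  by apply/orP; right; apply/and3P; split=> //; [exact: avW hB xB|exact: avW hC yC].
have oB' : order_ge (avoid BB W) (sumn (map cost ls)).
  move=> X cX; apply: leq_trans (_ : u - #|[set v in N i]| <= _).
    have : #|[set v in N i]| <= size (N i) by rewrite cardsE card_size.
    by move: us short; clear; lia.
  apply: (avoid_order oP); apply/coversP => B; rewrite inE => /andP[+ nN].
  rewrite inE => /andP[BB_B nP]; move/coversP: cX; apply; rewrite inE BB_B.
  by rewrite meetsC /W meetsUl negb_or !(meetsC _ B) nP.
have := IH _ _ _ e'_sym bB' oB' ls3 (path_sorted pls) (ltnW szr) (leqnn _).
by move=> /(models_restr e_sym ls3); apply: modelsS; rewrite setTI setTD.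
Qed.
End ManyCycles.

(** * Bounds on the treewidth *)

Section Final.

Lemma minor_of_list (H G : sgraph) r (l : 'I_r -> nat) ls :
  (forall i, 3 <= l i) -> iso H (disjoint_union (fun i => cycle_graph (l i))) ->
  perm_eq (codom l) ls -> models (@adj G) ls setT -> minor H G.
Proof.
move=> l3 iH /(perm_iotaP 0)[Is uIs lE] /models_nth[W [W1 W2]].
apply: minor_iso iH _.
have sIs : size Is = r by have := congr1 size lE; rewrite size_map size_codom card_ord.
have ltI (i : 'I_r) : nth 0 Is i < size ls.
  have : nth 0 Is i \in Is by rewrite mem_nth // sIs.
  by rewrite (perm_mem uIs) mem_iota.
have nthl (i : 'I_r) : nth 0 ls (nth 0 Is i) = l i.
  have -> : l i = nth 0 (codom l) i.
    by rewrite /codom /image_mem (nth_map i) ?size_enum_ord // nth_ord_enum.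
  by rewrite lE (nth_map 0) // sIs.
apply: (@minor_of_models G r l (fun i => W (nth 0 Is i))) => //.
- by move=> i; rewrite -nthl; case: (W1 _ (ltI i)).
- move=> i j nij; have : nth 0 Is i != nth 0 Is j.
    by rewrite nth_uniq ?sIs // (perm_uniq uIs) iota_uniq.
  by rewrite neq_ltn => /orP[h|h]; [|rewrite disjoint_sym]; apply: W2 h (ltI _).
Qed.

Lemma is_f_exists (H : sgraph) K : minor_free_treewidth_le H K ->
  exists k, is_f H k /\ k <= K.
Proof.
move=> hK; have ex : exists k, `[< minor_free_treewidth_le H k >] by exists K; apply/asboolP.
have [k /asboolP hk kmin] := ex_minnP ex; exists k; split; last by apply: kmin; apply/asboolP.
by split=> // k' /asboolP; apply: kmin.
Qed.

Lemma bramble_treewidth (H : sgraph) k :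
  (forall (G : sgraph) BB, bramble (@adj G) BB -> order_ge BB k.+2 -> minor H G) ->
  minor_free_treewidth_le H k.
Proof.
move=> h G nm; apply: treewidth_le_bramble => BB bB; apply: contrapT => no.
apply: nm; apply: h bB _ => X cX; rewrite ltnNge; apply/negP => Xk; apply: no.
by exists X.
Qed.

Lemma card_cycles r (H : sgraph) (l : 'I_r -> nat) :
  iso H (disjoint_union (fun i => cycle_graph (l i))) -> #|H| = sumn (codom l).
Proof.
move=> [phi bphi _]; rewrite (bij_eq_card bphi) card_tagged; congr sumn.
by rewrite /codom /image_mem; apply: eq_map => i; rewrite card_ord.
Qed.

Lemma sumn_cost m ls :
  2 * sumn (map (cost m) ls) <= 3 * sumn ls + size ls + 64 * m * size ls.
Proof.
elim: ls => //= l ls; have : 2 * uphalf l <= l + 1 by lia.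
rewrite [cost m l]/cost; move: (sumn (map _ ls)) (sumn ls) (size ls) => S n t.
nia.
Qed.

Lemma cycles_treewidth r (H : sgraph) : 3 <= r -> disjoint_union_of_cycles r H ->
  exists k, is_f H k /\ 2 * k <= 3 * #|H| + r + 2048 * (r * r * up_log 2 r).
Proof.
move=> r3 [l [l3 iH]]; set L := up_log 2 r.
have rL : r <= 2 ^ L by apply: up_logP.
have L2 : 2 <= L.
  by rewrite ltnNge; apply/negP => L1; move: rL; rewrite leqNgt => /negP; apply;
     apply: leq_trans r3; rewrite ltnS; apply: leq_trans (leq_pexp2l _ L1) _.
(* The ladder needs 4 r (2 h + 3) <= 2 m < 2 ^ (h + 1). *)
pose m := 32 * (r * L); pose h := 6 + 2 * L.
have m0 : 0 < m by rewrite /m !muln_gt0; move: r3 L2; clear; lia.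
have hm : 2 * m < 2 ^ h.+1.
  have -> : 2 ^ h.+1 = 128 * (2 ^ L * 2 ^ L) by rewrite /h -addSn expnD mul2n -addnn expnD.
  have : L < 2 ^ L by apply: ltn_expl.
  by move: rL r3; rewrite /m; move: (2 ^ L) => X; clear; nia.
have rm : 4 * (r * (h.+1).*2.+1) <= 2 * m by rewrite /m /h; move: L2; clear; nia.
pose ls := sort geq (codom l).
have pls : perm_eq (codom l) ls by rewrite perm_sym perm_sort.
have sls : size ls = r by rewrite size_sort size_codom card_ord.
have nls : sumn ls = #|H| by rewrite (card_cycles iH); apply/esym/perm_sumn.
have l3s : all (leq 3) ls.
  by rewrite all_sort; apply/allP => _ /codomP[i ->].
have [k [fk kK]] : exists k, is_f H k /\ k <= sumn (map (cost m) ls).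
  apply: is_f_exists; apply: bramble_treewidth => G BB bB oB.
  apply: (minor_of_list l3 iH pls).
  apply: (many_cycles m0 hm rm (@adj_sym G) bB (k := sumn (map (cost m) ls))) => //.
  - by move=> X /oB /ltnW /ltnW.
  - by apply: sort_sorted => x y; apply: leq_total.
  - by rewrite sls.
exists k; split=> //; have := sumn_cost m ls; rewrite nls sls.
move: kK; rewrite /m; move: (sumn _) => S; clear; nia.
Qed.

(** The constant is made abstract: as a numeral it would be expanded in real
    arithmetic. *)
Lemma cycles_treewidth_ex : exists C, forall r (H : sgraph), 3 <= r ->
  disjoint_union_of_cycles r H ->
  exists k, is_f H k /\ 2 * k <= 3 * #|H| + r + C * (r * r * up_log 2 r).
Proof. by exists 2048; exact: cycles_treewidth. Qed.

Lemma two_cycles_treewidth (H : sgraph) s : 0 < s -> #|H| + 4 <= s * s ->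
  disjoint_union_of_cycles 2 H -> exists k, is_f H k /\ k <= #|H| + 4 * s + 2.
Proof.
move=> s0 ns [l [l3 iH]].
have nE := card_cycles iH; have cl : codom l = [:: l ord0; l ord_max].
  by rewrite /codom /image_mem enum_ordSl enum_ordSl enum_ord0 /=; congr [:: _; l _]; apply: val_inj.
have [l1 [l2 [pls l21 l23]]] : exists l1 l2, [/\ perm_eq (codom l) [:: l1; l2], l2 <= l1 & 3 <= l2].
  have [h|/ltnW h] := leqP (l ord0) (l ord_max).
    exists (l ord_max), (l ord0); split; rewrite // cl.
    by rewrite -[X in perm_eq _ X]/(rot 1 [:: l ord0; l ord_max]) perm_sym perm_rot.
  by exists (l ord0), (l ord_max); split; rewrite // cl.
have n12 : #|H| = l1 + l2 by rewrite nE (perm_sumn pls) /= addn0.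
(* With p = s rows, 2 j p >= s ^ 2 / 2 >= n / 2 + 2 >= l2. *)
pose j := (s + 3) %/ 4.
have [j4 j4'] : s <= 4 * j /\ 4 * j <= s + 3 by rewrite /j; clear; lia.
have [k [fk kK]] : exists k, is_f H k /\ k <= l1 + l2 + 8 * j + 2 * s - 4.
  apply: is_f_exists; apply: bramble_treewidth => G BB bB oB.
  apply: (minor_of_list l3 iH pls).
  have [||||W1 [W2 [m1 m2 dW]]] := two_cycles (@adj_sym G) bB oB l23 l21 (j := j) (p := s) => //.
  - by move: s0 j4; clear; lia.
  - by move: n12 ns l21 j4; clear; nia.
  - by move: l23 l21; clear; lia.
  exists W1; split=> //.
  exists W2; split=> //.
  by rewrite subsetD subsetT disjoint_sym.
by exists k; split=> //; move: kK j4' l23 l21; rewrite n12; clear; lia.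
Qed.
End Final.
(** * Logarithms and square roots *)

Import Order.TTheory GRing.Theory Num.Theory.
Local Open Scope ring_scope.

Section RealBounds.
Variable R : realType.

(** This is ln (1 + x) <= x at x = - 1 / 2. *)
Lemma ln2_ge_half : 1 / 2 <= ln (2 : R).
Proof.
have := @le_ln1Dx R (- (1 / 2)); rewrite (_ : 1 + - (1 / 2) = 2^-1); last by lra.
rewrite lnV ?posrE //; last by lra.
Qed.

(** The least L with r <= 2 ^ L satisfies (L - 1) * ln 2 <= ln r. *)
Lemma up_log_le_ln (r : nat) : (2 <= r)%N -> (up_log 2 r)%:R <= 4 * ln (r%:R : R).
Proof.
move=> r2; have lr : ln (2 : R) <= ln (r%:R : R).
  by rewrite ler_ln ?posrE ?ltr0n ?ler_nat //; lia.
have r0 : 0 < r%:R :> R by rewrite ltr0n; lia.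
have L1 : (2 ^ (up_log 2 r).-1 < r)%N by apply: up_log_gtn.
have h : (up_log 2 r).-1%:R * ln (2 : R) <= ln (r%:R : R).
  rewrite mulr_natl -lnXn //.
  by rewrite ler_ln ?posrE ?exprn_gt0 // -natrX ler_nat ltnW.
have := ln2_ge_half.
have : (up_log 2 r)%:R = (up_log 2 r).-1%:R + 1 :> R.
  rewrite natr1 prednK // up_log_gt0; lia.
move: h lr; move: (ln (2 : R)) (ln (r%:R : R)) ((up_log 2 r).-1) => a b n h ab -> a2.
have n0 : 0 <= n%:R :> R by [].
nra.
Qed.
End RealBounds.

Theorem theorem1p3 (R : realType) :
  (exists c : R, forall (r : nat) (H : sgraph),
     (3 <= r)%N -> disjoint_union_of_cycles r H ->
     exists k : nat, is_f H k /\
       k%:R <= 3 * #|H|%:R / 2 + c * r%:R ^+ 2 * ln (r%:R : R))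
  /\
  (forall H : sgraph, disjoint_union_of_cycles 2 H ->
     exists k : nat, is_f H k /\
       k%:R < #|H|%:R
              + 9 / 2 * (Num.ceil (Num.sqrt ((4 + #|H|)%:R : R)))%:~R
              + 2 :> R).
Proof.
split.
  have [C hC] := cycles_treewidth_ex; exists (2 * C%:R + 1) => r H r3 cH.
  have [k [fk kb]] := hC r H r3 cH; exists k; split=> //.
  have r2 : (2 <= r)%N by lia.
  have hL := up_log_le_ln R r2.
  have lr : 1 / 2 <= ln (r%:R : R).
    by apply: le_trans (ln2_ge_half R) _; rewrite ler_ln ?posrE ?ltr0n ?ler_nat //; lia.
  have {kb} : 2 * k%:R <= 3 * #|H|%:R + r%:R + C%:R * (r%:R * r%:R * (up_log 2 r)%:R) :> R.
    by rewrite -!natrM -!natrD ler_nat.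
  have r1 : 1 <= r%:R :> R by rewrite ler1n; lia.
  have C0 : 0 <= C%:R :> R by [].
  move: hL lr r1 C0; rewrite expr2.
  move: (ln (r%:R : R)) => b.
  move: ((up_log 2 r)%:R : R) (#|H|%:R : R) (k%:R : R) (r%:R : R) (C%:R : R) => L n K x c hL b2 x1 c0 kb.
  have h1 : c * (x * x * L) <= c * (x * x * (4 * b)).
    by apply: ler_wpM2l => //; apply: ler_wpM2l => //; nra.
  have h2 : x <= x * x * (2 * b) by nra.
  by lra.
move=> H cH; set c := Num.ceil _; pose s := `|c|%N.
have sq0 : 0 < Num.sqrt ((4 + #|H|)%:R : R) by rewrite sqrtr_gt0 ltr0n.
have c0 : 0 < c by rewrite /c ceil_gt0.
have cE : c = s%:Z by rewrite /s gez0_abs // ltW.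
have s0 : (0 < s)%N by rewrite -ltz_nat -cE.
have hs : Num.sqrt ((4 + #|H|)%:R : R) <= s%:R.
  by have := ceil_ge (Num.sqrt ((4 + #|H|)%:R : R)); rewrite -/c cE.
have ns : (#|H| + 4 <= s * s)%N.
  rewrite -(ler_nat R) natrM addnC -[X in X <= _]sqr_sqrtr ?ler0n // expr2.
  by apply: ler_pM => //; rewrite sqrtr_ge0.
have [k [fk kb]] := two_cycles_treewidth s0 ns cH; exists k; split=> //.
rewrite cE; have {kb} : k%:R <= #|H|%:R + 4 * s%:R + 2 :> R.
  by rewrite -natrM -!natrD ler_nat.
have : 0 < s%:R :> R by rewrite ltr0n.
change ((s%:Z)%:~R : R) with (s%:R : R).
move: (s%:R : R) (k%:R : R) (#|H|%:R : R) => x K n; lra.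
Qed.
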